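(* Let $\Gamma\subset\mathrm{SL}_2(\mathbb{R})$ be a Fuchsian group acting freely and properly discontinuously on $\mathbb{H}$, and let $k$ be an integer. The map $$\mathrm{Z}^1(\Gamma,\mathbb{D}_k)\longrightarrow\bigoplus_{i=1}^n\mathrm{Z}^1(\Gamma,\mathfrak{d}_k),\qquad A_\bullet\longmapsto(a_{\bullet,1},\dots,a_{\bullet,n}),$$ where $a_{\gamma,i}$ is the coefficient of $\rho_i$ in $A_\gamma$, is surjective. That is, given $a_{\bullet,i}\in\mathrm{Z}^1(\Gamma,\mathfrak{d}_k)$ for $i=1,\dots,n$, there exists $A_\bullet\in\mathrm{Z}^1(\Gamma,\mathbb{D}_k)$ with $A_\bullet=1+\sum_{i=1}^n a_{\bullet,i}\rho_i+O(\rho^2)$.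
   Context: $j_\gamma(\tau)=c\tau+d$. $\Gamma$ acts on power series in commuting variables $\rho_1,\dots,\rho_n$ with coefficients in linear differential operators on $\mathbb{H}$ by $(A\|_k\gamma)(\tau,\partial_\tau)=j_\gamma(\tau)^{-k}A(\gamma\tau,\partial_{\gamma\tau})j_\gamma(\tau)^k$, $\partial_{\gamma\tau}=j_\gamma(\tau)^2\partial_\tau$. $\mathfrak{d}_k=\{2p\partial_\tau+kp':p\in\mathbb{C}[\tau],\deg p\le2\}$ (a $\Gamma$-module and Lie algebra under commutator). $\mathrm{Z}^1(\Gamma,\mathfrak{d}_k)$ is the set of maps $a:\Gamma\to\mathfrak{d}_k$ with $a_{\gamma\delta}=a_\gamma\|_k\delta+a_\delta$. $\mathfrak{d}_k^\rho=(\rho)\mathfrak{d}_k[[\rho_1,\dots,\rho_n]]$ where $(\rho)$ is the ideal generated by the $\rho_i$, $\mathbb{D}_k=\exp(\mathfrak{d}_k^\rho)$, and $\mathrm{Z}^1(\Gamma,\mathbb{D}_k)$ is the set of maps $A:\Gamma\to\mathbb{D}_k$ with $A_{\gamma\delta}=(A_\gamma\|_k\delta)A_\delta$. $O(\rho^2)$ denotes terms in $(\rho)^2$. *)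

(* Defs.v *)
From HB Require Import structures.
From mathcomp Require Import all_boot all_order all_algebra.
From mathcomp Require Import fraction.
From mathcomp Require Import all_classical all_reals.
From mathcomp Require Import topology normedtype.
From mathcomp.real_closed Require Import complex.

Set Implicit Arguments.
Unset Strict Implicit.
Unset Printing Implicit Defensive.

Import Order.TTheory GRing.Theory Num.Theory.
Import numFieldNormedType.Exports.
Local Open Scope ring_scope.
Local Open Scope classical_set_scope.

Section FuchsianDefs.
Variable R : realType.

Local Notation C := (R[i]).
Local Notation K := {fraction {poly C}}.

Definition rC (x : R) : C := Complex x 0.

Definition ga (g : 'M[R]_2) : R := g ord0 ord0.
Definition gb (g : 'M[R]_2) : R := g ord0 ord_max.
Definition gc (g : 'M[R]_2) : R := g ord_max ord0.
Definition gd (g : 'M[R]_2) : R := g ord_max ord_max.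

Definition mobius (g : 'M[R]_2) (z : C) : C :=
  (rC (ga g) * z + rC (gb g)) / (rC (gc g) * z + rC (gd g)).

Definition upper_half (z : C) : Prop := 0 < complex.Im z.

Definition subgroup_SL2 (G : set 'M[R]_2) : Prop :=
  [/\ G 1%:M,
      (forall g, G g -> \det g = 1),
      (forall g h, G g -> G h -> G (g *m h)) &
      (forall g, G g -> G (invmx g))].

Definition discrete_SL2 (G : set 'M[R]_2) : Prop :=
  forall g, G g -> exists2 e : R, 0 < e &
    forall h, G h -> (forall i j, `|h i j - g i j| < e) -> h = g.

Definition fuchsian (G : set 'M[R]_2) : Prop := subgroup_SL2 G /\ discrete_SL2 G.

Definition acts_freely (G : set 'M[R]_2) : Prop :=
  forall g, G g -> forall z, upper_half z -> mobius g z = z -> g = 1%:M.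

Definition acts_properly_discontinuously (G : set 'M[R]_2) : Prop :=
  forall S : set (R * R), compact S -> (forall p, S p -> 0 < p.2) ->
    finite_set [set g | G g /\ exists p q, [/\ S p, S q &
       mobius g (Complex p.1 p.2) = Complex q.1 q.2]].

Definition tof (p : {poly C}) : K := @tofrac _ p.

Definition cK (c : C) : K := tof c%:P.

Definition dK (x : K) : K :=
  let r := repr x in
  (tof (\n_r)^`() * tof \d_r - tof \n_r * tof (\d_r)^`()) / (tof \d_r) ^+ 2.

Definition jK (g : 'M[R]_2) : K := tof (rC (gc g) *: 'X + (rC (gd g))%:P).

Definition mobK (g : 'M[R]_2) : K :=
  tof (rC (ga g) *: 'X + (rC (gb g))%:P) / jK g.

Definition pbK (g : 'M[R]_2) (x : K) : K :=
  let r := repr x in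
  (map_poly cK \n_r).[mobK g] / (map_poly cK \d_r).[mobK g].

(* operators act on C(tau); the product is composition *)
Definition Op := K -> K.

(* (A ||_k g)(tau, d_tau) = j^{-k} A(g tau, d_{g tau}) j^k, i.e. the
   conjugate  M_{j^-k} o phi_g o A o phi_g^{-1} o M_{j^k}  *)
Definition slashOp (k : int) (A : Op) (g : 'M[R]_2) : Op :=
  fun f => (jK g) ^ (- k) * pbK g (A (pbK (invmx g) ((jK g) ^ k * f))).

Definition opd (k : int) (p : {poly C}) : Op :=
  fun f => 2%:R * tof p * dK f + k%:~R * tof p^`() * f.

Definition in_dk (k : int) (A : Op) : Prop :=
  exists2 p : {poly C}, (size p <= 3)%N & A = opd k p.

Definition mi (n : nat) := 'I_n -> nat.
Definition mi0 (n : nat) : mi n := fun _ => 0%N.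
Arguments mi0 n : clear implicits.
Definition mi_unit (n : nat) (i : 'I_n) : mi n := fun j => (j == i : nat).
Definition mdeg (n : nat) (a : mi n) : nat := (\sum_(i < n) a i)%N.

Definition series (n : nat) := mi n -> Op.

(* Cauchy product (rho's commute with everything) *)
Definition smul (n : nat) (F G : series n) : series n :=
  fun a f => \sum_(b : {ffun 'I_n -> 'I_(mdeg a).+1} | [forall i, (b i <= a i)%N])
               F (fun i => nat_of_ord (b i)) (G (fun i => (a i - b i)%N) f).

Definition sone (n : nat) : series n :=
  fun a f => if [forall i, a i == 0%N] then f else 0.

Arguments sone n : clear implicits.

Definition spow (n : nat) (X : series n) (m : nat) : series n :=
  iter m (smul X) (sone n).

(* exp X = sum_m X^m / m!  (well defined for X in (rho)) *)
Definition sexp (n : nat) (X : series n) : series n :=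
  fun a f => \sum_(m < (mdeg a).+1) (m`!%:R)^-1 * spow X m a f.

Definition dk_rho (k : int) (n : nat) (X : series n) : Prop :=
  X (mi0 n) = (fun _ => 0) /\ forall a, in_dk k (X a).

Definition Dk (k : int) (n : nat) : set (series n) :=
  [set F | exists2 X, dk_rho k X & F = sexp X].

Arguments Dk k n : clear implicits.

Definition sslash (k : int) (n : nat) (F : series n) (g : 'M[R]_2) : series n :=
  fun a => slashOp k (F a) g.

Definition Z1_dk (G : set 'M[R]_2) (k : int) (a : 'M[R]_2 -> Op) : Prop :=
  (forall g, G g -> in_dk k (a g)) /\
  (forall g h, G g -> G h ->
     a (g *m h) = (fun f => slashOp k (a g) h f + a h f)).

Definition Z1_Dk (G : set 'M[R]_2) (k : int) (n : nat)
    (A : 'M[R]_2 -> series n) : Prop :=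
  (forall g, G g -> Dk k n (A g)) /\
  (forall g h, G g -> G h -> A (g *m h) = smul (sslash k (A g) h) (A h)).

End FuchsianDefs.

Arguments mi0 n : clear implicits.
Arguments sone {R} n.
Arguments Dk {R} k n.

(* Main.v *)
(** A cocycle is built degree by degree in the rho_i.  If X is a cochain in d_k^rho whose
    exponential A is a cocycle modulo (rho)^m, then the degree m part y(g,h) of
    (A_g|h) A_h A_gh^-1 is a 2-cocycle, and X can be corrected in degree m as soon as y
    is a coboundary.  That y takes values in d_k does not need the Baker-Campbell-Hausdorff
    formula: if F is a product of exponentials of d_k^rho and eps is the Euler operator of
    the rho_i, then F^-1 eps F - eps lies in d_k^rho, and for F = 1 + f with f of order m
    it is congruent to m f modulo order m + 1.

    It remains to see that H^2(Gamma, d_k) = 0.  As a module, d_k is V + iV with V the real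
    binary quadratic forms, and the cone of positive definite forms models the upper
    half-plane.  By extension of linear functionals it is enough that a finite chain
    on which all coboundaries vanish also annihilates every 2-cocycle.  A cocycle becomes an
    equivariant cochain T on triples of positive definite forms; stabilisers of lines are
    trivial or infinite cyclic, so an equivariant coboundary makes T vanish on collinear
    triples, and then T is additive under dissection of triangles.  Cut along bisectors, the
    chain is transported into one Dirichlet domain.  Its degree at a point w, with values
    in V*, is the same for all generic w, so it is an invariant linear form l.  If l did not
    vanish, the translates of the compact support of the chain would cover all forms of
    discriminant one, and l would be bounded on these, which is impossible.  Finally an
    additive cochain annihilates a chain of generic degree zero. *)
Require Import Defs.
From HB Require Import structures.
From mathcomp Require Import all_boot all_order all_algebra.
From mathcomp Require Import fraction.
From mathcomp Require Import all_classical all_reals.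
From mathcomp Require Import topology normedtype.
From mathcomp.real_closed Require Import complex.
From mathcomp Require lebesgue_measure.
From mathcomp Require Import ring lra zify.

Set Implicit Arguments.
Unset Strict Implicit.
Unset Printing Implicit Defensive.
Import Order.TTheory GRing.Theory Num.Theory.
Import numFieldNormedType.Exports.

Local Open Scope ring_scope.
Local Open Scope classical_set_scope.

(** * Binary quadratic forms and degrees of triangles *)

(** No finiteness of $\Gamma$ is assumed: it may be infinitely generated with non-compact quotient,
    so neither a finite presentation nor a finite triangulation is at hand. This is why a cocycle is
    tested against finite chains by duality: each test involves finitely many triangles, and
    properness leaves finitely many translates to count. Forms replace points of the half-plane
    because their geometry is linear: lines become planes through 0, the side on which a point lies
    is the sign of a determinant, bisectors are kernels of linear forms, and geometric facts become
    polynomial identities and inequalities. That V* has no invariants cannot be the last argument,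
    since for trivial or cyclic $\Gamma$ there are some; hence the comparison of sizes for forms
    near the boundary of the cone. Freeness enters twice: it makes the group act freely on rays of
    forms, and it excludes -1, which fixes every form, so that stabilisers of lines have no torsion.
    Points in special position lie on countably many planes; they are avoided by choosing a small
    parameter outside a countable set. *)

Lemma countable_avoid (R : realType) (A : set R) (e : R) : countable A -> 0 < e ->
  exists2 x, 0 < x < e & ~ A x.
Proof.
move=> cA e0; apply: contrapT => no.
have sub : `]0, e[%classic `<=` A.
  move=> x /=; rewrite in_itv /= => hx; apply: contrapT => nA; apply: no.
  by exists x.
have := lebesgue_measure.countable_lebesgue_measure0 (sub_countable (subset_card_le sub) cA).
rewrite lebesgue_measure.lebesgue_measure_itv /= lte_fin e0 EFinN oppe0 adde0 => /eqP.
by rewrite eqe gt_eqF.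
Qed.

Section Forms.
Variable R : realType.
Local Notation V := (R * R * R)%type.
Implicit Types (x y z w : V) (g h : 'M[R]_2).

(* (A, B, C) stands for the binary quadratic form A u^2 + B u v + C v^2, and
   [fact x g] for its pull-back along the linear substitution g. *)
Definition fact x g : V :=
  (x.1.1 * ga g ^+ 2 + x.1.2 * (ga g * gc g) + x.2 * gc g ^+ 2,
   x.1.1 * (2 * (ga g * gb g)) + x.1.2 * (ga g * gd g + gb g * gc g)
     + x.2 * (2 * (gc g * gd g)),
   x.1.1 * gb g ^+ 2 + x.1.2 * (gb g * gd g) + x.2 * gd g ^+ 2).

Definition disc x : R := 4 * (x.1.1 * x.2) - x.1.2 ^+ 2.
(** The polar form of [disc], normalised so that [bil x x = disc x]; its signature is (1, 2). *)
Definition bil x y : R := 2 * (x.1.1 * y.2) + 2 * (y.1.1 * x.2) - x.1.2 * y.1.2.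
Definition det3 x y z : R :=
  x.1.1 * (y.1.2 * z.2 - y.2 * z.1.2) - x.1.2 * (y.1.1 * z.2 - y.2 * z.1.1)
  + x.2 * (y.1.1 * z.1.2 - y.1.2 * z.1.1).
Definition vscale (t : R) x : V := (t * x.1.1, t * x.1.2, t * x.2).
Definition dot x y : R := x.1.1 * y.1.1 + x.1.2 * y.1.2 + x.2 * y.2.
Definition cross x y : V :=
  (x.1.2 * y.2 - x.2 * y.1.2, x.2 * y.1.1 - x.1.1 * y.2,
   x.1.1 * y.1.2 - x.1.2 * y.1.1).

Definition pcone x : Prop := 0 < x.1.1 /\ 0 < disc x.

Lemma det2E g : \det g = ga g * gd g - gb g * gc g.
Proof.
rewrite (expand_det_row _ ord0) big_ord_recl big_ord1 /cofactor !det_mx11 !mxE /=.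
rewrite /ga /gb /gc /gd.
rewrite (_ : lift ord0 ord0 = ord_max); last exact: val_inj.
rewrite (_ : lift ord_max 0 = ord0); last exact: val_inj.
by rewrite /= expr0 expr1; ring.
Qed.

Lemma mul2E g h :
  [/\ ga (g *m h) = ga g * ga h + gb g * gc h,
      gb (g *m h) = ga g * gb h + gb g * gd h,
      gc (g *m h) = gc g * ga h + gd g * gc h &
      gd (g *m h) = gc g * gb h + gd g * gd h].
Proof.
rewrite /ga /gb /gc /gd.
have e : lift ord0 ord0 = ord_max :> 'I_2 by exact: val_inj.
by split; rewrite mxE !big_ord_recl big_ord0 addr0 e.
Qed.

Lemma fact_mul x g h : fact x (g *m h) = fact (fact x g) h.
Proof. by rewrite /fact; have [-> -> -> ->] := mul2E g h; congr (_, _, _) => /=; ring. Qed.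

Lemma fact1 x : fact x 1%:M = x.
Proof.
by case: x => [[A B] C]; rewrite /fact /ga /gb /gc /gd !mxE /=; congr (_, _, _); ring.
Qed.

Lemma factD x y g : fact (x + y) g = fact x g + fact y g.
Proof. by congr (_, _, _) => /=; ring. Qed.

Lemma factZ t x g : fact (vscale t x) g = vscale t (fact x g).
Proof. by congr (_, _, _) => /=; ring. Qed.

Lemma disc_fact x g : disc (fact x g) = (\det g) ^+ 2 * disc x.
Proof. by rewrite det2E /disc /=; ring. Qed.

Lemma bil_fact x y g : bil (fact x g) (fact y g) = (\det g) ^+ 2 * bil x y.
Proof. by rewrite det2E /bil /=; ring. Qed.

Lemma det3_fact x y z g :
  det3 (fact x g) (fact y g) (fact z g) = (\det g) ^+ 3 * det3 x y z.
Proof. by rewrite det2E /det3 /=; ring. Qed.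

Lemma dot_cross w x y : dot (cross x y) w = det3 w x y.
Proof. by rewrite /dot /det3 /=; ring. Qed.

Lemma pcone_gt0 x : pcone x -> 0 < x.1.1 /\ 0 < x.2.
Proof.
rewrite /pcone /disc; case: x => [[A B] C] /= [A0 d]; split=> //.
have : 0 < A * C by nra.
by rewrite pmulr_rgt0.
Qed.

(** The reversed Cauchy-Schwarz inequality in signature (1, 2): (BB')^2 < 16 AC A'C' <= (2AC' +
    2A'C)^2. *)
Lemma bil_gt0 x y : pcone x -> pcone y -> 0 < bil x y.
Proof.
move=> hx hy; have [a c] := pcone_gt0 hx; have [a' c'] := pcone_gt0 hy.
move: hx hy a c a' c'; rewrite /pcone /disc /bil.
case: x => [[A B] C]; case: y => [[A' B'] C'] /= [_ d] [_ d'] a c a' c'.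
have h1 : (B * B') ^+ 2 < (2 * (A * C') + 2 * (A' * C)) ^+ 2.
  have e : B ^+ 2 * B' ^+ 2 < (4 * (A * C)) * (4 * (A' * C')).
    apply: ltr_pM; rewrite ?sqr_ge0 //; lra.
  have := sqr_ge0 (2 * (A * C') - 2 * (A' * C)); rewrite exprMn; nra.
have h2 : 0 < 2 * (A * C') + 2 * (A' * C) by rewrite addr_gt0 ?mulr_gt0.
rewrite -subr_gt0 in h1.
have [//|le0] := ltrP 0 (2 * (A * C') + 2 * (A' * C) - B * B').
have : 0 < 2 * (A * C') + 2 * (A' * C) + B * B' by lra.
nra.
Qed.

Lemma pconeD x y : pcone x -> pcone y -> pcone (x + y).
Proof.
move=> hx hy; have := bil_gt0 hx hy; move: hx hy; rewrite /pcone /disc /bil.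
case: x => [[A B] C]; case: y => [[A' B'] C'] /= [a d] [a' d'] b.
by split; [lra | nra].
Qed.

Lemma pconeZ t x : 0 < t -> pcone x -> pcone (vscale t x).
Proof.
rewrite /pcone /disc; case: x => [[A B] C] /= t0 [a d]; split; first exact: mulr_gt0.
rewrite (_ : _ - _ = t ^+ 2 * (4 * (A * C) - B ^+ 2)); last by ring.
by rewrite mulr_gt0 // exprn_gt0.
Qed.

Lemma pcone_fact x g : \det g = 1 -> pcone x -> pcone (fact x g).
Proof.
move=> dg hx; split; last by rewrite disc_fact dg expr1n mul1r; case: hx.
have [a c] := pcone_gt0 hx; have /= := hx.2; move: a c dg; rewrite det2E /disc /=.
case: x hx => [[A B] C] /= _; set p := ga g; set q := gc g => A0 C0 dg d.
have pq : (p != 0) || (q != 0).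
  apply/negPn; rewrite negb_or !negbK; apply/negP => /andP[/eqP p0 /eqP q0].
  by move: dg; rewrite p0 q0 mul0r mulr0 subrr => /eqP; rewrite eq_sym oner_eq0.
(* Multiplied by 4A, the new leading coefficient is completed to a sum of squares. *)
rewrite -(pmulr_rgt0 _ (_ : 0 < 4 * A)); last by rewrite mulr_gt0.
rewrite [ltRHS](_ : _ = (2 * A * p + B * q) ^+ 2 + (4 * (A * C) - B ^+ 2) * q ^+ 2); last by ring.
have [q0|q0] := eqVneq q 0; last first.
  by rewrite ltr_wpDl ?sqr_ge0 // mulr_gt0 // exprn_even_gt0.
have p0 : p != 0 by move: pq; rewrite q0 eqxx orbF.
rewrite q0 mulr0 addr0 expr0n mulr0 addr0 exprn_even_gt0 //=.
by rewrite !mulf_neq0 ?pnatr_eq0 // gt_eqF.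
Qed.

End Forms.

(** * The degree of a triangle at a point, and its jump along a segment *)

Section Degree.
Variable R : realType.
Local Notation V := (R * R * R)%type.
Implicit Types (x y z w : V) (a b c t : R).

Lemma vec_eqP x y :
  x.1.1 = y.1.1 -> x.1.2 = y.1.2 -> x.2 = y.2 -> x = y.
Proof. by case: x => [[? ?] ?]; case: y => [[? ?] ?] /= -> -> ->. Qed.

Definition par x y := cross x y = 0.

Lemma parP x y : pcone x -> pcone y -> par x y -> exists2 t, 0 < t & y = vscale t x.
Proof.
move=> hx hy [/= e1 e2 e3].
have [ax cx] := pcone_gt0 hx; have [ay cy] := pcone_gt0 hy.
exists (y.1.1 / x.1.1); first exact: divr_gt0.
have nx : x.1.1 != 0 by rewrite gt_eqF.
apply: vec_eqP => /=; first by rewrite divfK.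
- by apply: (mulfI nx); rewrite mulrCA mulrA divfK //; lra.
- by apply: (mulfI nx); rewrite mulrCA mulrA divfK //; lra.
Qed.

Lemma det3_nil w x y : par x y -> det3 w x y = 0.
Proof. by rewrite -dot_cross => ->; rewrite /dot /= !mul0r !addr0. Qed.

Lemma det3_perm x y z : det3 y z x = det3 x y z.
Proof. by rewrite /det3; ring. Qed.

Lemma det3_swap x y z : det3 x z y = - det3 x y z.
Proof. by rewrite /det3; ring. Qed.

(** Applied to barycentric coordinates up to a common factor, this separates the sign patterns of a
    point outside a triangle from those of a point inside or on its boundary. *)
Lemma sg3P a b c :
  [\/ Num.sg a + Num.sg b + Num.sg c + Num.sg a * Num.sg b * Num.sg c = 0,
      [/\ 0 <= a, 0 <= b, 0 <= c & 0 < a + b + c] |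
      [/\ a <= 0, b <= 0, c <= 0 & a + b + c < 0]].
Proof.
case: (sgrP a) => [->|a0|a0]; case: (sgrP b) => [->|b0|b0]; case: (sgrP c) => [->|c0|c0];
  rewrite ?ltxx;
  solve [ by constructor 1; ring
        | by constructor 2; split; lra
        | by constructor 3; split; lra].
Qed.

Lemma sg3_eq0 a b c a' b' c' : 0 < a' -> 0 < b' -> 0 < c' ->
  a * a' + b * b' + c * c' = 0 ->
  Num.sg a + Num.sg b + Num.sg c + Num.sg a * Num.sg b * Num.sg c = 0.
Proof.
move=> a0 b0 c0 e; case: (sg3P a b c) => // [[ha hb hc s]|[ha hb hc s]].
- have [h1|h1] := lerP a 0; last first.
    have := mulr_gt0 h1 a0; have := mulr_ge0 hb (ltW b0); have := mulr_ge0 hc (ltW c0); lra.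
  have [h2|h2] := lerP b 0; last first.
    have := mulr_gt0 h2 b0; have := mulr_ge0 ha (ltW a0); have := mulr_ge0 hc (ltW c0); lra.
  have h3 : 0 < c by lra.
  have := mulr_gt0 h3 c0; have := mulr_ge0 ha (ltW a0); have := mulr_ge0 hb (ltW b0); lra.
- have [h1|h1] := lerP 0 a; last first.
    have : a * a' < 0 by rewrite nmulr_rlt0.
    have := mulr_le0_ge0 hb (ltW b0); have := mulr_le0_ge0 hc (ltW c0); lra.
  have [h2|h2] := lerP 0 b; last first.
    have : b * b' < 0 by rewrite nmulr_rlt0.
    have := mulr_le0_ge0 ha (ltW a0); have := mulr_le0_ge0 hc (ltW c0); lra.
  have h3 : c < 0 by lra.
  have : c * c' < 0 by rewrite nmulr_rlt0.
  have := mulr_le0_ge0 ha (ltW a0); have := mulr_le0_ge0 hb (ltW b0); lra.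
Qed.

(* For a non-degenerate triangle and [w] off its sides this is the signed
   indicator of the triangle; the closed formula makes it a cochain that can
   be compared by pure sign computations. *)
Definition deg w x y z : R :=
  let p := Num.sg (det3 w x y) in let q := Num.sg (det3 w y z) in
  let r := Num.sg (det3 w z x) in (p + q + r + p * q * r) / 4.

Lemma bary w x y z :
  vscale (det3 x y z) w =
  vscale (det3 w y z) x + vscale (det3 w z x) y + vscale (det3 w x y) z.
Proof. by rewrite /vscale /det3; apply: vec_eqP => /=; ring. Qed.

Lemma bilD e x y : bil e (x + y) = bil e x + bil e y.
Proof. by rewrite /bil /=; ring. Qed.

Lemma bilZ e t x : bil e (vscale t x) = t * bil e x.
Proof. by rewrite /bil /=; ring. Qed.

(** Pairing Cramer's relation [bary] with [x] gives a linear relation between the three determinants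
    whose coefficients are positive, since [bil] is positive on the cone; such signs cancel. *)
Lemma deg_flat w x y z : pcone x -> pcone y -> pcone z -> det3 x y z = 0 ->
  deg w x y z = 0.
Proof.
move=> hx hy hz e; rewrite /deg; apply/eqP; rewrite mulf_eq0; apply/orP; left; apply/eqP.
apply: (@sg3_eq0 _ _ _ (bil x z) (bil x x) (bil x y)); [exact: bil_gt0..|].
have := congr1 (bil x) (bary w x y z); rewrite e !bilD !bilZ mul0r; lra.
Qed.

Lemma deg_hull w x y z : pcone w -> pcone x -> pcone y -> pcone z ->
  det3 x y z != 0 -> deg w x y z != 0 ->
  exists a b c, [/\ 0 <= a, 0 <= b, 0 <= c &
                    w = vscale a x + vscale b y + vscale c z].
Proof.
move=> hw hx hy hz D0; rewrite /deg mulf_eq0 negb_or => /andP[s0 _].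
set D := det3 x y z in D0 *.
have eB : w = vscale (det3 w y z / D) x + vscale (det3 w z x / D) y + vscale (det3 w x y / D) z.
  have := bary w x y z; rewrite -/D => -[/= h1 h2 h3].
  by apply: vec_eqP => /=; apply: (mulfI D0); rewrite ?h1 ?h2 ?h3; field.
exists (det3 w y z / D), (det3 w z x / D), (det3 w x y / D).
suff H : [/\ 0 <= det3 w y z / D, 0 <= det3 w z x / D & 0 <= det3 w x y / D].
  by case: H => *; split.
(* Coordinates that are all non-positive are impossible: pairing with [w] would give
   [bil w w <= 0]. *)
have key a b c : (0 <= a /\ 0 <= b /\ 0 <= c) \/ (a <= 0 /\ b <= 0 /\ c <= 0) ->
    w = vscale a x + vscale b y + vscale c z -> [/\ 0 <= a, 0 <= b & 0 <= c].
  move=> [[? [? ?]]|[a0 [b0 c0]]] // e; exfalso.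
  have := bil_gt0 hw hw; rewrite {2}e !bilD !bilZ.
  have := mulr_le0_ge0 a0 (ltW (bil_gt0 hw hx)).
  have := mulr_le0_ge0 b0 (ltW (bil_gt0 hw hy)).
  have := mulr_le0_ge0 c0 (ltW (bil_gt0 hw hz)); lra.
apply: key eB.
have [Dp|Dn|De] := ltgtP D 0; last by rewrite De eqxx in D0.
- have i0 : D^-1 <= 0 by rewrite invr_le0 ltW.
  case: (sg3P (det3 w x y) (det3 w y z) (det3 w z x)) => [e|[? ? ? _]|[? ? ? _]].
  + by rewrite e eqxx in s0.
  + by right; rewrite !mulr_ge0_le0.
  + by left; rewrite !mulr_le0.
- have i0 : 0 <= D^-1 by rewrite invr_ge0 ltW.
  case: (sg3P (det3 w x y) (det3 w y z) (det3 w z x)) => [e|[? ? ? _]|[? ? ? _]].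
  + by rewrite e eqxx in s0.
  + by left; rewrite !mulr_ge0.
  + by right; rewrite !mulr_le0_ge0.
Qed.

Lemma deg_rot w x y z : deg w y z x = deg w x y z.
Proof. by rewrite /deg; congr (_ / _); ring. Qed.

Lemma sg_cases a : a != 0 -> Num.sg a = 1 \/ Num.sg a = -1.
Proof.
by move=> n; have [l|l|e] := ltrgt0P a; [left; exact: gtr0_sg | right; exact: ltr0_sg |
  rewrite e eqxx in n].
Qed.

Lemma deg_cut w x y z a b : 0 < a -> 0 < b ->
  let m := vscale a x + vscale b y in
  det3 w x y != 0 -> det3 w y z != 0 -> det3 w z x != 0 -> det3 w m z != 0 ->
  deg w x y z = deg w x m z + deg w m y z.
Proof.
move=> a0 b0 m p0 q0 r0 u0; rewrite /deg.
rewrite [det3 w x m](_ : _ = b * det3 w x y); last by rewrite /det3 /=; ring.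
rewrite [det3 w m y](_ : _ = a * det3 w x y); last by rewrite /det3 /=; ring.
rewrite [det3 w z m]det3_swap.
rewrite !sgrM sgrN (gtr0_sg a0) (gtr0_sg b0) !mul1r.
have e : det3 w m z = - a * det3 w z x + b * det3 w y z by rewrite /det3 /=; ring.
(* If the two old determinants have opposite signs, the new one inherits its sign; if they agree,
   the identity holds for either sign of the new one. *)
have key : Num.sg (det3 w z x) = - Num.sg (det3 w y z) -> Num.sg (det3 w m z) = Num.sg (det3 w y z).
  move=> h; move: e; have [h1|h1] := sg_cases q0.
  - rewrite h1; rewrite h1 in h; move/eqP: h1; move/eqP: h; rewrite sgr_cp0 sgr_cp0 => h h1 e.
    apply/eqP; rewrite sgr_cp0 e; apply: addr_gt0; last exact: mulr_gt0.
    by rewrite nmulr_rgt0 ?oppr_lt0.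
  - rewrite h1; rewrite h1 opprK in h; move/eqP: h1; move/eqP: h; rewrite !sgr_cp0 => h h1 e.
    apply/eqP; rewrite sgr_cp0 e -oppr_gt0 opprD; apply: addr_gt0.
      by rewrite mulNr opprK mulr_gt0.
    by rewrite oppr_gt0 pmulr_rlt0.
rewrite -mulrDl; congr (_ / _); move: key.
have [->|->] := sg_cases p0; have [->|->] := sg_cases q0; have [->|->] := sg_cases r0;
  have [->|->] := sg_cases u0 => key; try ring.
all: by have := key (ltac:(ring)); lra.
Qed.

(** A sign that never vanishes: a point in the plane of [w] and [w'] counts as lying on the positive
    side, so [icr] requires no general position with respect to that plane. *)
Definition tsg t : R := if 0 <= t then 1 else -1.

Lemma tsgM t : tsg t * t = `|t|.
Proof. by rewrite /tsg; case: ger0P => _; rewrite ?mul1r ?mulN1r. Qed.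

Lemma tsg_sq t : tsg t * tsg t = 1.
Proof. by rewrite /tsg; case: ifP => _; ring. Qed.

Lemma sg_tsg t : Num.sg (tsg t) = tsg t.
Proof. by rewrite /tsg; case: ifP => _; rewrite ?sgrN sgr1. Qed.

(** The signed crossing number of two segments: the first factor detects that [w], [w'] lie on
    different sides of the plane of [x], [y], the second that [x], [y] lie on different sides of the
    plane of [w], [w']. *)
Definition icr w w' x y : R :=
  (Num.sg (det3 w x y) - Num.sg (det3 w' x y)) *
  (1 - tsg (det3 w w' x) * tsg (det3 w w' y)) / 4.

Lemma coplanar_par w w' x y : det3 w w' x = 0 -> det3 w w' y = 0 ->
  det3 w x y != 0 -> par w w'.
Proof.
move=> e1 e2 n.
have e : vscale (det3 w x y) w' = vscale (det3 w' x y) w.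
  have h : vscale (det3 w x y) w' + vscale (det3 w w' x) y =
           vscale (det3 w' x y) w + vscale (det3 w w' y) x.
    by rewrite /det3; apply: vec_eqP => /=; ring.
  move: h; rewrite e1 e2 => -[/= ? ? ?]; apply: vec_eqP => /=; lra.
case: e => /= h1 h2 h3.
by apply: vec_eqP => /=; apply: (mulfI n); rewrite mulr0 mulrBr ![det3 w x y * (_ * _)]mulrCA
  ?h1 ?h2 ?h3; ring.
Qed.

(* Reflecting the vertices through the origin so that they all lie on one side
   of the plane of [w] and [w'] turns both degrees into 0. *)
Lemma sg3_refl w w' u x y z : ~ par w w' -> u = w \/ u = w' ->
  det3 u x y != 0 -> det3 u y z != 0 -> det3 u z x != 0 ->
  let tx := tsg (det3 w w' x) in let ty := tsg (det3 w w' y) in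
  let tz := tsg (det3 w w' z) in
  let p := Num.sg (det3 u x y) in let q := Num.sg (det3 u y z) in
  let r := Num.sg (det3 u z x) in
  p * q * r = - (p * (tx * ty) + q * (ty * tz) + r * (tz * tx)).
Proof.
move=> npar hu p0 q0 r0 tx ty tz p q r.
have := sg3P (tx * ty * det3 u x y) (ty * tz * det3 u y z) (tz * tx * det3 u z x).
have tn t : tsg t != 0 by rewrite /tsg; case: ifP => _; rewrite ?oppr_eq0 oner_eq0.
rewrite !sgrM !sg_tsg -/tx -/ty -/tz -/p -/q -/r.
have pl : tx * ty * det3 u x y * `|det3 w w' z| + ty * tz * det3 u y z * `|det3 w w' x|
   + tz * tx * det3 u z x * `|det3 w w' y| = 0.
  rewrite -!tsgM -/tx -/ty -/tz.
  have -> : tx * ty * det3 u x y * (tz * det3 w w' z) + ty * tz * det3 u y z * (tx * det3 w w' x)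
   + tz * tx * det3 u z x * (ty * det3 w w' y) = tx * ty * tz * (det3 u x y * det3 w w' z +
    det3 u y z * det3 w w' x + det3 u z x * det3 w w' y) by ring.
  by case: hu => ->; rewrite /det3; ring.
have nz : ~ [/\ det3 w w' x = 0 & det3 w w' y = 0].
  move=> [e1 e2]; apply: npar; case: hu p0 => -> p0; first exact: coplanar_par e1 e2 p0.
  have sw v : det3 w' w v = - det3 w w' v by rewrite /det3; ring.
  have [/= h1 h2 h3] : par w' w by apply: coplanar_par p0; rewrite sw ?e1 ?e2 oppr0.
  by apply: vec_eqP => /=; lra.
have nn (A B C a b c : R) : 0 <= A -> 0 <= B -> 0 <= C -> A != 0 -> B != 0 -> C != 0 ->
    0 <= a -> 0 <= b -> 0 <= c -> A * a + B * b + C * c = 0 -> a = 0 /\ b = 0.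
  move=> A0 B0 C0 An Bn Cn ha hb hc /eqP.
  rewrite paddr_eq0 ?addr_ge0 ?mulr_ge0 // paddr_eq0 ?mulr_ge0 //.
  by rewrite !mulf_eq0 (negPf An) (negPf Bn) => /andP[/andP[/eqP-> /eqP->] _].
have An : tx * ty * det3 u x y != 0 by rewrite !mulf_neq0 ?tn.
have Bn : ty * tz * det3 u y z != 0 by rewrite !mulf_neq0 ?tn.
have Cn : tz * tx * det3 u z x != 0 by rewrite !mulf_neq0 ?tn.
have fin : `|det3 w w' z| = 0 -> `|det3 w w' x| = 0 ->
    p * q * r = - (p * (tx * ty) + q * (ty * tz) + r * (tz * tx)).
  move=> e1 e2; exfalso; apply: nz; split; apply: normr0_eq0 => //.
  by move/eqP: pl; rewrite e1 e2 !mulr0 !add0r mulf_eq0 (negPf Cn) => /eqP.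
case=> [e|[A0 B0 C0 _]|[A0 B0 C0 _]].
- have ex : tx * tx = 1 by exact: tsg_sq.
  have ey : ty * ty = 1 by exact: tsg_sq.
  have ez : tz * tz = 1 by exact: tsg_sq.
  have E : tx * ty * p * (ty * tz * q) * (tz * tx * r) =
           (tx * tx) * (ty * ty) * (tz * tz) * (p * q * r) by ring.
  by move: e; rewrite E ex ey ez; lra.
- by have [e1 e2] := nn _ _ _ _ _ _ A0 B0 C0 An Bn Cn (normr_ge0 _) (normr_ge0 _)
    (normr_ge0 _) pl; exact: fin.
- have [] : `|det3 w w' z| = 0 /\ `|det3 w w' x| = 0; last exact: fin.
  apply: (nn (- (tx * ty * det3 u x y)) (- (ty * tz * det3 u y z)) (- (tz * tx * det3 u z x))
       _ _ `|det3 w w' y|); rewrite ?oppr_ge0 ?oppr_eq0 //.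
  by rewrite !mulNr -!opprD pl oppr0.
Qed.

Lemma tsgMp s t : 0 < s -> tsg (s * t) = tsg t.
Proof. by move=> s0; rewrite /tsg pmulr_rge0. Qed.

Lemma par_sym x y : par x y -> par y x.
Proof. by move=> [/= ? ? ?]; apply: vec_eqP => /=; lra. Qed.

Lemma icr_par_tri w w' x y z : pcone x -> pcone y -> par x y ->
  icr w w' x y + icr w w' y z + icr w w' z x = 0.
Proof.
move=> hx hy pxy; have [s s0 ->] := parP hx hy pxy; rewrite /icr.
have e1 u : det3 u x (vscale s x) = 0 by rewrite /det3 /=; ring.
have e2 u : det3 u (vscale s x) z = - (s * det3 u z x) by rewrite /det3 /=; ring.
have e3 u u' : det3 u u' (vscale s x) = s * det3 u u' x by rewrite /det3 /=; ring.
rewrite !e1 !e2 !e3 !tsgMp // !sgrN !sgrM (gtr0_sg s0); ring.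
Qed.

Lemma icr_par w w' x y : pcone w -> pcone w' -> par w w' -> icr w w' x y = 0.
Proof.
move=> hw hw' p; have [s s0 ->] := parP hw hw' p; rewrite /icr.
have e u : det3 (vscale s w) x u = s * det3 w x u by rewrite /det3 /=; ring.
by rewrite e sgrM (gtr0_sg s0) mul1r subrr !mul0r.
Qed.

Definition off w x y := par x y \/ det3 w x y != 0.

(** A homotopy formula: moving the point from [w] to [w'] changes the degree by the crossings with
    the three sides. By [sg3_refl] the cubic term of [deg] is a sum of terms that each involve a
    single side, which turns the difference into a coboundary. *)
Lemma deg_diff w w' x y z : pcone w -> pcone w' -> pcone x -> pcone y -> pcone z ->
  off w x y -> off w y z -> off w z x -> off w' x y -> off w' y z -> off w' z x ->
  deg w x y z - deg w' x y z = icr w w' x y + icr w w' y z + icr w w' z x.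
Proof.
move=> hw hw' hx hy hz.
have flat x' y' z' u : pcone x' -> pcone y' -> pcone z' -> par x' y' -> deg u x' y' z' = 0.
  by move=> ? ? ? p; apply: deg_flat => //; rewrite -det3_perm det3_perm -det3_perm -det3_perm det3_nil.
have [pxy|nxy] := pselect (par x y).
  by rewrite !flat // subrr (icr_par_tri _ _ _ hx hy pxy).
have [pyz|nyz] := pselect (par y z).
  by rewrite -!(deg_rot _ x) !flat // subrr -(icr_par_tri w w' x hy hz pyz) => *; ring.
have [pzx|nzx] := pselect (par z x).
  rewrite (deg_rot _ z) (deg_rot w' z) !flat // subrr -(icr_par_tri w w' y hz hx pzx) => *; ring.
move=> [//|p0] [//|q0] [//|r0] [//|p'0] [//|q'0] [//|r'0].
have [pw|nw] := pselect (par w w').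
  rewrite !icr_par // !addr0; have [s s0 ->] := parP hw hw' pw.
  have e x' y' : det3 (vscale s w) x' y' = s * det3 w x' y' by rewrite /det3 /=; ring.
  by rewrite /deg !e !sgrM (gtr0_sg s0) !mul1r subrr.
rewrite /deg (sg3_refl nw (or_introl erefl) p0 q0 r0) (sg3_refl nw (or_intror erefl) p'0 q'0 r'0) /icr.
by field.
Qed.

(** The common point comes from the linear relation between [x], [y], [w], [w'] with determinants as
    coefficients; positivity of [bil] on the cone excludes the wrong signs. This is what makes the
    number of crossing translates finite. *)
Lemma icr_hull w w' x y : pcone w -> pcone w' -> pcone x -> pcone y ->
  icr w w' x y != 0 ->
  exists a b c d, [/\ 0 <= a, 0 <= b, 0 <= c, 0 <= d &
   [/\ 0 < a + b, 0 < c + d &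
     vscale a x + vscale b y = vscale c w + vscale d w']].
Proof.
move=> hw hw' hx hy; rewrite /icr !mulf_eq0 !negb_or => /andP[/andP[n1 n2] _].
have pl (u u' a b : V) : vscale (det3 u u' b) a - vscale (det3 u u' a) b =
     vscale (det3 u a b) u' - vscale (det3 u' a b) u :> V.
  by apply: vec_eqP; rewrite /det3 /=; ring.
have pos a b u v : 0 <= a -> 0 <= b -> 0 < a + b -> pcone u -> pcone v ->
    0 < bil w (vscale a u + vscale b v).
  move=> a0 b0 ab hu hv; rewrite bilD !bilZ.
  have := bil_gt0 hw hu; have := bil_gt0 hw hv => p1 p2.
  have [a1|a1] := ltrP 0 a.
    by rewrite ltr_wpDr ?mulr_gt0 // mulr_ge0 // ltW.
  have b1 : 0 < b by lra.
  by rewrite ltr_wpDl ?mulr_gt0 // mulr_ge0 // ltW.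
(* up to exchanging [x] and [y] the plane of [w], [w'] separates them *)
wlog [tx ty] : x y hx hy n1 n2 / 0 <= det3 w w' x /\ det3 w w' y < 0.
  move=> wl; have [tx|tx] := lerP 0 (det3 w w' x); have [ty|ty] := lerP 0 (det3 w w' y).
  - by move: n2; rewrite /tsg tx ty mulr1 subrr eqxx.
  - exact: wl.
  - have [|||a [b [c [d [a0 b0 c0 d0 [ab cd e]]]]]] := wl y x hy hx.
    + rewrite det3_swap [det3 w' _ _]det3_swap !sgrN; apply: contra_neq n1 => h; lra.
    + by rewrite mulrC.
    + by split.
    + exists b, a, c, d; split=> //; split=> //; first by rewrite addrC.
      by rewrite addrC.
  - by move: n2; rewrite /tsg !(lt_geF tx, lt_geF ty) mulrNN mulr1 subrr eqxx.
set P := det3 w x y in n1 *; set P' := det3 w' x y in n1 *.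
have e : vscale (- det3 w w' y) x + vscale (det3 w w' x) y = vscale P' w + vscale (- P) w'.
  by have := pl w w' x y; rewrite -/P -/P' => -[/= ? ? ?]; apply: vec_eqP => /=; lra.
have s1 : 0 < - det3 w w' y + det3 w w' x by lra.
have p1 := pos _ _ x y (ltac:(lra) : 0 <= - det3 w w' y) tx s1 hx hy.
have [P0|P0] := ltrP 0 P; have [P'0|P'0] := ltrP 0 P'.
- by move: n1; rewrite (gtr0_sg P0) (gtr0_sg P'0) subrr eqxx.
- exfalso; move: p1; rewrite e.
  have := pos P (- P') w' w (ltW P0) (ltac:(lra)) (ltac:(lra)) hw' hw.
  by rewrite !bilD !bilZ; lra.
- exists (- det3 w w' y), (det3 w w' x), P', (- P).
  by split; [lra|lra|lra|lra|split; [lra|lra|exact: e]].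
have [z0|P0'] := eqVneq (P - P') 0.
  by move: n1; rewrite (_ : P = P') ?subrr ?eqxx //; lra.
have [zP|nP] := eqVneq P 0.
  exfalso; move: p1; rewrite e zP bilD !bilZ => h.
  have : P' * bil w w <= 0 by rewrite mulr_le0_ge0 // ltW // bil_gt0.
  lra.
have [zP'|nP'] := eqVneq P' 0.
  have : P < 0 by rewrite lt_neqAle nP.
  exists (- det3 w w' y), (det3 w w' x), P', (- P).
  by split; [lra|lra|lra|lra|split; [lra|lra|exact: e]].
move: n1; rewrite ltr0_sg ?lt_neqAle ?nP // ltr0_sg ?lt_neqAle ?nP' //.
by rewrite subrr eqxx.
Qed.

End Degree.

(** * Degrees at infinitesimally close points and flags *)

Section Chain.
Variable R : realType.
Local Notation V := (R * R * R)%type.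
Implicit Types (x y z w v d n : V).

(** Two orders of magnitude: for small [e] the displacement along [d] decides on which side of a
    plane through [v] the point lies, unless the plane contains [d]; then the displacement along [n]
    decides. *)
Definition germ v d n (e e1 e2 : R) : V :=
  v + vscale (e1 * e) d + vscale (e2 * e ^+ 2) n.

Definition lexsg (a b c e1 e2 : R) : R :=
  if a != 0 then Num.sg a else if b != 0 then e1 * Num.sg b else e2 * Num.sg c.

Definition sign1 (e : R) := e = 1 \/ e = -1.

Lemma sg_near (a b : R) : a != 0 -> `|b| < `|a| -> Num.sg (a + b) = Num.sg a.
Proof.
move=> a0; have [ap|an|e] := ltrgt0P a; last by rewrite e eqxx in a0.
  by rewrite ltr_norml (gtr0_sg ap) => /andP[h1 h2]; rewrite gtr0_sg //; lra.
by rewrite ltr_norml (ltr0_sg an) => /andP[h1 h2]; rewrite ltr0_sg //; lra.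
Qed.

Lemma sign1_norm e : sign1 e -> `|e| = 1.
Proof. by case=> ->; rewrite ?normrN normr1. Qed.

Lemma lex_small (a b c : R) : exists2 e0, 0 < e0 & forall e e1 e2, 0 < e -> e < e0 ->
  sign1 e1 -> sign1 e2 -> Num.sg (a + e1 * e * b + e2 * e ^+ 2 * c) = lexsg a b c e1 e2.
Proof.
rewrite /lexsg; have [->|a0] := eqVneq a 0; last first.
  have B0 : 0 < `|b| + `|c| + 1 by have := normr_ge0 b; have := normr_ge0 c; lra.
  exists (Num.min 1 (`|a| / (`|b| + `|c| + 1))) => [|e e1 e2 e0].
    by rewrite lt_min ltr01 divr_gt0 ?normr_gt0.
  rewrite lt_min => /andP[e_1]; rewrite ltr_pdivlMr // => ha h1 h2.
  rewrite -addrA sg_near // (le_lt_trans (ler_normD _ _)) //.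
  rewrite !normrM (sign1_norm h1) (sign1_norm h2) !mul1r (ger0_norm (ltW e0)).
  have : e * e * `|c| <= e * `|c| by rewrite ler_wpM2r // ler_piMr ?ltW.
  lra.
rewrite ?eqxx /=; have [->|b0] := eqVneq b 0.
  exists 1 => // e e1 e2 e0 _ h1 h2; rewrite mulr0 !add0r !sgrM (gtr0_sg e0) !mulr1 ?eqxx /=.
  by congr (_ * _); case: h2 => ->; rewrite ?sgrN sgr1.
have C0 : 0 < `|c| + 1 by have := normr_ge0 c; lra.
exists (`|b| / (`|c| + 1)) => [|e e1 e2 e0]; first by rewrite divr_gt0 ?normr_gt0.
rewrite ltr_pdivlMr // => hb h1 h2.
have e1n : e1 != 0 by case: h1 => ->; rewrite ?oppr_eq0 oner_eq0.
have nz : e1 * e * b != 0 by rewrite !mulf_neq0 // gt_eqF.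
rewrite add0r sg_near //.
  by rewrite !sgrM (gtr0_sg e0) mulr1; congr (_ * _); case: h1 => ->; rewrite ?sgrN sgr1.
rewrite !normrM (sign1_norm h1) (sign1_norm h2) !mul1r (ger0_norm (ltW e0)).
rewrite -mulrA ltr_pM2l //.
by apply: le_lt_trans hb; rewrite ler_wpM2l ?ltW // ltrDl.
Qed.

(** The mixed second difference. It annihilates functions of one of the two signs alone, so a
    contribution requires one side that depends on [e1] and another that depends on [e2]. *)
Definition alt4 (F : R -> R -> R) : R := F 1 1 - F 1 (-1) - F (-1) 1 + F (-1) (-1).

Definition sdeg (p q r : R -> R -> R) e1 e2 : R :=
  (p e1 e2 + q e1 e2 + r e1 e2 + p e1 e2 * q e1 e2 * r e1 e2) / 4.

Lemma alt4_two a b c a' b' c' a'' b'' c'' : a != 0 -> a' != 0 ->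
  alt4 (sdeg (lexsg a b c) (lexsg a' b' c') (lexsg a'' b'' c'')) = 0.
Proof.
by move=> h h'; rewrite /alt4 /sdeg /lexsg h h'; case: ifP => _; [|case: ifP => _]; field.
Qed.

Lemma alt4_cross b c a' b' c' b'' c'' : a' != 0 -> b != 0 -> b'' != 0 ->
  alt4 (sdeg (lexsg 0 b c) (lexsg a' b' c') (lexsg 0 b'' c'')) = 0.
Proof. by move=> h h' h''; rewrite /alt4 /sdeg /lexsg eqxx h h' h'' /=; field. Qed.

Lemma alt4_flag1 c a' b' c' b'' c'' : a' != 0 -> b'' != 0 ->
  alt4 (sdeg (lexsg 0 0 c) (lexsg a' b' c') (lexsg 0 b'' c'')) = Num.sg (c * a' * b'').
Proof. by move=> h h'; rewrite /alt4 /sdeg /lexsg eqxx h h' /= !sgrM; field. Qed.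

Lemma alt4_flag2 b c a' b' c' c'' : a' != 0 -> b != 0 ->
  alt4 (sdeg (lexsg 0 b c) (lexsg a' b' c') (lexsg 0 0 c'')) = Num.sg (b * a' * c'').
Proof. by move=> h h'; rewrite /alt4 /sdeg /lexsg eqxx h h' /= !sgrM; field. Qed.

Lemma det3_germ v d n e e1 e2 x y :
  det3 (germ v d n e e1 e2) x y =
  det3 v x y + e1 * e * det3 d x y + e2 * e ^+ 2 * det3 n x y.
Proof. by rewrite /det3 /germ /=; ring. Qed.

Definition ind (P : Prop) : R := if pselect P then 1 else 0.

Lemma indT (P : Prop) : P -> ind P = 1.
Proof. by rewrite /ind; case: pselect. Qed.

Lemma indF (P : Prop) : ~ P -> ind P = 0.
Proof. by rewrite /ind; case: pselect. Qed.

Definition flag v d x y := ind (par x v /\ det3 v d y = 0).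

Definition ldeg v d n x y z :=
  sdeg (lexsg (det3 v x y) (det3 d x y) (det3 n x y))
       (lexsg (det3 v y z) (det3 d y z) (det3 n y z))
       (lexsg (det3 v z x) (det3 d z x) (det3 n z x)).

Lemma ldeg_rot v d n x y z : alt4 (ldeg v d n y z x) = alt4 (ldeg v d n x y z).
Proof. by rewrite /alt4 /ldeg /sdeg; field. Qed.

(** Of the two sides through the vertex, one that lies in the plane of [v] and [d] depends on [e2]
    only, one that does not on [e1] only. The relation [pl] shows that they cannot both lie in this
    plane, and it fixes the sign of the contribution. *)
Lemma ldeg_vertex v d n x y z : pcone v -> pcone x -> 0 < det3 v d n ->
  det3 x y z != 0 -> par x v ->
  alt4 (ldeg v d n x y z) = ind (det3 v d y = 0) - ind (det3 v d z = 0).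
Proof.
move=> hv hx D0 nz pxv; have [s s0 ex] := parP hv hx (par_sym pxv).
rewrite {x hx pxv}ex in nz *.
have eD : det3 (vscale s v) y z = s * det3 v y z by rewrite /det3 /=; ring.
rewrite eD mulf_eq0 negb_or in nz; case/andP: nz => _ a'0.
rewrite /ldeg [det3 v (vscale s v) y](_ : _ = 0); last by rewrite /det3 /=; ring.
rewrite [det3 v z (vscale s v)](_ : _ = 0); last by rewrite /det3 /=; ring.
have eb : det3 d (vscale s v) y = - (s * det3 v d y) by rewrite /det3 /=; ring.
have eb'' : det3 d z (vscale s v) = s * det3 v d z by rewrite /det3 /=; ring.
have ec : det3 n (vscale s v) y = s * det3 y n v by rewrite /det3 /=; ring.
have ec'' : det3 n z (vscale s v) = - (s * det3 z n v) by rewrite /det3 /=; ring.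
have pl : det3 v d n * det3 v y z = det3 y n v * det3 v d z - det3 z n v * det3 v d y.
  by rewrite /det3 /=; ring.
have sn : s != 0 by rewrite gt_eqF.
have Dn : det3 v d n != 0 by rewrite gt_eqF.
have [y0|yn] := eqVneq (det3 v d y) 0; have [z0|zn] := eqVneq (det3 v d z) 0.
- by have /eqP := pl; rewrite y0 z0 !mulr0 subr0 mulf_eq0 (negPf Dn) (negPf a'0).
- rewrite (indT y0) (indF (elimN eqP zn)) subr0 eb y0 mulr0 oppr0 alt4_flag1 //; last first.
    by rewrite eb'' mulf_neq0.
  rewrite y0 mulr0 subr0 in pl; rewrite ec eb''.
  apply: gtr0_sg; rewrite -(pmulr_rgt0 _ D0).
  have -> : det3 v d n * (s * det3 y n v * det3 v y z * (s * det3 v d z)) =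
     (s * (det3 v d n * det3 v y z)) ^+ 2.
    transitivity (s ^+ 2 * (det3 y n v * det3 v d z) * (det3 v d n * det3 v y z)); first ring.
    by rewrite -pl; ring.
  by rewrite exprn_even_gt0 //= !mulf_neq0.
- rewrite (indF (elimN eqP yn)) (indT z0) sub0r eb'' z0 mulr0 alt4_flag2 //; last first.
    by rewrite eb oppr_eq0 mulf_neq0.
  rewrite z0 mulr0 sub0r in pl; rewrite ec'' eb.
  apply: ltr0_sg; rewrite -(pmulr_rlt0 _ D0).
  have -> : det3 v d n * (- (s * det3 v d y) * det3 v y z * - (s * det3 z n v)) =
     - (s * (det3 v d n * det3 v y z)) ^+ 2.
    transitivity (- (s ^+ 2 * (- (det3 z n v * det3 v d y)) * (det3 v d n * det3 v y z)));
      first by ring.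
    by rewrite -pl; ring.
  by rewrite oppr_lt0 exprn_even_gt0 //= !mulf_neq0.
- rewrite (indF (elimN eqP yn)) (indF (elimN eqP zn)) subr0 alt4_cross //.
    by rewrite eb oppr_eq0 mulf_neq0.
  by rewrite eb'' mulf_neq0.
Qed.

Lemma two_sides v x y z : det3 x y z != 0 -> det3 v x y = 0 -> det3 v z x = 0 ->
  par x v.
Proof.
move=> D0 e1 e2; apply: (@coplanar_par _ x v y z) => //.
- by move: e1; rewrite /det3 => e1; lra.
- by move: e2; rewrite /det3 => e2; lra.
Qed.

(** At most one side passes through the ray of [v], so two of the three signs do not depend on the
    germ. *)
Lemma ldeg_off v d n x y z : pcone v -> 0 < det3 v d n -> det3 x y z != 0 ->
  ~ par x v -> ~ par y v -> ~ par z v -> alt4 (ldeg v d n x y z) = 0.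
Proof.
move=> hv D0 nz nx ny nz'.
have nz1 : det3 y z x != 0 by rewrite det3_perm.
have nz2 : det3 z x y != 0 by rewrite 2!det3_perm.
have [p0|p0] := eqVneq (det3 v x y) 0; last first.
  have [q0|q0] := eqVneq (det3 v y z) 0; last exact: alt4_two.
  have [r0|r0] := eqVneq (det3 v z x) 0; last first.
    by rewrite -ldeg_rot -ldeg_rot; exact: alt4_two.
  by case: nz'; exact: two_sides nz2 r0 q0.
have [q0|q0] := eqVneq (det3 v y z) 0.
  by case: ny; exact: two_sides nz1 q0 p0.
have [r0|r0] := eqVneq (det3 v z x) 0.
  by case: nx; exact: two_sides nz p0 r0.
by rewrite -ldeg_rot; exact: alt4_two.
Qed.

Lemma ldeg_flags v d n x y z : pcone v -> pcone x -> pcone y -> pcone z ->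
  0 < det3 v d n -> det3 x y z != 0 ->
  alt4 (ldeg v d n x y z) =
    (flag v d x y - flag v d x z) + (flag v d y z - flag v d y x)
    + (flag v d z x - flag v d z y).
Proof.
move=> hv hx hy hz D0 nz.
have npar x' y' z' : det3 x' y' z' != 0 -> pcone x' -> pcone y' -> par x' v -> ~ par y' v.
  move=> n0 hx' hy' /par_sym p /par_sym q; move: n0.
  have [s _ ->] := parP hv hx' p; have [t _ ->] := parP hv hy' q.
  by move/eqP; apply; rewrite /det3 /=; ring.
have flagF a b u : ~ par a v -> flag v d a b - flag v d a u = 0.
  by move=> na; rewrite /flag !indF ?subrr //; case.
have flagT a b : par a v -> flag v d a b = ind (det3 v d b = 0).
  move=> pa; rewrite /flag; have [e|e] := pselect (det3 v d b = 0); first by rewrite !indT.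
  by rewrite !indF //; case.
have nz1 : det3 y z x != 0 by rewrite det3_perm.
have nz2 : det3 z x y != 0 by rewrite 2!det3_perm.
have [px|nx] := pselect (par x v).
  rewrite (ldeg_vertex hv hx D0 nz px) !(flagT x) // (flagF y); last exact: npar nz _ _ px.
  by rewrite (flagF z) ?addr0 // => pz; exact: (npar _ _ _ nz2 hz hx pz px).
have [py|ny] := pselect (par y v).
  rewrite -ldeg_rot (ldeg_vertex hv hy D0 nz1 py) !(flagT y) // (flagF x) //.
  by rewrite (flagF z) ?addr0 ?add0r //; exact: npar nz1 _ _ py.
have [pz|nz'] := pselect (par z v).
  rewrite -ldeg_rot -ldeg_rot (ldeg_vertex hv hz D0 nz2 pz) !(flagT z) // (flagF x) //.
  by rewrite (flagF y) ?addr0 ?add0r //; exact: npar nz2 _ _ pz.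
by rewrite ldeg_off // !flagF // !addr0.
Qed.

Lemma deg_germ v d n x y z : exists2 e0, 0 < e0 & forall e, 0 < e -> e < e0 ->
  alt4 (fun e1 e2 => deg (germ v d n e e1 e2) x y z) = alt4 (ldeg v d n x y z).
Proof.
have [a a0 ha] := lex_small (det3 v x y) (det3 d x y) (det3 n x y).
have [b b0 hb] := lex_small (det3 v y z) (det3 d y z) (det3 n y z).
have [c c0 hc] := lex_small (det3 v z x) (det3 d z x) (det3 n z x).
exists (Num.min a (Num.min b c)) => [|e e0]; first by rewrite !lt_min a0 b0 c0.
rewrite !lt_min => /and3P[ea eb ec].
have s1 : sign1 1 by left.
have s2 : sign1 (-1) by right.
by rewrite /alt4 /deg !det3_germ !ha ?hb ?hc.
Qed.

Lemma pcone_germ v d n : pcone v -> exists2 e0, 0 < e0 &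
  forall e e1 e2, 0 < e -> e < e0 -> sign1 e1 -> sign1 e2 -> pcone (germ v d n e e1 e2).
Proof.
move=> [A0 dv].
have [a a0 ha] := lex_small v.1.1 d.1.1 n.1.1.
have h1 e : sign1 e -> `|e| <= 1 by move/sign1_norm->.
pose M := `|2 * bil v d| + `|2 * bil v n| + `|disc d| + `|2 * bil d n| + `|disc n| + 1.
have M0 : 0 < M.
  by rewrite /M ltr_wpDl // !addr_ge0.
exists (Num.min a (Num.min 1 (disc v / M))).
  by rewrite !lt_min a0 ltr01 divr_gt0.
move=> e e1 e2 e0; rewrite !lt_min ltr_pdivlMr // => /and3P[ea eb ec] s1 s2; split.
  have := ha e e1 e2 e0 ea s1 s2; rewrite /lexsg (gt_eqF A0) /= (gtr0_sg A0).
  by move/eqP; rewrite sgr_cp0.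
have -> : disc (germ v d n e e1 e2) = disc v + e * (e1 * (2 * bil v d) + e2 * e * (2 * bil v n)
   + e1 ^+ 2 * e * disc d + e1 * e2 * e ^+ 2 * (2 * bil d n) + e2 ^+ 2 * e ^+ 3 * disc n).
  by rewrite /disc /bil /germ /=; ring.
set S := (X in e * X).
have SM : `|S| <= M.
  have e1' : e <= 1 by exact: ltW.
  have n1 := sign1_norm s1; have n2 := sign1_norm s2.
  have en1 : `|e| <= 1 by rewrite ger0_norm // ltW.
  have en k : `|e ^+ k| <= 1 by rewrite normrX ger0_norm ?exprn_ile1 // ltW.
  have le (x y : R) : `|x| <= 1 -> `|x * y| <= `|y| by move=> hx; rewrite normrM ler_piMl.
  rewrite /S /M; apply: le_trans (ler_normD _ _) _.
  apply: ler_wpDr => //.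
  apply: lerD; last by apply: le; rewrite normrM normrX n2 expr1n mul1r.
  apply: le_trans (ler_normD _ _) _; apply: lerD; last first.
    by apply: le; rewrite !normrM n1 n2 !mul1r mulr_ile1.
  apply: le_trans (ler_normD _ _) _; apply: lerD; last first.
    by apply: le; rewrite normrM normrX n1 expr1n mul1r.
  apply: le_trans (ler_normD _ _) _; apply: lerD; first by apply: le; rewrite n1.
  by apply: le; rewrite normrM n2 mul1r.
have : - (e * M) <= e * S.
  by rewrite -mulrN ler_pM2l //; move: SM; rewrite ler_norml => /andP[].
lra.
Qed.

End Chain.

(** * Additive cochains and dissections *)

Section ChainZero.
Variable R : realType.
Local Notation V := (R * R * R)%type.
Implicit Types (x y z w v d n : V).

Lemma group_sum (J : finType) (K : eqType) (key : J -> K) (mu val : J -> R) :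
  (forall i j, key i = key j -> val i = val j) ->
  (forall j0, \sum_(j | key j == key j0) mu j = 0) ->
  \sum_j mu j * val j = 0.
Proof.
move=> hval hmu.
pose p j := odflt j [pick i | key i == key j].
have keyp j : key (p j) = key j.
  by rewrite /p; case: pickP => [i /eqP //|/(_ j)]; rewrite eqxx.
have pE i j : key i = key j -> p i = p j.
  move=> e; rewrite /p (eq_pick (Q := fun k => key k == key j)); last by move=> k; rewrite /= e.
  by case: pickP => // /(_ j); rewrite eqxx.
rewrite (partition_big p xpredT) //=; apply: big1 => k _.
have [[j pj]|no] := pselect (exists j, p j = k); last first.
  by rewrite big_pred0 // => j; apply/negbTE/eqP => pj; apply: no; exists j.
transitivity (\sum_(i | key i == key j) mu i * val j).
  apply: eq_big => i; last by move=> /eqP e; rewrite (hval i j) // -keyp e -pj keyp.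
  by apply/eqP/eqP => [e|/pE ->//]; rewrite -keyp e -pj keyp.
by rewrite -mulr_suml hmu mul0r.
Qed.

Lemma common_eps (I : finType) (P : I -> R -> Prop) :
  (forall i, exists2 e0, 0 < e0 & forall e, 0 < e -> e < e0 -> P i e) ->
  exists2 e0, 0 < e0 & forall e, 0 < e -> e < e0 -> forall i, P i e.
Proof.
move=> h.
suff [e0 e00 H] : exists2 e0, 0 < e0 &
    forall e, 0 < e -> e < e0 -> forall i, i \in enum I -> P i e.
  by exists e0 => // e ep el i; apply: H => //; rewrite mem_enum.
elim: (enum I) => [|j s [e0 e00 IH]]; first by exists 1.
have [e1 e10 h1] := h j; exists (Num.min e0 e1) => [|e ep]; first by rewrite lt_min e00.
rewrite lt_min => /andP[l0 l1] i; rewrite inE => /orP[/eqP->|]; first exact: h1.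
exact: IH.
Qed.

Lemma quad_roots_countable (a b c : R) : ~ [/\ a = 0, b = 0 & c = 0] ->
  countable [set e | a + e * b + e ^+ 2 * c = 0].
Proof.
move=> nz; have [[r /= hr]|no] := pselect (exists r, a + r * b + r ^+ 2 * c = 0); last first.
  apply: (sub_countable (B := set0)); last exact: countable0.
  by apply: subset_card_le => x hx; apply: no; exists x.
apply: (sub_countable (B := [set r] `|` [set - (b + c * r) / c])); last first.
  by apply: finite_set_countable; rewrite finite_setU; split; exact: finite_set1.
apply: subset_card_le => x /= hx.
have e : (x - r) * (c * x + (b + c * r)) = 0.
  by transitivity ((a + x * b + x ^+ 2 * c) - (a + r * b + r ^+ 2 * c)); [ring|rewrite hx hr subrr].
have /orP[|/eqP e2] : (x - r == 0) || (c * x + (b + c * r) == 0) by rewrite -mulf_eq0 e.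
  by rewrite subr_eq0 => /eqP ->; left.
have [c0|cn] := eqVneq c 0; last by right; apply: (mulfI cn); rewrite mulrCA divff // mulr1; lra.
rewrite {}c0 in hx hr nz e2.
have b0 : b = 0 by lra.
by case: nz; split => //; rewrite b0 in hr; lra.
Qed.

Lemma dot_basis (nu : V) v d n : det3 v d n != 0 -> dot nu v = 0 -> dot nu d = 0 ->
  dot nu n = 0 -> nu = 0.
Proof.
move=> D0 e1 e2 e3.
have : vscale (det3 v d n) nu = vscale (dot nu v) (cross d n) +
    vscale (dot nu d) (cross n v) + vscale (dot nu n) (cross v d).
  by apply: vec_eqP; rewrite /dot /det3 /cross /=; ring.
rewrite e1 e2 e3 => -[/= h1 h2 h3].
by apply: vec_eqP => /=; apply: (mulfI D0); rewrite ?h1 ?h2 ?h3; ring.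
Qed.

(** For each choice of signs a plane excludes only the roots of a quadratic polynomial in [e], which
    is nonzero because [v], [d], [n] form a basis. *)
Lemma germ_avoid (N : set V) v d n e0 : countable N -> (forall nu, N nu -> nu <> 0) ->
  det3 v d n != 0 -> 0 < e0 ->
  exists2 e, 0 < e < e0 & forall nu, N nu -> forall e1 e2, sign1 e1 -> sign1 e2 ->
    dot nu (germ v d n e e1 e2) != 0.
Proof.
move=> cN nN D0 e00.
pose bad (nu : V) (e1 e2 : R) := [set e | dot nu v + e * (e1 * dot nu d) + e ^+ 2 * (e2 * dot nu n) = 0].
have cbad nu e1 e2 : N nu -> sign1 e1 -> sign1 e2 -> countable (bad nu e1 e2).
  move=> Nn s1 s2; apply: quad_roots_countable => -[h1 h2 h3].
  apply: (nN _ Nn); apply: (dot_basis D0 h1).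
    by case: s1 h2 => ->; rewrite ?mulN1r ?mul1r => h2; lra.
  by case: s2 h3 => ->; rewrite ?mulN1r ?mul1r => h3; lra.
pose A := \bigcup_(nu in N) (bad nu 1 1 `|` bad nu 1 (-1) `|` bad nu (-1) 1 `|` bad nu (-1) (-1)).
have s1 : sign1 (1 : R) by left.
have s2 : sign1 (-1 : R) by right.
have cU (B C : set R) : countable B -> countable C -> countable (B `|` C).
  by move=> cB cC; rewrite -bigcup2E; apply: bigcup_countable => // -[|[|k]] _ /=.
have [|e he nA] := @countable_avoid _ A e0 _ e00.
  apply: bigcup_countable => // nu Nn.
  by apply: (cU); [apply: (cU); [apply: (cU)|]|]; apply: cbad.
exists e => // nu Nn e1 e2 h1 h2; apply/eqP => z; apply: nA; exists nu => //.
have {}z : bad nu e1 e2 e by rewrite /bad /= -z /dot /germ /=; ring.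
by case: h1 z => ->; case: h2 => -> z; rewrite /setU /=; tauto.
Qed.

Definition additive_cochain (T : V -> V -> V -> R) :=
  (forall x y z w, pcone x -> pcone y -> pcone z -> pcone w ->
     T y z w - T x z w + T x y w - T x y z = 0) /\
  (forall x y z, pcone x -> pcone y -> pcone z -> det3 x y z = 0 -> T x y z = 0).

Section AdditiveTheory.
Variable T : V -> V -> V -> R.
Hypothesis aT : additive_cochain T.

Lemma add_flip p x z : pcone p -> pcone x -> pcone z -> T p z x = - T p x z.
Proof.
move=> hp hx hz; have [coc flat] := aT.
have := coc p x z x hp hx hz hx.
rewrite (flat x z x) // ?(flat p x x) //; try by rewrite /det3; ring.
lra.
Qed.

Lemma add_edges p x y z : pcone p -> pcone x -> pcone y -> pcone z ->
  T x y z = T p x y + T p y z + T p z x.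
Proof.
move=> hp hx hy hz; have [coc flat] := aT.
have := coc p x y z hp hx hy hz; rewrite (add_flip hp hx hz); lra.
Qed.

Lemma add_line p q x y : pcone p -> pcone q -> pcone x -> pcone y -> det3 q x y = 0 ->
  T p x y = T p q y - T p q x.
Proof.
move=> hp hq hx hy e; have [coc flat] := aT.
have := coc p q x y hp hq hx hy; rewrite (flat q x y) //; lra.
Qed.

Lemma add_scale p q x s : pcone p -> pcone q -> pcone x -> 0 < s ->
  T p q (vscale s x) = T p q x.
Proof.
move=> hp hq hx s0; have [coc flat] := aT; have hs := pconeZ s0 hx.
have := coc p q x (vscale s x) hp hq hx hs.
rewrite (flat q x) // ?(flat p x) //; try by rewrite /det3 /=; ring.
lra.
Qed.
End AdditiveTheory.

Lemma npar6 x y z : det3 x y z != 0 -> [/\ ~ par x y, ~ par y z & ~ par z x].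
Proof.
move=> nz; split=> pr; move/eqP: nz; apply.
- by rewrite det3_perm (det3_nil _ pr).
- exact: det3_nil.
- by rewrite -det3_perm (det3_nil _ pr).
Qed.

(* Every triangle splits into half-edges (flags).  The alternating sum of the
   degrees at the four points [v +- e d +- e^2 n] counts the flags at [v] in the
   direction [d], so it vanishes; and [T] only depends on the flags. *)
Lemma chain_zero (T : V -> V -> V -> R) (I : finType) (c : I -> R) (X Y Z : I -> V) (N : set V) :
  additive_cochain T ->
  (forall i, [/\ pcone (X i), pcone (Y i), pcone (Z i) & det3 (X i) (Y i) (Z i) != 0]) ->
  countable N -> (forall nu, N nu -> nu <> 0) ->
  (forall w, pcone w -> (forall nu, N nu -> dot nu w != 0) ->
     \sum_i c i * deg w (X i) (Y i) (Z i) = 0) ->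
  \sum_i c i * T (X i) (Y i) (Z i) = 0.
Proof.
move=> aT hI cN nN hdeg.
have [i0|no] := pselect (exists i : I, True); last first.
  by rewrite big1 // => i _; case: no; exists i.
case: i0 => i0 _; pose p := X i0.
have hp : pcone p by case: (hI i0).
pose vt i (k : 'I_3) := nth (0 : V) [:: X i; Y i; Z i] k.
pose ot i (k : 'I_3) (b : bool) :=
  nth (0 : V) (if b then [:: Y i; Z i; X i] else [:: Z i; X i; Y i]) k.
pose ray v : set V := [set x | pcone x /\ par v x].
pose pla v u : set V := [set x | pcone x /\ det3 v u x = 0].
pose J := (I * 'I_3 * bool)%type.
pose vj (j : J) := vt j.1.1 j.1.2.
pose oj (j : J) := ot j.1.1 j.1.2 j.2.
pose mu (j : J) : R := c j.1.1 * (if j.2 then 1 else -1).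
pose key (j : J) := (ray (vj j), pla (vj j) (oj j)).
(* The auxiliary point is chosen from the plane alone, so [vl v u] depends only on the ray of [v]
   and the plane of the edge. In [edge], the value of [T] on the cone from [p] over an edge becomes
   a difference of two such half-edge terms. *)
pose vl v u := T p (xget p (pla v u)) v.
have sumJ (F : I -> V -> V -> R) :
    \sum_(j : J) mu j * F j.1.1 (vj j) (oj j) =
    \sum_i c i * ((F i (X i) (Y i) - F i (X i) (Z i)) + (F i (Y i) (Z i) - F i (Y i) (X i))
               + (F i (Z i) (X i) - F i (Z i) (Y i))).
  rewrite -(pair_bigA _ (fun ik b => mu (ik, b) * F ik.1 (vj (ik, b)) (oj (ik, b)))) /=.
  rewrite -(pair_bigA _ (fun i k => \sum_b mu (i, k, b) * F i (vj (i, k, b)) (oj (i, k, b)))) /=.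
  apply: eq_bigr => i _; rewrite !big_ord_recl big_ord0 !big_bool /mu /vj /oj /vt /ot /=; ring.
have hvo (j : J) : [/\ pcone (vj j), pcone (oj j) & ~ par (vj j) (oj j)].
  case: j => -[i k] b; rewrite /vj /oj /vt /ot /=; have [hx hy hz nz] := hI i.
  have [n1 n2 n3] := npar6 nz.
  case: k => -[|[|[|//]]] hk; case: b => /=; split=> // pr; try by move: pr.
  - by apply: n3; exact: par_sym.
  - by apply: n1; exact: par_sym.
  - by apply: n2; exact: par_sym.
have qP v u : pcone v -> pcone u -> pla v u (xget p (pla v u)).
  by move=> hv hu; apply: (@xgetPex _ p); exists v; split=> //; rewrite /det3; ring.
have pla_sym v u : pla u v = pla v u.
  apply/seteqP; split=> x [hx e]; split=> //; move: e; rewrite /det3; lra.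
have edge x y : pcone x -> pcone y -> T p x y = vl y x - vl x y.
  move=> hx hy; have [hq e] := qP _ _ hx hy; rewrite /vl [pla y x]pla_sym.
  by rewrite -(add_line aT) // -e /det3; ring.
suff : \sum_(j : J) mu j * vl (vj j) (oj j) = 0.
  rewrite (sumJ (fun=> vl)) => h; apply: oppr_inj; rewrite oppr0 -[RHS]h -sumrN.
  apply: eq_bigr => i _; have [hx hy hz _] := hI i.
  by rewrite (add_edges aT hp hx hy hz) !edge //; ring.
(* Half-edges are grouped by flag: [vl] is constant on each group, and it remains to see that the
   multiplicities cancel there. *)
apply: (group_sum (key := key)) => [j1 j2 [er ep]|j0].
  have [h1 o1 _] := hvo j1; have [h2 o2 _] := hvo j2.
  rewrite /vl ep.
  have [hq _] := qP _ _ h2 o2.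
  move: (xget _ _) hq => q0 hq.
  have [_ pr] : ray (vj j1) (vj j2).
    by rewrite er; split=> //; rewrite /par /cross; apply: vec_eqP => /=; ring.
  have [s s0 ->] := parP h1 h2 pr.
  by rewrite (add_scale aT).
have [hv hd npar] := hvo j0; set v := vj j0 in hv npar *; set d := oj j0 in hd npar *.
(* With this choice the determinant of [v], [d], [n] is the squared length of [n]. *)
pose n := cross v d.
have D0 : 0 < det3 v d n.
  rewrite (_ : det3 v d n = n.1.1 ^+ 2 + n.1.2 ^+ 2 + n.2 ^+ 2); last first.
    by rewrite /n /det3 /=; ring.
  rewrite lt_neqAle !addr_ge0 ?sqr_ge0 // andbT eq_sym; apply/eqP => /eqP.
  rewrite !paddr_eq0 ?addr_ge0 ?sqr_ge0 // !sqrf_eq0 => /andP[/andP[/eqP e1 /eqP e2] /eqP e3].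
  by apply: npar; apply: vec_eqP.
have keyE j : (key j == key j0) = (par (vj j) v /\ det3 v d (oj j) = 0) :> Prop.
  have [h1 o1 np1] := hvo j.
  apply/propext; split => [/eqP[er ep]|[pr e]].
    have [_ /par_sym pv] : ray v (vj j).
      by rewrite -er; split=> //; rewrite /par /cross; apply: vec_eqP => /=; ring.
    have [_ eo] : pla v d (oj j) by rewrite -ep; split=> //; rewrite /det3; ring.
    by split.
  apply/eqP; have [s s0 es] := parP hv h1 (par_sym pr); rewrite /key es; congr (_, _).
    apply/seteqP; split=> x [hx]; rewrite /par /cross /= => -[e1 e2 e3]; split=> //.
      by apply: vec_eqP => /=; apply: (mulfI (lt0r_neq0 s0)); lra.
    by apply: vec_eqP => /=; rewrite -!mulrA -mulrBr ?e1 ?e2 ?e3 ?mulr0 //;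
      rewrite mulrCA -mulrBr ?e1 ?e2 ?e3 ?mulr0.
  set u := oj j in e o1 np1 *.
  pose B := det3 v u n.
  have pl x : det3 v d n * det3 (vscale s v) u x = s * B * det3 v d x.
    transitivity (s * (B * det3 v d x + det3 v d u * det3 v n x)).
      by rewrite /B /det3 /=; ring.
    by rewrite e mul0r addr0 mulrA.
  have B0 : B != 0.
    apply/eqP => B0; apply: np1; rewrite es.
    have z x : det3 (vscale s v) u x = 0.
      by apply: (mulfI (lt0r_neq0 D0)); rewrite pl B0 mulr0 mul0r mulr0.
    have := z (1, 0, 0); have := z (0, 1, 0); have := z (0, 0, 1).
    rewrite /det3 /= => z1 z2 z3; apply: vec_eqP => /=; lra.
  apply/seteqP; split=> x [hx ex]; split=> //.
    apply: (mulfI (mulf_neq0 (lt0r_neq0 s0) B0)); by rewrite -pl ex !mulr0.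
  by apply: (mulfI (lt0r_neq0 D0)); rewrite pl ex !mulr0.
transitivity (\sum_j mu j * flag v d (vj j) (oj j)).
  rewrite big_mkcond; apply: eq_bigr => j _; rewrite /flag.
  case: (boolP (key j == key j0)) => k; first by rewrite indT ?mulr1 // -keyE.
  by rewrite indF ?mulr0 // -keyE; exact/negP.
rewrite (sumJ (fun=> flag v d)).
have [e0 e00 he0] := common_eps (fun i => deg_germ v d n (X i) (Y i) (Z i)).
have [e1 e10 he1] := pcone_germ d n hv.
have m0 : 0 < Num.min e0 e1 by rewrite lt_min e00.
(* At the four points of this germ the hypothesis on degrees applies, and all signs already have
   their limiting values. *)
have [e /andP[ep]] := germ_avoid cN nN (lt0r_neq0 D0) m0.
rewrite lt_min => /andP[l0 l1] av.
have s1 : sign1 (1 : R) by left.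
have s2 : sign1 (-1 : R) by right.
have z a b : sign1 a -> sign1 b -> \sum_i c i * deg (germ v d n e a b) (X i) (Y i) (Z i) = 0.
  by move=> sa sb; apply: hdeg => [|nu Nn]; [exact: he1|exact: av].
transitivity (alt4 (fun a b => \sum_i c i * deg (germ v d n e a b) (X i) (Y i) (Z i))); last first.
  by rewrite /alt4 !z //; ring.
rewrite /alt4 -!sumrB -big_split /=; apply: eq_bigr => i _.
have [hx hy hz nz] := hI i.
rewrite -(ldeg_flags hv hx hy hz D0 nz) -(he0 e ep l0 i) /alt4; ring.
Qed.
End ChainZero.

(** * Dissection of triangles along planes *)

Section Cutting.
Variable R : realType.
Local Notation V := (R * R * R)%type.
Implicit Types (x y z w l : V) (t : V * V * V).

Definition hull x y z u := exists a b c : R,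
  [/\ 0 <= a, 0 <= b, 0 <= c & u = vscale a x + vscale b y + vscale c z].

Definition tri t := [/\ pcone t.1.1, pcone t.1.2, pcone t.2 & det3 t.1.1 t.1.2 t.2 != 0].

Definition subtri t' t := tri t' /\
  [/\ hull t.1.1 t.1.2 t.2 t'.1.1, hull t.1.1 t.1.2 t.2 t'.1.2 & hull t.1.1 t.1.2 t.2 t'.2].

Definition onesided l t :=
  [/\ 0 <= dot l t.1.1, 0 <= dot l t.1.2 & 0 <= dot l t.2] \/
  [/\ dot l t.1.1 <= 0, dot l t.1.2 <= 0 & dot l t.2 <= 0].

Definition tval (T : V -> V -> V -> R) t := T t.1.1 t.1.2 t.2.

(** The linear forms in [L] keep their sign on each piece. The list [E] records the planes to be
    avoided: [deg] adds up only at points off them, whereas an additive cochain adds up without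
    restriction. *)
Definition dissection (L : seq V) t (P : seq (V * V * V)) (E : seq V) :=
  [/\ forall t', t' \in P -> subtri t' t,
      forall t' l, t' \in P -> l \in L -> onesided l t',
      forall T, additive_cochain T -> tval T t = \sum_(t' <- P) tval T t',
      forall w, pcone w -> (forall nu, nu \in E -> dot nu w != 0) ->
        tval (deg w) t = \sum_(t' <- P) tval (deg w) t' &
      forall nu, nu \in E -> nu <> 0].

Lemma dotD l x y : dot l (x + y) = dot l x + dot l y.
Proof. by rewrite /dot /=; ring. Qed.

Lemma dotZ l (s : R) x : dot l (vscale s x) = s * dot l x.
Proof. by rewrite /dot /=; ring. Qed.

Lemma hull_trans x y z x' y' z' u : hull x y z x' -> hull x y z y' -> hull x y z z' ->
  hull x' y' z' u -> hull x y z u.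
Proof.
move=> [a1 [b1 [c1 [? ? ? ->]]]] [a2 [b2 [c2 [? ? ? ->]]]] [a3 [b3 [c3 [? ? ? ->]]]].
move=> [a [b [c [? ? ? ->]]]].
exists (a * a1 + b * a2 + c * a3), (a * b1 + b * b2 + c * b3), (a * c1 + b * c2 + c * c3).
by split; rewrite ?addr_ge0 ?mulr_ge0 //; apply: vec_eqP => /=; ring.
Qed.

Lemma hull_l x y z : hull x y z x.
Proof.
by exists 1, 0, 0; split; rewrite ?ler01 //; apply: vec_eqP => /=; ring.
Qed.

Lemma hull_rot x y z u : hull y z x u -> hull x y z u.
Proof.
by move=> [a [b [c [? ? ? ->]]]]; exists c, a, b; split=> //; apply: vec_eqP => /=; ring.
Qed.

Lemma hull_m x y z : hull x y z y.
Proof. by apply: hull_rot; exact: hull_l. Qed.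

Lemma hull_r x y z : hull x y z z.
Proof. by apply: hull_rot; exact: hull_m. Qed.

Lemma subtri_trans t t' t'' : subtri t' t -> subtri t'' t' -> subtri t'' t.
Proof.
move=> [_ [h1 h2 h3]] [tr [k1 k2 k3]]; split=> //.
by split; [exact: hull_trans k1|exact: hull_trans k2|exact: hull_trans k3].
Qed.

Lemma onesided_sub l t t' : subtri t' t -> onesided l t -> onesided l t'.
Proof.
move=> [_ [[a1 [b1 [c1 [? ? ? e1]]]] [a2 [b2 [c2 [? ? ? e2]]]] [a3 [b3 [c3 [? ? ? e3]]]]]].
rewrite /onesided e1 e2 e3 !dotD !dotZ.
case=> -[h1 h2 h3]; [left|right]; split; rewrite ?addr_ge0 ?mulr_ge0 //.
all: by rewrite -oppr_ge0 !opprD -!mulrN !addr_ge0 // mulr_ge0 // oppr_ge0.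
Qed.

Lemma dissection_bind L1 L2 t P E : dissection L1 t P E ->
  (forall t', t' \in P -> exists P' E', dissection L2 t' P' E') ->
  exists P' E', dissection (L1 ++ L2) t P' E'.
Proof.
move=> [d1 d2 d3 d4 d5] h.
suff [Q [F [q1 q2 q3 q4]]] : exists (Q : seq (V * V * V)) (F : seq V), [/\
    forall t'', t'' \in Q -> exists2 t', t' \in P & subtri t'' t' /\
       forall l, l \in L2 -> onesided l t'',
    forall T, additive_cochain T -> \sum_(t' <- P) tval T t' = \sum_(t' <- Q) tval T t',
    forall w, pcone w -> (forall nu, nu \in F -> dot nu w != 0) ->
      \sum_(t' <- P) tval (deg w) t' = \sum_(t' <- Q) tval (deg w) t' &
    forall nu, nu \in F -> nu <> 0].
  exists Q, (E ++ F); split.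
  - by move=> t'' /q1[t' tP [s _]]; apply: subtri_trans s; exact: d1.
  - move=> t'' l /q1[t' tP [s o]]; rewrite mem_cat => /orP[lL|]; last exact: o.
    by apply: onesided_sub s _; exact: d2.
  - by move=> T aT; rewrite d3 // q2.
  - move=> w hw nw; rewrite d4 // ?q3 // => nu nN; apply: nw; rewrite mem_cat nN ?orbT //.
  - by move=> nu; rewrite mem_cat => /orP[/d5|/q4].
elim: P h {d1 d2 d3 d4} => [_|t' P IH h].
  by exists [::], [::]; split.
have [P' [E' [e1 e2 e3 e4 e5]]] := h t' (mem_head _ _).
have [|Q [F [q1 q2 q3 q4]]] := IH; first by move=> u uP; apply: h; rewrite inE uP orbT.
exists (P' ++ Q), (E' ++ F); split.
- move=> t''; rewrite mem_cat => /orP[tP|/q1[u uP ?]].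
    by exists t'; rewrite ?mem_head //; split; [exact: e1|move=> l; exact: e2].
  by exists u; rewrite // inE uP orbT.
- by move=> T aT; rewrite big_cons big_cat /= e3 // q2.
- move=> w hw nw; rewrite big_cons big_cat /= e4 // ?q3 // => nu nN; apply: nw;
    by rewrite mem_cat nN ?orbT.
- by move=> nu; rewrite mem_cat => /orP[/e5|/q4].
Qed.

Lemma dissection_id L t : tri t -> (forall l, l \in L -> onesided l t) ->
  dissection L t [:: t] [::].
Proof.
move=> ht hL; split=> //.
- move=> t'; rewrite inE => /eqP ->; split=> //.
  by split; [exact: hull_l|exact: hull_m|exact: hull_r].
- by move=> t' l; rewrite inE => /eqP ->; exact: hL.
- by move=> T _; rewrite big_seq1.
- by move=> w _ _; rewrite big_seq1.
Qed.

Lemma dissection_rot L x y z P E : pcone x -> pcone y -> pcone z ->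
  dissection L (y, z, x) P E -> dissection L (x, y, z) P E.
Proof.
move=> hx hy hz [d1 d2 d3 d4 d5]; split=> //.
- move=> t' /d1[tr [h1 h2 h3]]; split=> //.
  by split; [exact: (hull_rot h1)|exact: (hull_rot h2)|exact: (hull_rot h3)].
- move=> T aT; rewrite -d3 // /tval /= (add_edges aT hx hx hy hz) (add_edges aT hx hy hz hx).
  by ring.
- by move=> w hw nw; rewrite -d4 // /tval /= (deg_rot w x).
Qed.

Lemma pcone_comb x y (a b : R) : pcone x -> pcone y -> 0 < a -> 0 < b ->
  pcone (vscale a x + vscale b y).
Proof. by move=> *; apply: pconeD; exact: pconeZ. Qed.

Lemma dissection_edge x y z (a b : R) : tri (x, y, z) -> 0 < a -> 0 < b ->
  let m := vscale a x + vscale b y in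
  dissection [::] (x, y, z) [:: (x, m, z); (m, y, z)]
    [:: cross x y; cross y z; cross z x; cross m z].
Proof.
move=> tr a0 b0 m; have [/= hx hy hz nz] := tr.
have hm : pcone m by exact: pcone_comb.
have e1 : det3 x m z = b * det3 x y z by rewrite /m /det3 /=; ring.
have e2 : det3 m y z = a * det3 x y z by rewrite /m /det3 /=; ring.
have n1 : det3 x m z != 0 by rewrite e1 mulf_neq0 // gt_eqF.
have n2 : det3 m y z != 0 by rewrite e2 mulf_neq0 // gt_eqF.
have mh : hull x y z m.
  exists a, b, 0; split; [exact: ltW|exact: ltW|exact: lexx|].
  by apply: vec_eqP => /=; ring.
split=> //.
- move=> t'; rewrite !inE => /orP[/eqP->|/eqP->]; split=> //; split=> //=;
    by [exact: hull_l|exact: hull_r|exact: hull_m].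
- move=> T aT; rewrite !big_cons big_nil addr0 /tval /=.
  have [coc flat] := aT.
  have := coc x m y z hx hm hy hz; rewrite (flat x m y) //; last by rewrite /m /det3 /=; ring.
  lra.
- move=> w hw nw; rewrite !big_cons big_nil addr0 /tval /=.
  apply: deg_cut => //; rewrite -dot_cross; apply: nw; rewrite !inE eqxx ?orbT //.
- have [p1 p2 p3] := npar6 nz; have [_ p4 _] := npar6 n1.
  by move=> nu; rewrite !inE => /or4P[] /eqP->.
Qed.

(** The measure of the induction: after a cut, each piece has the new vertex, on the plane, in place
    of a vertex that was off it. *)
Definition nzc l t : nat :=
  ((dot l t.1.1 != 0%R) + (dot l t.1.2 != 0%R) + (dot l t.2 != 0%R))%N.

Lemma dissection1 l k t : tri t -> (nzc l t <= k)%N ->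
  exists P E, dissection [:: l] t P E.
Proof.
elim: k t => [|k IH] t ht hk.
  exists [:: t], [::]; apply: dissection_id => // l'; rewrite inE => /eqP ->; left.
  move: hk; rewrite /nzc.
  case: eqP => [->|//]; case: eqP => [->|//]; case: eqP => [->|//] _.
  by rewrite lexx.
have step x y z : tri (x, y, z) -> (nzc l (x, y, z) <= k.+1)%N ->
    dot l x * dot l y < 0 -> exists P E, dissection [:: l] (x, y, z) P E.
  move=> tr hc neg.
  have nx : dot l x != 0 by apply: contraTneq neg => ->; rewrite mul0r ltxx.
  have ny : dot l y != 0 by apply: contraTneq neg => ->; rewrite mulr0 ltxx.
  (* These weights put [m] in the kernel of [l], because [l] has opposite signs at [x] and [y]. *)
  pose a := `|dot l y|; pose b := `|dot l x|.
  have a0 : 0 < a by rewrite normr_gt0.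
  have b0 : 0 < b by rewrite normr_gt0.
  have hd := dissection_edge tr a0 b0.
  set m := vscale a x + vscale b y in hd.
  have m0 : dot l m = 0.
    rewrite dotD !dotZ /a /b; move: neg.
    have [x0|x0|x0] := ltrgt0P (dot l x); last by rewrite x0 mul0r ltxx.
      by rewrite pmulr_rlt0 // => y0; rewrite (ltr0_norm y0) ; ring.
    by rewrite nmulr_rlt0 // => y0; rewrite (gtr0_norm y0) ; ring.
  apply: (@dissection_bind [::] [:: l] _ _ _ hd) => t'.
  have [d1 _ _ _ _] := hd; move=> tP; have [tr' _] := d1 _ tP; apply: IH => //.
  move: tP; rewrite !inE => /orP[/eqP->|/eqP->]; move: hc;
    rewrite /nzc /= m0 eqxx nx ny /=; lia.
case: t ht hk => [[x y] z] ht hk; have [/= hx hy hz nz] := ht.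
have [xy|xy] := ltrP (dot l x * dot l y) 0; first exact: step.
have [yz|yz] := ltrP (dot l y * dot l z) 0.
  have [||P [E d]] := step y z x _ _ yz.
  - by split=> //=; rewrite det3_perm.
  - by move: hk; rewrite /nzc /=; lia.
  by exists P, E; exact: dissection_rot.
have [zx|zx] := ltrP (dot l z * dot l x) 0.
  have [||P [E d]] := step z x y _ _ zx.
  - by split=> //=; rewrite det3_perm det3_perm.
  - by move: hk; rewrite /nzc /=; lia.
  by exists P, E; apply: dissection_rot => //; exact: dissection_rot.
exists [:: (x, y, z)], [::]; apply: dissection_id => // l'; rewrite inE => /eqP ->.
rewrite /onesided /=.
have [px|nx|ex] := ltrgt0P (dot l x).
- by left; rewrite pmulr_rge0 // in xy; rewrite pmulr_lge0 // in zx; split=> //; exact: ltW.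
- right; rewrite nmulr_rge0 // in xy; rewrite nmulr_lge0 // in zx; split=> //; exact: ltW.
rewrite ?ex ?lexx.
have [py|ny|ey] := ltrgt0P (dot l y).
- by left; rewrite pmulr_rge0 // in yz; split=> //; exact: ltW.
- by right; rewrite nmulr_rge0 // in yz; split=> //; exact: ltW.
by rewrite ?ey ?lexx; have [?|?] := lerP 0 (dot l z); [left|right]; split=> //; exact: ltW.
Qed.

Lemma dissectionP L t : tri t -> exists P E, dissection L t P E.
Proof.
elim: L t => [|l L IH] t ht; first by exists [:: t], [::]; exact: dissection_id.
have [P [E d]] := dissection1 ht (leqnn (nzc l t)).
apply: (@dissection_bind [:: l] L _ _ _ d) => t' tP; apply: IH.
by have [d1 _ _ _ _] := d; have [] := d1 _ tP.
Qed.
End Cutting.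

(** * The action of a Fuchsian group on forms *)

Section Roots.
Variable R : realType.
Local Notation V := (R * R * R)%type.
Local Notation C := R[i].
Implicit Types (x y z w : V) (g h : 'M[R]_2).

(** Real and imaginary part of the root of A t^2 + B t + C in the upper half-plane. *)
Definition rootre x : R := - x.1.2 / (2 * x.1.1).
Definition rootim x : R := Num.sqrt (disc x) / (2 * x.1.1).
Definition formroot x : C := Complex (rootre x) (rootim x).

Lemma rootim_gt0 x : pcone x -> 0 < rootim x.
Proof. by move=> [A0 d]; rewrite /rootim divr_gt0 ?sqrtr_gt0 ?mulr_gt0. Qed.

Lemma mobius_root x g : \det g = 1 -> pcone x -> mobius g (formroot (fact x g)) = formroot x.
Proof.
move=> dg hx; have hg := pcone_fact dg hx.
have dE : disc (fact x g) = disc x by rewrite disc_fact dg expr1n mul1r.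
have im0 := rootim_gt0 hg.
set w := formroot (fact x g); set z := formroot x.
have den : rC (gc g) * w + rC (gd g) != 0.
  apply/eqP; rewrite /rC /w /formroot; simpc => -[h1 h2].
  have c0 : gc g = 0 by apply/eqP; move/eqP: h2; rewrite mulf_eq0 (gt_eqF im0) orbF.
  have d0 : gd g = 0 by move: h1; rewrite c0 mul0r add0r.
  by move: dg; rewrite det2E c0 d0 !mulr0 subrr => /eqP; rewrite eq_sym oner_eq0.
suff e : rC (ga g) * w + rC (gb g) = z * (rC (gc g) * w + rC (gd g)).
  by rewrite /mobius -/w e mulfK.
move: dE dg; rewrite /w /z /formroot /rC /rootre /rootim.
have := hg.1; have := hx.1.
have : Num.sqrt (disc x) ^+ 2 = disc x by rewrite sqr_sqrtr // ltW // hx.2.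
case: x hx hg w z im0 den => [[A B] C0] hx hg w z im0 den /=.
rewrite det2E; set s := Num.sqrt _ => s2 A0 A'0 dE dg.
rewrite dE -/s; simpc.
move: s2 A'0; rewrite /disc /=.
move: (ga g) (gb g) (gc g) (gd g) dg => a b c d dg s2 A'0.
set A' := A * a ^+ 2 + B * (a * c) + C0 * c ^+ 2 in A'0 *.
have An : A != 0 by rewrite gt_eqF.
have A'n : A' != 0 by rewrite gt_eqF.
have q4 : 4 * A * A' != 0 by rewrite !mulf_neq0 ?pnatr_eq0.
set B' := A * (2 * (a * b)) + B * (a * d + b * c) + C0 * (2 * (c * d)).
(* After clearing denominators, with the square of [s] replaced by the discriminant in the real
   part, both parts are multiples of 1 - (ad - bc). *)
congr Complex; apply: (mulfI q4); apply/eqP; rewrite -subr_eq0; apply/eqP.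
- transitivity (2 * A * (a * - B' + 2 * A' * b) + B * (c * - B' + 2 * A' * d) + c * s ^+ 2).
    by field; rewrite An A'n.
  rewrite s2 [LHS](_ : _ = c * (4 * (A * C0) - B ^+ 2) * (1 - (a * d - b * c))).
    by rewrite dg subrr mulr0.
  by rewrite /A' /B'; ring.
- transitivity (s * (2 * A * a + B * c - (2 * A' * d - c * B'))).
    by field; rewrite An A'n.
  rewrite [LHS](_ : _ = s * (2 * A * a + B * c) * (1 - (a * d - b * c))).
    by rewrite dg subrr mulr0.
  by rewrite /A' /B'; ring.
Qed.

(** The form [x] minus a small multiple of u^2 + v^2 is still positive definite, so a bound on
    [bil x y] bounds the trace of [y]; with the discriminant fixed this confines the root to a
    compact box. *)
Lemma bil_bound x (D K : R) : pcone x -> 0 < D -> exists2 M, 0 < M & forall y, pcone y -> disc y = D ->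
  bil x y <= K -> [/\ - M <= rootre y, rootre y <= M, M^-1 <= rootim y & rootim y <= M].
Proof.
move=> hx D0; have [A0 C0] := pcone_gt0 hx; have dx := hx.2.
(* With this value the shifted form has discriminant disc x / 2 + 4 k^2. *)
pose k := disc x / (8 * (x.1.1 + x.2)).
have S0 : 0 < 8 * (x.1.1 + x.2) by lra.
have k0 : 0 < k by rewrite divr_gt0.
have kE : k * (8 * (x.1.1 + x.2)) = disc x by rewrite divfK ?gt_eqF.
have hxe : pcone (x.1.1 - k, x.1.2, x.2 - k).
  split => /=.
    rewrite subr_gt0 /k ltr_pdivrMr //.
    rewrite /disc; have := sqr_ge0 x.1.2; have : 0 < x.1.1 * x.2 by exact: mulr_gt0.
    nra.
  rewrite (_ : disc _ = disc x - k * (8 * (x.1.1 + x.2)) / 2 + 4 * k ^+ 2); last first.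
    by rewrite /disc /=; field.
  rewrite kE; have := sqr_ge0 k; lra.
have k2 : 0 < 2 * k by rewrite pmulr_rgt0.
pose L := `|K| / (2 * k) + 1.
have L0 : 0 < L by rewrite ltr_wpDl // divr_ge0 // ltW // mulr_gt0.
pose s := Num.sqrt D.
have s0 : 0 < s by rewrite sqrtr_gt0.
pose M1 := 4 * L ^+ 2 / D; pose M2 := 2 * L / s; pose M3 := 2 * L * s / D.
have M10 : 0 < M1 by rewrite divr_gt0 // mulr_gt0 // exprn_gt0.
have M20 : 0 < M2 by rewrite divr_gt0 // mulr_gt0.
have M30 : 0 < M3 by rewrite divr_gt0 // !mulr_gt0.
exists (M1 + M2 + M3) => [|y hy dy hb]; first by rewrite !addr_gt0.
have [a0 c0] := pcone_gt0 hy.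
have sum : y.1.1 + y.2 <= L.
  have h := bil_gt0 hxe hy.
  have e : bil x y = bil (x.1.1 - k, x.1.2, x.2 - k) y + k * 2 * (y.1.1 + y.2).
    by rewrite /bil /=; ring.
  have h2 : y.1.1 + y.2 <= K / (2 * k) by rewrite ler_pdivlMr //; lra.
  apply: le_trans h2 _; rewrite /L ler_wpDr // ler_pM2r ?invr_gt0 //.
  exact: ler_norm.
have aL : y.1.1 <= L by lra.
have cL : y.2 <= L by lra.
have dE : 4 * (y.1.1 * y.2) - y.1.2 ^+ 2 = D by [].
have aD : D / (2 * L) <= 2 * y.1.1.
  rewrite ler_pdivrMr ?mulr_gt0 //; have := sqr_ge0 y.1.2.
  have : y.1.1 * y.2 <= y.1.1 * L by rewrite ler_pM2l.
  lra.
have bL : `|y.1.2| <= 2 * L.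
  rewrite -(@ler_pXn2r _ 2) ?nnegrE // ?mulr_ge0 ?ltW // real_normK ?num_real //.
  have : y.1.1 * y.2 <= L * L by rewrite ler_pM // ltW.
  rewrite exprMn; lra.
have q0 : 0 < D / (2 * L) by rewrite divr_gt0 // mulr_gt0.
have a20 : 0 < 2 * y.1.1 by rewrite mulr_gt0.
have re : `|rootre y| <= M1.
  rewrite /rootre normrM normrN normrV ?unitfE ?gt_eqF // (gtr0_norm a20).
  rewrite ler_pdivrMr //.
  apply: le_trans bL _; rewrite (_ : 2 * L = M1 * (D / (2 * L))); last first.
    by rewrite /M1; field; rewrite !gt_eqF.
  by rewrite ler_pM2l.
have imE : rootim y = s / (2 * y.1.1) by rewrite /rootim dy.
move: re; rewrite ler_norml => /andP[r1 r2].
split; [lra|lra| |].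
- have p1 : 0 < 2 * y.1.1 / s by exact: divr_gt0.
  have p2 : 0 < M1 + M2 + M3 by rewrite !addr_gt0.
  rewrite imE -[s / _]invf_div lef_pV2 ?posrE //.
  have : 2 * y.1.1 / s <= M2 by rewrite ler_pM2r ?invr_gt0 // ler_pM2l.
  lra.
- have : rootim y <= M3.
    rewrite imE ler_pdivrMr //.
    have -> : s = M3 * (D / (2 * L)) by rewrite /M3; field; rewrite !gt_eqF.
    by rewrite ler_pM2l.
  lra.
Qed.

Definition mobius_free (G : set 'M[R]_2) :=
  forall g x, G g -> pcone x -> fact x g = x -> g = 1%:M.

(** Proper discontinuity in terms of forms: at fixed discriminants [bil] is an increasing function
    of hyperbolic distance. *)
Definition bil_finite (G : set 'M[R]_2) :=
  forall x y K, pcone x -> pcone y -> finite_set [set g | G g /\ bil x (fact y g) <= K].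

Lemma freeP (G : set 'M[R]_2) : subgroup_SL2 G -> acts_freely G -> mobius_free G.
Proof.
move=> [_ dG _ _] fG g x Gg hx e; apply: (fG g Gg (formroot x)).
  exact: rootim_gt0.
by rewrite -{1}e mobius_root // dG.
Qed.

(** Every [g] that is counted maps the root of [fact y g] to the root of [y], and both lie in one
    compact box. *)
Lemma finiteP (G : set 'M[R]_2) : subgroup_SL2 G -> acts_properly_discontinuously G ->
  bil_finite G.
Proof.
move=> [_ dG _ _] pd x y K hx hy.
have [M1 M10 h1] := bil_bound K hx hy.2.
have [M2 M20 h2] := bil_bound (bil y y) hy hy.2.
pose M := M1 + M2.
pose S : set (R * R) := `[- M, M]%classic `*` `[M^-1, M]%classic.
have cS : compact S by apply: compact_setX; exact: segment_compact.
have M0 : 0 < M by rewrite addr_gt0.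
have Sp p : S p -> 0 < p.2.
  by move=> [_] /=; rewrite in_itv /= => /andP[+ _]; apply: lt_le_trans; rewrite invr_gt0.
apply: sub_finite_set (pd S cS Sp) => g /= [Gg hb]; split=> //.
have box (m : R) z : 0 < m -> m <= M -> [/\ - m <= rootre z, rootre z <= m, m^-1 <= rootim z & rootim z <= m] ->
    S (rootre z, rootim z).
  move=> m0 mM [q1 q2 q3 q4]; have i : M^-1 <= m^-1 by rewrite lef_pV2.
  by split; rewrite /= in_itv /=; apply/andP; split; lra.
exists (rootre (fact y g), rootim (fact y g)), (rootre y, rootim y); split.
- apply: (box M1) => //; first by rewrite lerDl ltW.
  apply: h1 => //; first by apply: pcone_fact => //; exact: dG.
  by rewrite disc_fact dG // expr1n mul1r.
- by apply: (box M2) => //; [rewrite lerDr ltW | exact: h2].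
- exact: (mobius_root (dG _ Gg) hy).
Qed.

End Roots.

(** * Stabilisers of lines *)

Section Stabiliser.
Variable R : realType.
Local Notation V := (R * R * R)%type.
Local Notation M2 := ('M[R]_2).
Implicit Types (x y z w : V) (g h k : M2).

Lemma det1_unit g : \det g = 1 -> g \in unitmx.
Proof. by move=> e; rewrite unitmxE e unitr1. Qed.

Lemma mulVg g : \det g = 1 -> invmx g *m g = 1%:M.
Proof. by move=> e; apply: mulVmx; exact: det1_unit. Qed.

Lemma mulgV g : \det g = 1 -> g *m invmx g = 1%:M.
Proof. by move=> e; apply: mulmxV; exact: det1_unit. Qed.

Lemma factK g x : \det g = 1 -> fact (fact x g) (invmx g) = x.
Proof. by move=> e; rewrite -fact_mul mulgV // fact1. Qed.

Lemma factKV g x : \det g = 1 -> fact (fact x (invmx g)) g = x.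
Proof. by move=> e; rewrite -fact_mul mulVg // fact1. Qed.

Lemma mx2P g h : ga g = ga h -> gb g = gb h -> gc g = gc h -> gd g = gd h -> g = h.
Proof.
rewrite /ga /gb /gc /gd => e1 e2 e3 e4; apply/matrixP => i j.
have o (l : 'I_2) : l = ord0 \/ l = ord_max.
  by case: l => -[|[|//]] hl; [left|right]; exact: val_inj.
by case: (o i) => ->; case: (o j) => ->.
Qed.

Definition mk2 (a b c d : R) : M2 :=
  \matrix_(i, j) (if i == ord0 then if j == ord0 then a else b
                  else if j == ord0 then c else d).

Lemma mk2E a b c d : [/\ ga (mk2 a b c d) = a, gb (mk2 a b c d) = b,
  gc (mk2 a b c d) = c & gd (mk2 a b c d) = d].
Proof. by rewrite /ga /gb /gc /gd !mxE. Qed.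

(** The columns of [P] are two isotropic vectors of the form; for A nonzero they come from its two
    real roots, and the factor A/s makes the determinant 1. *)
Lemma indef_diag (n : V) : disc n < 0 -> exists P b, [/\ \det P = 1, b != 0 & fact n P = (0, b, 0)].
Proof.
case: n => [[A B] C]; rewrite /disc /= => d.
have [A0|An] := eqVneq A 0.
  have Bn : B != 0 by apply: contraTneq d => ->; rewrite A0 -leNgt expr0n mul0r mulr0 subrr.
  have [e1 e2 e3 e4] := mk2E 1 (- C / B) 0 1.
  exists (mk2 1 (- C / B) 0 1), B; split=> //; first by rewrite det2E e1 e2 e3 e4; ring.
  by rewrite /fact e1 e2 e3 e4 A0; apply: vec_eqP => /=; field.
pose s := Num.sqrt (B ^+ 2 - 4 * (A * C)).
have s2 : s ^+ 2 = B ^+ 2 - 4 * (A * C) by rewrite sqr_sqrtr //; lra.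
have sn : s != 0 by apply: contraTneq d => e; move: s2; rewrite e expr0n /= => e2; rewrite -leNgt; lra.
pose r1 := (- B + s) / (2 * A); pose r2 := (- B - s) / (2 * A).
have [e1 e2 e3 e4] := mk2E (A / s * r1) r2 (A / s) 1.
exists (mk2 (A / s * r1) r2 (A / s) 1), (- s); rewrite oppr_eq0; split=> //.
  by rewrite det2E e1 e2 e3 e4 /r1 /r2; field; rewrite An sn.
rewrite /fact e1 e2 e3 e4; apply: vec_eqP => /=.
- transitivity ((s ^+ 2 - (B ^+ 2 - 4 * (A * C))) * A / (4 * s ^+ 2)).
    by rewrite /r1; field; rewrite An sn.
  by rewrite s2 subrr !mul0r.
- transitivity (- (B ^+ 2 - 4 * (A * C) + s ^+ 2) / (2 * s)).
    by rewrite /r1 /r2; field; rewrite An sn.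
  by rewrite -s2; field.
- transitivity ((s ^+ 2 - (B ^+ 2 - 4 * (A * C))) / (4 * A)).
    by rewrite /r2; field.
  by rewrite s2 subrr !mul0r.
Qed.

(** In signature (1, 2) the orthogonal complement of a positive vector is negative definite. If
    [disc n] were non-negative, the chain of Cauchy-Schwarz inequalities would consist of equalities
    and [n] would vanish. *)
Lemma bil_orth_disc (n : V) x : pcone x -> n <> 0 -> bil n x = 0 -> disc n < 0.
Proof.
move=> hx n0; have [A0 C0] := pcone_gt0 hx; have dx := hx.2.
case: n n0 => [[a b] c]; case: x hx A0 C0 dx => [[A B] C] hx /=; rewrite /disc /bil /=.
move=> A0 C0 dx n0 e; rewrite ltNge; apply/negP => d.
have ac : 0 <= a * c by have := sqr_ge0 b; lra.
have e2 : (2 * (a * C) + 2 * (A * c)) ^+ 2 = b ^+ 2 * B ^+ 2.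
  rewrite -exprMn; have -> : 2 * (a * C) + 2 * (A * c) = b * B by lra.
  by [].
have h1 : b ^+ 2 * B ^+ 2 <= 4 * (a * c) * B ^+ 2 by rewrite ler_wpM2r ?sqr_ge0 //; lra.
have h2 : 4 * (a * c) * B ^+ 2 <= 4 * (a * c) * (4 * (A * C)).
  by apply: ler_wpM2l; [exact: mulr_ge0|lra].
have sq : (a * C - A * c) ^+ 2 = 0.
  by apply/eqP; rewrite eq_le sqr_ge0 andbT; nra.
have e3 : a * C = A * c by apply/eqP; rewrite -subr_eq0 -sqrf_eq0 sq.
have z : a * c * (4 * (A * C) - B ^+ 2) = 0.
  have p : 0 <= 4 * (A * C) - B ^+ 2 by lra.
  apply/eqP; rewrite eq_le (mulr_ge0 ac p) andbT.
  have : (2 * (a * C) + 2 * (A * c)) ^+ 2 = 16 * (a * c * (A * C)).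
    transitivity (16 * (a * C) * (A * c)); last by ring.
    by rewrite e3; ring.
  lra.
have ac0 : a * c = 0.
  by apply/eqP; move/eqP: z; rewrite mulf_eq0 [_ - _ == 0]gt_eqF ?orbF //; lra.
have a0 : a = 0.
  have : a ^+ 2 * C = 0 by transitivity (a * (a * C)); [ring|rewrite e3 mulrCA ac0 mulr0].
  by move/eqP; rewrite mulf_eq0 (gt_eqF C0) orbF sqrf_eq0 => /eqP.
have c0 : c = 0.
  by move/esym/eqP: e3; rewrite a0 mul0r mulf_eq0 (gt_eqF A0) => /eqP.
apply: n0; rewrite a0 c0; congr (_, _, _).
by move: d; rewrite a0 mul0r mulr0 sub0r oppr_ge0 => d; apply/eqP; rewrite -sqrf_eq0 eq_le d sqr_ge0.
Qed.

(** A normal form for lines: the normal vector of the plane is indefinite, hence a multiple of uv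
    after a substitution, and the plane orthogonal to uv consists of the diagonal forms. *)
Lemma line_diag x y : pcone x -> pcone y -> ~ par x y ->
  exists2 P, \det P = 1 & forall z, det3 x y z = 0 <-> (fact z P).1.2 = 0.
Proof.
move=> hx hy npar; pose c := cross x y.
(* The vector that represents the linear form det3 x y with respect to [bil]. *)
pose n : V := (c.2 / 2, - c.1.2, c.1.1 / 2).
have nE z : bil n z = det3 x y z.
  by rewrite /bil /n /c /det3 /=; field.
have n0 : n <> 0.
  move=> [/= h1 h2 h3]; apply: npar.
  by apply: vec_eqP => /=; lra.
have [|P [b [dP bn nP]]] := @indef_diag n.
  by apply: (bil_orth_disc hx n0); rewrite nE /det3; ring.
exists P => // z; rewrite -nE.
have -> : bil n z = bil (fact n P) (fact z P) by rewrite bil_fact dP expr1n mul1r.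
rewrite nP /bil /= !mul0r !mulr0 add0r sub0r; split=> [/eqP|->]; last by rewrite mulr0 oppr0.
by rewrite oppr_eq0 mulf_eq0 (negPf bn) => /eqP.
Qed.

Lemma fact_opp1 x : fact x (- 1%:M) = x.
Proof.
by case: x => [[A B] C]; rewrite /fact /ga /gb /gc /gd !mxE /=; apply: vec_eqP => /=; ring.
Qed.

Lemma opp1_neq1 : (- 1%:M : M2) <> 1%:M.
Proof.
by move/matrixP/(_ ord0 ord0); rewrite !mxE /= => h; have : (0 : R) < 1 by []; lra.
Qed.

Variable G : set M2.
Hypothesis sG : subgroup_SL2 G.
Hypothesis fG : mobius_free G.
Hypothesis finG : bil_finite G.

Let G1 : G 1%:M. Proof. by case: sG. Qed.
Let dG g : G g -> \det g = 1. Proof. by case: sG => _ + _ _; apply. Qed.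
Let GM g h : G g -> G h -> G (g *m h). Proof. by case: sG => _ _ + _; apply. Qed.
Let GV g : G g -> G (invmx g). Proof. by case: sG => _ _ _; apply. Qed.

Definition pla (x y : V) : set V := [set z | pcone z /\ det3 x y z = 0].
Definition setfact (L : set V) g : set V := [set fact z g | z in L].
Definition stab (L : set V) : set M2 := [set g | G g /\ setfact L g = L].

Lemma form1_pcone : pcone (1, 0, 1 : R).
Proof. by split; rewrite /disc /= ?ltr01 // expr0n subr0 !mulr1. Qed.

(** Two diagonal test forms force the conjugate [q] to be diagonal or antidiagonal. In the second
    case its square is -1, which fixes every form, contrary to freeness. *)
Lemma stab_char x y : pcone x -> pcone y -> ~ par x y ->
  exists2 P, \det P = 1 & forall k, stab (pla x y) k -> exists2 t, t != 0 &
    k = P *m mk2 t 0 0 t^-1 *m invmx P.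
Proof.
move=> hx hy npar; have [P dP hP] := line_diag hx hy npar.
exists P => // k [Gk Lk]; pose q := invmx P *m k *m P.
have dk := dG Gk.
have dPV : \det (invmx P) = 1 by rewrite det_inv dP invr1.
have dq : ga q * gd q - gb q * gc q = 1 by rewrite -det2E !det_mulmx dPV dP dk !mul1r.
have kE : k = P *m q *m invmx P.
  by rewrite /q !mulmxA mulgV // mul1mx -mulmxA mulgV // mulmx1.
have diag (a c : R) : 0 < a -> 0 < c -> (fact (a, 0, c) q).1.2 = 0.
  move=> a0 c0.
  have hd : pcone (a, 0, c).
    by split; rewrite //= /disc /= expr0n /= subr0 !mulr_gt0.
  pose z := fact (a, 0, c) (invmx P).
  have zL : pla x y z.
    by split; [exact: pcone_fact|apply/hP; rewrite factKV].
  have : pla x y (fact z k) by rewrite -Lk; exists z.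
  by move=> [_ /hP]; rewrite /z /q !fact_mul.
have eq1 := diag 1 1 ltr01 ltr01; have eq2 := diag 1 2 ltr01 (ltr0n _ 2).
move: eq1 eq2; rewrite /fact /= => eq1 eq2.
have pq : ga q * gb q = 0 by lra.
have rs : gc q * gd q = 0 by lra.
have [p0|pn] := eqVneq (ga q) 0.
  exfalso; clearbody q.
  have s0 : gd q = 0.
    have : gd q * 1 = 0 by rewrite -dq p0; transitivity (- (gb q * (gc q * gd q))); [ring|rewrite rs mulr0 oppr0].
    by rewrite mulr1.
  have qq : q *m q = - 1%:M.
    have [e1 e2 e3 e4] := mul2E q q; apply: mx2P.
    - by rewrite e1 p0 /ga !mxE /=; move: dq; rewrite p0 s0; lra.
    - by rewrite e2 p0 s0 /gb !mxE /=; ring.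
    - by rewrite e3 p0 s0 /gc !mxE /=; ring.
    - by rewrite e4 s0 /gd !mxE /=; move: dq; rewrite p0 s0; lra.
  have kk : k *m k = - 1%:M.
    transitivity (P *m q *m (invmx P *m P) *m q *m invmx P); first by rewrite kE !mulmxA.
    by rewrite mulVg // mulmx1 -(mulmxA P) qq mulmxN mulmx1 mulNmx mulgV.
  apply: opp1_neq1; rewrite -kk; apply: (fG (GM Gk Gk) hx).
  by rewrite kk fact_opp1.
have q0 : gb q = 0 by apply/eqP; move/eqP: pq; rewrite mulf_eq0 (negPf pn).
have sE : gd q = (ga q)^-1 by apply: (mulfI pn); rewrite divff //; move: dq; rewrite q0; lra.
have r0 : gc q = 0.
  by apply/eqP; move/eqP: rs; rewrite sE mulf_eq0 invr_eq0 (negPf pn) orbF.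
exists (ga q) => //; rewrite kE; congr (_ *m _ *m _).
by have [e1 e2 e3 e4] := mk2E (ga q) 0 0 (ga q)^-1; apply: mx2P; rewrite ?e1 ?e2 ?e3 ?e4.
Qed.
End Stabiliser.

Lemma finite_min (R : realType) (T : choiceType) (A : set T) (f : T -> R) x0 :
  finite_set A -> A x0 -> exists2 x, A x & forall y, A y -> f x <= f y.
Proof.
move=> /finite_seqP[s ->] /=.
elim: s x0 => [//|y s IH] x0 _.
case: s IH => [|z s] IH.
  by exists y; rewrite /= ?mem_head // => u; rewrite inE => /eqP ->.
have [x xs hx] := IH z (mem_head _ _).
have [le|lt] := lerP (f y) (f x).
  exists y; rewrite /= ?mem_head // => u; rewrite inE => /orP[/eqP -> //|us].
  by apply: le_trans le _; exact: hx.
exists x; first by rewrite /= inE xs orbT.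
by move=> u; rewrite inE => /orP[/eqP ->|]; [exact: ltW|exact: hx].
Qed.

Lemma pow_bracket (R : realType) (q y : R) : 1 < q -> 1 <= y ->
  exists n, q ^+ n <= y < q ^+ n.+1.
Proof.
move=> q1 y1.
have ex : exists n, y < q ^+ n.
  have b n : 1 + n%:R * (q - 1) <= q ^+ n.
    elim: n => [|n IH]; first by rewrite expr0 mul0r addr0.
    rewrite exprS -natr1.
    have n0 : 0 <= n%:R :> R by exact: ler0n.
    have : q * (1 + n%:R * (q - 1)) <= q * q ^+ n by rewrite ler_pM2l // (lt_trans ltr01).
    have : 0 <= n%:R * (q - 1) ^+ 2 by rewrite mulr_ge0 ?sqr_ge0.
    lra.
  exists (Num.truncn (y / (q - 1))).+1.
  apply: lt_le_trans (b _); have := truncnS_gt (y / (q - 1)).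
  rewrite ltr_pdivrMr ?subr_gt0 //; lra.
case: (ex_minnP ex) => -[|n] hn mn.
  by move: hn; rewrite expr0 ltNge y1.
exists n; rewrite hn andbT leNgt; apply/negP => /mn.
by rewrite ltnn.
Qed.

Section Cyclic.
Variable R : realType.
Local Notation V := (R * R * R)%type.
Local Notation M2 := ('M[R]_2).
Implicit Types (x y z w : V) (g h k : M2).
Variable G : set M2.
Hypothesis sG : subgroup_SL2 G.
Hypothesis fG : mobius_free G.
Hypothesis finG : bil_finite G.

Let G1 : G 1%:M. Proof. by case: sG. Qed.
Let dG g : G g -> \det g = 1. Proof. by case: sG => _ + _ _; apply. Qed.
Let GM g h : G g -> G h -> G (g *m h). Proof. by case: sG => _ _ + _; apply. Qed.
Let GV g : G g -> G (invmx g). Proof. by case: sG => _ _ _; apply. Qed.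

Lemma setfactM (L : set V) g h : setfact L (g *m h) = setfact (setfact L g) h.
Proof.
apply/seteqP; split=> z.
  by move=> [u Lu <-]; exists (fact u g); [exists u|rewrite fact_mul].
by move=> [_ [u Lu <-] <-]; exists u; rewrite // fact_mul.
Qed.

Lemma setfact1 (L : set V) : setfact L 1%:M = L.
Proof.
apply/seteqP; split=> z; first by move=> [u Lu <-]; rewrite fact1.
by move=> Lz; exists z; rewrite ?fact1.
Qed.

Lemma stabM L g h : stab G L g -> stab G L h -> stab G L (g *m h).
Proof. by move=> [Gg Lg] [Gh Lh]; split; [exact: GM|rewrite setfactM Lg]. Qed.

Lemma stabV L g : stab G L g -> stab G L (invmx g).
Proof.
move=> [Gg Lg]; split; first exact: GV.
by rewrite -{1}Lg -setfactM mulgV ?setfact1 // dG.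
Qed.

(** The eigenvalue [chi] embeds the stabiliser into the multiplicative group, and absolute value 1
    forces the identity because -1 is excluded. Properness leaves finitely many eigenvalues in a
    bounded range, so an element with the least absolute value above 1 exists; division with
    remainder shows that it generates. *)
Lemma stab_cyclic x y : pcone x -> pcone y -> ~ par x y ->
  (forall k, stab G (pla x y) k -> k = 1%:M) \/
  exists h, [/\ stab G (pla x y) h, forall k, stab G (pla x y) k -> exists m : int, k = h ^ m &
                forall m : int, h ^ m = 1 -> m = 0].
Proof.
move=> hx hy npar; have [P dP hP] := stab_char sG fG hx hy npar.
set S := stab G (pla x y) in hP *.
pose D t := P *m mk2 t 0 0 t^-1 *m invmx P.
pose chi k := ga (invmx P *m k *m P).
have chiD t : chi (D t) = t.
  rewrite /chi /D !mulmxA mulVg // mul1mx -mulmxA mulVg // mulmx1.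
  by have [] := mk2E t 0 0 t^-1.
have DM s t : D s *m D t = D (s * t).
  rewrite /D; transitivity (P *m mk2 s 0 0 s^-1 *m (invmx P *m P) *m mk2 t 0 0 t^-1 *m invmx P).
    by rewrite !mulmxA.
  rewrite mulVg // mulmx1 -(mulmxA P); congr (_ *m _ *m _).
  have [e1 e2 e3 e4] := mk2E s 0 0 s^-1; have [e5 e6 e7 e8] := mk2E t 0 0 t^-1.
  have [e9 e10 e11 e12] := mk2E (s * t) 0 0 (s * t)^-1.
  have [m1 m2 m3 m4] := mul2E (mk2 s 0 0 s^-1) (mk2 t 0 0 t^-1).
  by apply: mx2P; rewrite ?m1 ?m2 ?m3 ?m4 ?e1 ?e2 ?e3 ?e4 ?e5 ?e6 ?e7 ?e8 ?e9 ?e10 ?e11 ?e12 ?invfM; ring.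
have D1 : D 1 = 1%:M.
  rewrite /D (_ : mk2 _ _ _ _ = 1%:M) ?mulmx1 ?mulgV //.
  have [e1 e2 e3 e4] := mk2E 1 0 0 (1^-1 : R).
  by apply: mx2P; rewrite ?e1 ?e2 ?e3 ?e4 /ga /gb /gc /gd !mxE //= invr1.
have DN1 : D (-1) = - 1%:M.
  rewrite /D (_ : mk2 _ _ _ _ = - 1%:M) ?mulmxN ?mulmx1 ?mulNmx ?mulgV //.
  have [e1 e2 e3 e4] := mk2E (-1) 0 0 ((-1)^-1 : R).
  by apply: mx2P; rewrite ?e1 ?e2 ?e3 ?e4 /ga /gb /gc /gd !mxE //= ?oppr0 ?invrN1.
have SD k : S k -> chi k != 0 /\ k = D (chi k).
  by move=> /hP[t t0 e]; have ce : chi k = t; [rewrite e chiD|rewrite ce].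
have chiM k k' : S k -> S k' -> chi (k *m k') = chi k * chi k'.
  by move=> /SD[_ e] /SD[_ e']; rewrite {1}e {1}e' DM chiD.
have norm1 k : S k -> `|chi k| = 1 -> k = 1%:M.
  move=> Sk n1; have [_ e] := SD _ Sk; have [Gk _] := Sk.
  have [p|p|p] := ltrgt0P (chi k).
  - by move: n1; rewrite (gtr0_norm p) => n1; rewrite e n1.
  - exfalso; apply: (@opp1_neq1 R); have kN : k = - 1%:M.
      by move: n1; rewrite (ltr0_norm p) => n1; rewrite e -DN1; congr D; lra.
    by rewrite -kN; apply: (fG Gk hx); rewrite kN fact_opp1.
  - by move: n1; rewrite p normr0 => /eqP; rewrite eq_sym oner_eq0.
have S1 : S 1%:M by split; rewrite ?setfact1.
have chi1 : chi 1%:M = 1 by rewrite -D1 chiD.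
have SV k : S k -> S (invmx k) by exact: stabV.
have chiV k : S k -> chi (invmx k) = (chi k)^-1.
  move=> Sk; have [n0 _] := SD _ Sk; apply: (mulfI n0).
  by rewrite divff // -chiM //; [rewrite mulgV //; case: Sk => /dG|exact: SV].
have [triv|[k0 [Sk0 k0n]]] : (forall k, S k -> k = 1%:M) \/ exists k, S k /\ k <> 1%:M.
- have [h|h] := pselect (forall k, S k -> k = 1%:M); [by left|right].
  apply: contrapT => no; apply: h => k Sk; apply: contrapT => kn.
  by apply: no; exists k.
- by left.
right.
have [k1 Sk1 k1g] : exists2 k, S k & 1 < `|chi k|.
  have [n0 _] := SD _ Sk0.
  have [l|l|e] := ltrgtP 1 `|chi k0|; [by exists k0| |by case: k0n; exact: norm1].
  exists (invmx k0); first exact: SV.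
  by rewrite chiV // normrV ?unitfE // invf_gt1 // normr_gt0.
pose F := [set k | S k /\ 1 < `|chi k| <= `|chi k1|].
have finF : finite_set F.
  have he := form1_pcone R.
  have hz : pcone (fact (1, 0, 1) (invmx P)).
    by apply: pcone_fact => //; rewrite det_inv dP invr1.
  (* In diagonal coordinates [bil] takes the value 2 (t^2 + t^-2), where t = chi k; both squares are
     at most the square of the bound. *)
  apply: sub_finite_set (finG (4 * `|chi k1| ^+ 2) hz hz) => k [Sk /andP[l1 l2]].
  have [n0 e] := SD _ Sk; split; first by case: Sk.
  have [e1 e2 e3 e4] := mk2E (chi k) 0 0 (chi k)^-1.
  rewrite {1}e /D -fact_mul !mulmxA mulVg // mul1mx fact_mul bil_fact det_inv dP invr1 expr1n mul1r.
  rewrite /bil /fact e1 e2 e3 e4 /=.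
  have a2 : chi k ^+ 2 <= `|chi k1| ^+ 2.
    by rewrite -(real_normK (num_real (chi k))) ler_pXn2r ?nnegrE.
  have b2 : (chi k)^-1 ^+ 2 <= 1.
    rewrite exprVn -(real_normK (num_real (chi k))) invf_le1 ?exprn_gt0 ?normr_gt0 //.
    by rewrite exprn_ege1 // ltW.
  have c2 : 1 <= `|chi k1| ^+ 2 by rewrite exprn_ege1 // ltW // (lt_le_trans l1).
  lra.
have Fk1 : F k1 by split; rewrite ?k1g /=.
have [h [Sh /andP[h1 hk1]] hmin] := finite_min (fun k => `|chi k|) finF Fk1.
have hn (n : nat) : S (h ^+ n) /\ `|chi (h ^+ n)| = `|chi h| ^+ n.
  elim: n => [|n [IH1 IH2]]; first by rewrite !expr0; split=> //; rewrite -[X in chi X]/(1%:M) chi1 normr1.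
  rewrite !exprS; split; first exact: (stabM Sh IH1).
  by rewrite -[X in chi X]/(h *m h ^+ n) chiM // normrM IH2.
have uh : h \is a GRing.unit.
  by apply: det1_unit; apply: dG; case: Sh.
have key k : S k -> 1 <= `|chi k| -> exists n : nat, k = h ^+ n.
  move=> Sk l; have [n /andP[n1 n2]] := pow_bracket h1 l; exists n.
  have [Sn cn] := hn n.
  pose r := k *m invmx (h ^+ n).
  have Sr : S r by exact: stabM Sk (SV _ Sn).
  have hp : 0 < `|chi h| ^+ n by rewrite exprn_gt0 // (lt_trans ltr01).
  have cr : `|chi r| = `|chi k| / `|chi h| ^+ n.
    by rewrite /r chiM // ?chiV //; [|exact: SV]; rewrite normrM normfV cn.
  have r1 : 1 <= `|chi r| by rewrite cr ler_pdivlMr // mul1r.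
  have r2 : `|chi r| < `|chi h| by rewrite cr ltr_pdivrMr // -exprS.
  have re : r = 1%:M.
    apply: norm1 => //; apply/eqP; rewrite eq_le r1 andbT leNgt; apply/negP => r3.
    have /hmin : F r by split=> //; rewrite r3 (le_trans (ltW r2)).
    by rewrite leNgt r2.
  transitivity (r *m h ^+ n); last by rewrite re mul1mx.
  by rewrite /r -mulmxA mulVg ?mulmx1 //; apply: dG; case: Sn.
exists h; split=> //.
- move=> k Sk; have [l|l] := lerP 1 `|chi k|.
    by have [n ->] := key _ Sk l; exists (Posz n).
  have [n0 _] := SD _ Sk.
  have [|n e] := key _ (SV _ Sk).
    by rewrite chiV // normfV invf_ge1 ?normr_gt0 // ltW.
  exists (- (Posz n)); rewrite -exprnN -e.
  by rewrite -[LHS]invmxK.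
- have pos (n : nat) : h ^+ n = 1 -> n = 0%N.
    case: n => // n e; have [_] := hn n.+1; rewrite e -[X in chi X]/(1%:M) chi1 normr1 => /eqP.
    by rewrite lt_eqF // exprn_egt1.
  case=> n; first by move=> /pos ->.
  rewrite NegzE -exprnN => e.
  by have /pos : h ^+ n.+1 = 1 by rewrite -[LHS]invrK e invr1.
Qed.
End Cyclic.

Lemma int_rec (T : Type) (F F' : int -> T -> T) (t0 : T) :
  (forall m v, F m (F' m v) = v) -> exists s : int -> T, forall m, s (m + 1) = F m (s m).
Proof.
move=> FK; pose P := fix P n := if n is n'.+1 then F n' (P n') else t0.
pose N := fix N n := if n is n'.+1 then F' (Negz n) (N n') else F' (Negz 0) t0.
exists (fun m => match m with Posz n => P n | Negz n => N n end) => -[n|[|n]].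
- by rewrite -PoszD addn1.
- by rewrite (_ : Negz 0 + 1 = 0) //= FK.
- by rewrite (_ : Negz n.+1 + 1 = Negz n) /= ?FK // !NegzE; lia.
Qed.

(** * Equivariant primitives for a cyclic stabiliser *)

Section LineLemma.
Variable R : realType.
Local Notation V := (R * R * R)%type.
Local Notation M2 := ('M[R]_2).
Implicit Types (x y z w : V) (g h k : M2).
Variable G : set M2.
Hypothesis sG : subgroup_SL2 G.
Hypothesis fG : mobius_free G.
Hypothesis finG : bil_finite G.

Let G1 : G 1%:M. Proof. by case: sG. Qed.
Let dG g : G g -> \det g = 1. Proof. by case: sG => _ + _ _; apply. Qed.
Let GM g h : G g -> G h -> G (g *m h). Proof. by case: sG => _ _ + _; apply. Qed.
Let GV g : G g -> G (invmx g). Proof. by case: sG => _ _ _; apply. Qed.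

Definition orb x : set V := [set y | exists g t, [/\ G g, 0 < t & y = vscale t (fact x g)]].
Definition rep x : V := xget 0 (orb x).
(** A map from the cone to the group, equivariant for right translations and constant on rays; it
    turns cochains on the group into cochains on forms. *)
Definition sec x : M2 :=
  xget 1%:M [set g | G g /\ exists2 t, 0 < t & x = vscale t (fact (rep x) g)].

Lemma vscaleA (s t : R) x : vscale s (vscale t x) = vscale (s * t) x.
Proof. by apply: vec_eqP => /=; ring. Qed.

Lemma vscale1 x : vscale 1 x = x.
Proof. by apply: vec_eqP => /=; ring. Qed.

Lemma orb_refl x : orb x x.
Proof. by exists 1%:M, 1; rewrite fact1 vscale1. Qed.

Lemma orb_sym x y : orb x y -> orb y x.
Proof.
move=> [g [t [Gg t0 ->]]]; exists (invmx g), t^-1; split; rewrite ?invr_gt0 //; first exact: GV.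
by rewrite factZ factK ?dG // vscaleA mulVf ?vscale1 // gt_eqF.
Qed.

Lemma orb_trans x y z : orb x y -> orb y z -> orb x z.
Proof.
move=> [g [t [Gg t0 ->]]] [h [s [Gh s0 ->]]]; exists (g *m h), (s * t).
by split; [exact: GM|exact: mulr_gt0|rewrite factZ vscaleA fact_mul].
Qed.

Lemma orb_eq x y : orb x y -> orb x = orb y.
Proof.
move=> h; apply/seteqP; split=> z; first by apply: orb_trans; exact: orb_sym.
exact: orb_trans.
Qed.

Lemma rep_eq x y : orb x y -> rep x = rep y.
Proof. by move=> h; rewrite /rep (orb_eq h). Qed.

Lemma rep_orb x : orb x (rep x).
Proof. by apply: (@xgetPex _ 0 (orb x)); exists x; exact: orb_refl. Qed.

Lemma orb_pcone x y : orb x y -> pcone x -> pcone y.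
Proof. by move=> [g [t [Gg t0 ->]]] hx; apply: pconeZ => //; apply: pcone_fact => //; exact: dG. Qed.

Lemma disc_vscale t x : disc (vscale t x) = t ^+ 2 * disc x.
Proof. by rewrite /disc /=; ring. Qed.

(** The group preserves discriminants, so comparing them removes the scalars; then freeness
    applies. *)
Lemma ray_inj r g g' t t' : pcone r -> G g -> G g' -> 0 < t -> 0 < t' ->
  vscale t (fact r g) = vscale t' (fact r g') -> g = g'.
Proof.
move=> hr Gg Gg' t0 t0' e.
have /eqP := congr1 (@disc R) e.
rewrite !disc_vscale !disc_fact !dG // expr1n !mul1r (inj_eq (mulIf (lt0r_neq0 hr.2))).
rewrite eqrXn2 ?ltW // => /eqP tt; rewrite -tt in e.
have {}e : fact r g = fact r g'.
  by rewrite -[fact r g]vscale1 -(mulVf (lt0r_neq0 t0)) -vscaleA e vscaleA mulVf ?vscale1 // lt0r_neq0.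
have h : g *m invmx g' = 1%:M.
  apply: (fG _ hr); first by apply: GM => //; exact: GV.
  by rewrite fact_mul e factK // dG.
by rewrite -[g]mulmx1 -(mulVg (dG Gg')) mulmxA h mul1mx.
Qed.

Lemma secP x : pcone x -> G (sec x) /\ exists2 t, 0 < t & x = vscale t (fact (rep x) (sec x)).
Proof.
move=> hx; apply: (@xgetPex _ 1%:M [set g | G g /\ exists2 t, 0 < t & x = vscale t (fact (rep x) g)]).
by have [g [t [Gg t0 e]]] := orb_sym (rep_orb x); exists g; split=> //; exists t.
Qed.

Lemma sec_fact x k : pcone x -> G k -> sec (fact x k) = sec x *m k.
Proof.
move=> hx Gk; have hk : pcone (fact x k) by apply: pcone_fact; rewrite ?dG.
have [Gs [t t0 e]] := secP hx; have [Gs' [t' t0' e']] := secP hk.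
have er : rep (fact x k) = rep x.
  by apply/esym/rep_eq; exists k, 1; rewrite vscale1.
apply: (@ray_inj (rep x) _ _ t' t) => //; first exact: orb_pcone (rep_orb x) hx.
  exact: GM.
by rewrite -{1}er -e' {1}e factZ fact_mul.
Qed.

Lemma sec_scale x s : pcone x -> 0 < s -> sec (vscale s x) = sec x.
Proof.
move=> hx s0; have hk := pconeZ s0 hx.
have [Gs [t t0 e]] := secP hx; have [Gs' [t' t0' e']] := secP hk.
have er : rep (vscale s x) = rep x.
  by apply/esym/rep_eq; exists 1%:M, s; rewrite fact1.
apply: (@ray_inj (rep x) _ _ t' (s * t)); rewrite ?mulr_gt0 //; first exact: orb_pcone (rep_orb x) hx.
by rewrite -{1}er -e' {1}e vscaleA.
Qed.

Lemma sec_rep x : pcone x -> sec (rep x) = 1%:M.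
Proof.
move=> hx; have hr := orb_pcone (rep_orb x) hx.
have [Gs [t t0 e]] := secP hr.
have er : rep (rep x) = rep x by apply/esym/rep_eq; exact: rep_orb.
apply: (@ray_inj (rep x) _ _ t 1) => //; rewrite fact1 vscale1 -{1}er; exact: esym.
Qed.

Lemma sec_par x y : pcone x -> pcone y -> par x y -> sec x = sec y.
Proof. by move=> hx hy /(parP hx hy)[s s0 ->]; rewrite sec_scale. Qed.

Variable f : M2 -> M2 -> M2 -> V.
Hypothesis fcoc : forall x y z w : M2, G x -> G y -> G z -> G w ->
  f y z w - f x z w + f x y w - f x y z = 0.
Hypothesis feq : forall x y z k : M2, G x -> G y -> G z -> G k ->
  f (x *m k) (y *m k) (z *m k) = fact (f x y z) k.

Lemma factN x g : fact (- x) g = - fact x g.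
Proof. by apply: vec_eqP => /=; ring. Qed.

Lemma factB x y g : fact (x - y) g = fact x g - fact y g.
Proof. by rewrite factD factN. Qed.

Definition primitive (S : set M2) (B : M2 -> M2 -> V) :=
  (forall x y z : M2, G x -> G y -> G z -> B y z - B x z + B x y = f x y z) /\
  (forall x y k : M2, G x -> G y -> S k -> B (x *m k) (y *m k) = fact (B x y) k).

Lemma vec_split x y : x = y -> [/\ x.1.1 = y.1.1, x.1.2 = y.1.2 & x.2 = y.2].
Proof. by move=> ->. Qed.

(** Vanishing of the second cohomology of a trivial or infinite cyclic group. The cone [f 1 y z] is
    a primitive that need not be equivariant. The function [u] that repairs it has to satisfy a
    first-order recursion along each coset of the cyclic group, and this can be solved because the
    powers of [h] are distinct. *)
Lemma equiv_primitive (S : set M2) : (forall k, S k -> G k) ->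
  (forall k, S k -> k = 1%:M) \/
  (exists h : M2, [/\ S h, forall k, S k -> exists m : int, k = h ^ m &
                forall m : int, h ^ m = 1 -> m = 0]) ->
  exists B, primitive S B.
Proof.
move=> SG hS.
have prim (u : M2 -> V) (x y z : M2) : G x -> G y -> G z ->
    (f 1%:M y z + u z - u y) - (f 1%:M x z + u z - u x) + (f 1%:M x y + u y - u x) = f x y z.
  move=> Gx Gy Gz; have /vec_split[/= h1 h2 h3] := fcoc G1 Gx Gy Gz.
  by apply: vec_eqP => /=; lra.
case: hS => [triv|[h [Sh hpow hinf]]].
  exists (fun x y : M2 => f 1%:M x y + 0 - 0); split; first by move=> *; exact: (prim (fun=> 0)).
  by move=> x y k _ _ /triv ->; rewrite !mulmx1 fact1.
have Gh := SG _ Sh.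
have uh : h \is a GRing.unit by apply: det1_unit; exact: dG.
have hp1 (m : int) : h ^ (m + 1) = h ^ m *m h by rewrite exprzDr.
have Gp (m : int) : G (h ^ m).
  have Gn (n : nat) : G (h ^+ n).
    by elim: n => [|n IH]; rewrite ?expr0 // exprS; exact: GM.
  by case: m => n; [exact: Gn|rewrite NegzE -exprnN; exact: GV].
have /choice[s hs] : forall r : M2, exists s : int -> V, forall m,
    s (m + 1) = fact (s m) h - f 1%:M h (r *m h ^ (m + 1)).
  move=> r.
  apply: (@int_rec _ (fun m v => fact v h - f 1%:M h (r *m h ^ (m + 1)))
     (fun m v => fact (v + f 1%:M h (r *m h ^ (m + 1))) (invmx h)) 0).
  by move=> m v; rewrite factKV ?dG // addrK.
pose cs (y : M2) : set M2 := [set z : M2 | exists m : int, z = y *m h ^ m].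
pose r (y : M2) := xget 1%:M (cs y).
have cs_eq (y : M2) : cs (y *m h) = cs y.
  apply/seteqP; split=> z [m ->]; first by exists (1 + m); rewrite exprzDr // mulmxA.
  exists (-1 + m); rewrite -mulmxA; congr (_ *m _).
  transitivity (h ^ (1 + (-1 + m))); first by rewrite addrA subrr add0r.
  by rewrite exprzDr.
have rP (y : M2) : exists m : int, y = r y *m h ^ m.
  have [m e] : cs y (r y) by apply: (@xgetPex _ 1%:M); exists y; exists 0; rewrite expr0z mulmx1.
  exists (- m); rewrite e -mulmxA.
  transitivity (y *m h ^ (m - m)); first by rewrite subrr expr0z mulmx1.
  by rewrite exprzDr.
pose mm (y : M2) : int := xget 0 [set m | y = r y *m h ^ m].
have mP (y : M2) : y = r y *m h ^ (mm y) by exact: (@xgetPex _ 0 [set m | y = r y *m h ^ m] (rP y)).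
have rG (y : M2) : G y -> G (r y).
  move=> Gy; have -> : r y = y *m invmx (h ^ mm y).
    by rewrite -[LHS]mulmx1 -(mulgV (dG (Gp (mm y)))) mulmxA -(mP y).
  by apply: GM => //; exact: GV.
have pinj (m m' : int) : h ^ m = h ^ m' -> m = m'.
  move=> e; apply/eqP; rewrite -subr_eq0; apply/eqP; apply: hinf.
  by rewrite exprzDr // e -exprzDr // subrr.
have mS (y : M2) : G y -> mm (y *m h) = mm y + 1.
  move=> Gy; apply: pinj; have er : r (y *m h) = r y by rewrite /r cs_eq.
  have := mP (y *m h); rewrite er {1}(mP y) -mulmxA -hp1 => e.
  have := congr1 (mulmx (invmx (r y))) e.
  by rewrite !mulmxA !mulVg ?mul1mx //; exact: dG (rG _ Gy).
pose u (y : M2) := s (r y) (mm y).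
have uh1 (y : M2) : G y -> u (y *m h) = fact (u y) h - f 1%:M h (y *m h).
  move=> Gy; rewrite /u mS // (_ : r (y *m h) = r y); last by rewrite /r cs_eq.
  by rewrite hs hp1 mulmxA -mP.
pose B (x y : M2) := f 1%:M x y + u y - u x.
pose Q k := G k /\ forall x y : M2, G x -> G y -> B (x *m k) (y *m k) = fact (B x y) k.
have Q1 : Q 1%:M by split=> // x y _ _; rewrite !mulmx1 fact1.
have QM k k' : Q k -> Q k' -> Q (k *m k').
  move=> [Gk hk] [Gk' hk']; split; first exact: GM.
  by move=> x y Gx Gy; rewrite !mulmxA hk' ?hk ?fact_mul //; exact: GM.
have QV k : Q k -> Q (invmx k).
  move=> [Gk hk]; split; first exact: GV.
  move=> x y Gx Gy; rewrite -{2}[x]mulmx1 -{2}[y]mulmx1 -(mulVg (dG Gk)) !mulmxA hk.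
  - by rewrite factK ?dG.
  - by apply: GM => //; exact: GV.
  - by apply: GM => //; exact: GV.
have Qh : Q h.
  split=> // x y Gx Gy; rewrite /B !uh1 //.
  have e : fact (f 1%:M x y) h = f h (x *m h) (y *m h) by rewrite -feq // mul1mx.
  rewrite factB factD e.
  have /vec_split[/= h1 h2 h3] := fcoc G1 Gh (GM Gx Gh) (GM Gy Gh).
  by apply: vec_eqP => /=; lra.
have Qp (m : int) : Q (h ^ m).
  have Qn (n : nat) : Q (h ^+ n).
    by elim: n => [|n IH]; rewrite ?expr0 // exprS; exact: QM.
  by case: m => n; [exact: Qn|rewrite NegzE -exprnN; exact: QV].
exists B; split; first by move=> *; exact: prim.
by move=> x y k Gx Gy /hpow[m ->]; exact: (Qp m).2.
Qed.

End LineLemma.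

Section Collinear.
Variable R : realType.
Local Notation V := (R * R * R)%type.
Local Notation M2 := ('M[R]_2).
Implicit Types (x y z w : V) (g h k : M2).

Lemma par_prop (n c : V) : n <> 0 -> par n c -> exists s, c = vscale s n.
Proof.
move=> n0 /vec_split[/= e1 e2 e3].
have d0 : dot n n != 0.
  apply/eqP => /eqP; rewrite /dot !paddr_eq0 ?addr_ge0 -?expr2 ?sqr_ge0 // !sqrf_eq0.
  by move=> /andP[/andP[/eqP h1 /eqP h2] /eqP h3]; apply: n0; exact: vec_eqP.
exists (dot n c / dot n n).
have E : vscale (dot n n) c = vscale (dot n c) n.
  rewrite /dot; apply: vec_eqP => /=; apply/eqP; rewrite -subr_eq0; apply/eqP.
  - transitivity (n.1.2 * - (n.1.1 * c.1.2 - n.1.2 * c.1.1) + n.2 * (n.2 * c.1.1 - n.1.1 * c.2)).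
      by ring.
    by rewrite e2 e3 oppr0 !mulr0 addr0.
  - transitivity (n.1.1 * (n.1.1 * c.1.2 - n.1.2 * c.1.1) + n.2 * - (n.1.2 * c.2 - n.2 * c.1.2)).
      by ring.
    by rewrite e1 e3 oppr0 !mulr0 addr0.
  - transitivity (n.1.1 * - (n.2 * c.1.1 - n.1.1 * c.2) + n.1.2 * (n.1.2 * c.2 - n.2 * c.1.2)).
      by ring.
    by rewrite e1 e2 oppr0 !mulr0 addr0.
move/vec_split: E => [/= h1 h2 h3].
by apply: vec_eqP => /=; apply: (mulfI d0); rewrite ?h1 ?h2 ?h3; field.
Qed.

Lemma pla_eq x y u v : ~ par x y -> ~ par u v ->
  det3 x y u = 0 -> det3 x y v = 0 -> pla u v = pla x y.
Proof.
move=> n1 n2 e1 e2.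
have pc : par (cross x y) (cross u v).
  have E : cross (cross x y) (cross u v) = vscale (det3 x y v) u - vscale (det3 x y u) v.
    by rewrite /cross /det3; apply: vec_eqP => /=; ring.
  by rewrite /par E e1 e2; apply: vec_eqP => /=; ring.
have [s e] := par_prop n1 pc.
have s0 : s != 0 by apply/eqP => s0; apply: n2; rewrite /par e s0; apply: vec_eqP => /=; ring.
have dE w : det3 u v w = s * det3 x y w.
  rewrite (det3_perm w u v) (det3_perm w x y) -!dot_cross.
  by rewrite /dot; move/vec_split: e => [-> -> ->] /=; rewrite /cross /=; ring.
apply/seteqP; split=> w [hw h]; split=> //; last by rewrite dE h mulr0.
by apply: (mulfI s0); rewrite -dE h mulr0.
Qed.

Variable G : set M2.
Hypothesis sG : subgroup_SL2 G.
Hypothesis fG : mobius_free G.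
Hypothesis finG : bil_finite G.

Let G1 : G 1%:M. Proof. by case: sG. Qed.
Let dG g : G g -> \det g = 1. Proof. by case: sG => _ + _ _; apply. Qed.
Let GM g h : G g -> G h -> G (g *m h). Proof. by case: sG => _ _ + _; apply. Qed.
Let GV g : G g -> G (invmx g). Proof. by case: sG => _ _ _; apply. Qed.

Variable f : M2 -> M2 -> M2 -> V.
Hypothesis fcoc : forall x y z w : M2, G x -> G y -> G z -> G w ->
  f y z w - f x z w + f x y w - f x y z = 0.
Hypothesis feq : forall x y z k : M2, G x -> G y -> G z -> G k ->
  f (x *m k) (y *m k) (z *m k) = fact (f x y z) k.

Lemma par_fact x y g : \det g = 1 -> par (fact x g) (fact y g) <-> par x y.
Proof.
suff H x' y' h : par x' y' -> par (fact x' h) (fact y' h).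
  by move=> d; split; [rewrite -{2}[x](factK _ d) -{2}[y](factK _ d); exact: H|exact: H].
move=> /vec_split[/= e1 e2 e3]; apply: vec_eqP => /=; apply/eqP; rewrite ?subr_eq0;
  apply/eqP; move: (ga h) (gb h) (gc h) (gd h) => a b c d.
- apply/eqP; rewrite -subr_eq0; apply/eqP.
  transitivity ((x'.1.1 * y'.1.2 - x'.1.2 * y'.1.1) * (a * b * (b * d) * 2 - b * b * (a * d + b * c))
    + (x'.2 * y'.1.1 - x'.1.1 * y'.2) * (b * b * (c * d) * 2 - 2 * (a * b) * (d * d))
    + (x'.1.2 * y'.2 - x'.2 * y'.1.2) * ((a * d + b * c) * (d * d) - 2 * (b * d) * (c * d))); first by ring.
  by rewrite e1 e2 e3 !mul0r !addr0.
- apply/eqP; rewrite -subr_eq0; apply/eqP.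
  transitivity ((x'.1.1 * y'.1.2 - x'.1.2 * y'.1.1) * (b * b * (a * c) - a * a * (b * d))
    + (x'.2 * y'.1.1 - x'.1.1 * y'.2) * (a * a * (d * d) - b * b * (c * c))
    + (x'.1.2 * y'.2 - x'.2 * y'.1.2) * (b * d * (c * c) - a * c * (d * d))); first by ring.
  by rewrite e1 e2 e3 !mul0r !addr0.
- apply/eqP; rewrite -subr_eq0; apply/eqP.
  transitivity ((x'.1.1 * y'.1.2 - x'.1.2 * y'.1.1) * (a * a * (a * d + b * c) - 2 * (a * b) * (a * c))
    + (x'.2 * y'.1.1 - x'.1.1 * y'.2) * (2 * (a * b) * (c * c) - a * a * (c * d) * 2)
    + (x'.1.2 * y'.2 - x'.2 * y'.1.2) * (a * c * (c * d) * 2 - (a * d + b * c) * (c * c))); first by ring.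
  by rewrite e1 e2 e3 !mul0r !addr0.
Qed.

Lemma setfact_pla x y g : \det g = 1 -> setfact (pla x y) g = pla (fact x g) (fact y g).
Proof.
move=> d; have dV : \det (invmx g) = 1 by rewrite det_inv d invr1.
apply/seteqP; split=> z.
  by move=> [u [hu e] <-]; split; [exact: pcone_fact|rewrite det3_fact e mulr0].
move=> [hz e]; exists (fact z (invmx g)); last by rewrite factKV.
split; first exact: pcone_fact.
have := congr1 (fun t => t) e; rewrite -{1}[z](factKV _ d) det3_fact d expr1n mul1r.
by [].
Qed.

Definition sphi x y z := f (sec G x) (sec G y) (sec G z).

(** A primitive is chosen for one line in each orbit and transported to the others; equivariance
    under the stabiliser makes the result independent of the transporting element. A pair on a
    single ray determines no line, but there the cocycle identity forces the value [f s s s], which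
    is the same for all lines. *)
Lemma collinear_primitive : exists b : V -> V -> V,
  (forall x y k, pcone x -> pcone y -> G k -> b (fact x k) (fact y k) = fact (b x y) k) /\
  (forall x y z, pcone x -> pcone y -> pcone z -> det3 x y z = 0 ->
     b y z - b x z + b x y = sphi x y z).
Proof.
pose isline L := exists x y, [/\ pcone x, pcone y, ~ par x y & L = pla x y].
have secG x : pcone x -> G (sec G x) by move=> /(secP sG)[].
have /choice[B hB] : forall L : set V, exists B, isline L -> primitive G f (stab G L) B.
  move=> L; have [l|nl] := pselect (isline L); last by exists (fun _ _ => 0).
  have [x [y [hx hy np ->]]] := l.
  have [||B hB] := @equiv_primitive R G sG f fcoc feq (stab G (pla x y)).
  - by move=> k [].
  - exact: stab_cyclic.
  by exists B.
pose orbL (L : set V) : set (set V) := [set L' | exists2 g, G g & L' = setfact L g].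
pose rL L := xget set0 (orbL L).
pose gL L := xget 1%:M [set g | G g /\ L = setfact (rL L) g].
have orb_same L g : G g -> orbL (setfact L g) = orbL L.
  move=> Gg; apply/seteqP; split=> L' [h Gh ->].
    by exists (g *m h); [exact: GM|rewrite setfactM].
  exists (invmx g *m h); first by apply: GM => //; exact: GV.
  by rewrite -setfactM mulmxA mulgV ?mul1mx // dG.
have rLP L : exists2 g, G g & L = setfact (rL L) g.
  have [g Gg e] : orbL L (rL L).
    by apply: (@xgetPex _ set0 (orbL L)); exists L; exists 1%:M; rewrite ?setfact1.
  by exists (invmx g); [exact: GV|rewrite e -setfactM mulgV ?setfact1 // dG].
have gLP L : G (gL L) /\ L = setfact (rL L) (gL L).
  by apply: (@xgetPex _ 1%:M [set g | G g /\ L = setfact (rL L) g]); have [g Gg e] := rLP L; exists g.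
have line_fact L g : G g -> isline L -> isline (setfact L g).
  move=> Gg [x [y [hx hy np ->]]]; exists (fact x g), (fact y g).
  split; [exact: pcone_fact (dG Gg) hx|exact: pcone_fact (dG Gg) hy| |].
    by move/(par_fact _ _ (dG Gg)).
  by rewrite setfact_pla // dG.
have rline L : isline L -> isline (rL L).
  move=> l; have [g Gg e] := rLP L.
  have -> : rL L = setfact L (invmx g) by rewrite {2}e -setfactM mulgV ?setfact1 // dG.
  by apply: line_fact => //; exact: GV.
pose bL L (u v : M2) := fact (B (rL L) (u *m invmx (gL L)) (v *m invmx (gL L))) (gL L).
have bL_coc L (u v w : M2) : isline L -> G u -> G v -> G w ->
    bL L v w - bL L u w + bL L u v = f u v w.
  move=> l Gu Gv Gw; have [Gg eL] := gLP L.
  have [h1 _] := hB _ (rline _ l).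
  have GgV := GV Gg.
  rewrite /bL -factB -factD. rewrite h1; try exact: GM. rewrite -feq; try exact: GM; try exact: Gg.
  by rewrite -!mulmxA mulVg ?mulmx1 // dG.
have bL_eq L (u v k : M2) : isline L -> G u -> G v -> G k ->
    bL (setfact L k) (u *m k) (v *m k) = fact (bL L u v) k.
  move=> l Gu Gv Gk; have [Gg eL] := gLP L.
  have er : rL (setfact L k) = rL L by rewrite /rL orb_same.
  have [Gg'] := gLP (setfact L k); rewrite er => eL'.
  rewrite /bL er; set g := gL L in Gg eL *; set g' := gL _ in Gg' eL' *.
  pose s := g *m k *m invmx g'.
  have GgV := GV Gg; have GgV' := GV Gg'.
  have Ss : stab G (rL L) s.
    split; first by apply: GM => //; exact: GM.
    by rewrite /s !setfactM -eL eL' -setfactM mulgV ?setfact1 // dG.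
  have [_ h2] := hB _ (rline _ l).
  have e (w : M2) : w *m k *m invmx g' = w *m invmx g *m s.
    by rewrite /s !mulmxA -(mulmxA w (invmx g) g) mulVg ?mulmx1 // dG.
  rewrite !e h2 //; try exact: GM.
  by rewrite -!fact_mul /s -!mulmxA mulVg ?mulmx1 // dG.
pose b x y := if pselect (par x y) then f (sec G x) (sec G x) (sec G x)
              else bL (pla x y) (sec G x) (sec G y).
have bpar x y : par x y -> b x y = f (sec G x) (sec G x) (sec G x).
  by rewrite /b; case: pselect.
have bnpar x y : ~ par x y -> b x y = bL (pla x y) (sec G x) (sec G y).
  by rewrite /b; case: pselect.
exists b; split=> [x y k hx hy Gk|x y z hx hy hz e].
  have [p|np] := pselect (par x y).
    by rewrite !bpar //; [rewrite !(sec_fact sG fG) // feq //; exact: secG|apply/par_fact => //; exact: dG].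
  rewrite !bnpar //; last by move/(par_fact _ _ (dG Gk)).
  rewrite -(setfact_pla _ _ (dG Gk)) !(sec_fact sG fG) // bL_eq //; [|exact: secG|exact: secG].
  by exists x, y.
have bLself L (u : M2) : isline L -> G u -> bL L u u = f u u u.
  by move=> l Gu; rewrite -(bL_coc L u u u) // subrr add0r.
have bE L u v : isline L -> pcone u -> pcone v -> (~ par u v -> pla u v = L) ->
    b u v = bL L (sec G u) (sec G v).
  move=> l hu hv h; have [p|np] := pselect (par u v); last by rewrite bnpar // h.
  by rewrite bpar // -(sec_par sG fG hu hv p) bLself //; exact: secG.
suff [L [l h1 h2 h3]] : exists L, [/\ isline L, ~ par y z -> pla y z = L,
     ~ par x z -> pla x z = L & ~ par x y -> pla x y = L].
  by rewrite !(bE L) // bL_coc //; exact: secG.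
have d1 : det3 x y y = 0 by rewrite /det3; ring.
have exline : exists x' y', [/\ pcone x', pcone y' & ~ par x' y'].
  exists (1, 0, 1), (2, 0, 1); split; try by split; rewrite /disc //= expr0n /=; lra.
  by move/vec_split => [/= _ + _]; lra.
have [pxy|nxy] := pselect (par x y); last first.
  exists (pla x y); split=> // [|np|np]; first by exists x, y.
    by apply: pla_eq => //; rewrite /det3; ring.
  by apply: pla_eq => //; rewrite /det3; ring.
have [pyz|nyz] := pselect (par y z); last first.
  exists (pla y z); split=> // [|np]; first by exists y, z.
  apply: pla_eq => //; first by rewrite det3_perm.
  by rewrite /det3; ring.
have [pxz|nxz] := pselect (par x z).
  have [x' [y' [hx' hy' np']]] := exline.
  by exists (pla x' y'); split=> //; exists x', y'.
by exists (pla x z); split=> //; exists x, z.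
Qed.
End Collinear.

(** * Degree zero chains and vanishing of the second cohomology *)

Lemma fsumE (W : zmodType) (T : choiceType) (A : set T) (F : T -> W) (s : seq T) :
  uniq s -> (forall x, x \in s -> A x) -> (forall x, A x -> F x != 0 -> x \in s) ->
  \sum_(x \in A) F x = \sum_(x <- s) F x.
Proof.
move=> us sA As; rewrite [RHS]fsbig_seq // -(fsbig_widen [set` s] A) //.
move=> x [Ax /= nx]; apply/eqP; apply: contraT => n0; case: nx; exact: As.
Qed.

Lemma finite_uniq (T : choiceType) (A : set T) : finite_set A ->
  exists2 s : seq T, uniq s & forall x, x \in s <-> A x.
Proof.
by move=> /finite_seqP[s ->]; exists (undup s); rewrite ?undup_uniq // => x /=; rewrite mem_undup.
Qed.

Section Sums.
Variable R : realType.
Local Notation V := (R * R * R)%type.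
Local Notation M2 := ('M[R]_2).
Implicit Types (x y z w v : V) (g h k : M2).

Lemma fact_sum (J : Type) (s : seq J) (F : J -> V) g :
  fact (\sum_(j <- s) F j) g = \sum_(j <- s) fact (F j) g.
Proof.
apply: (big_morph (fun x => fact x g)); first by move=> x y; exact: factD.
by apply: vec_eqP => /=; ring.
Qed.

Lemma dot_sum (J : Type) (s : seq J) (F : J -> V) l :
  dot l (\sum_(j <- s) F j) = \sum_(j <- s) dot l (F j).
Proof.
apply: (big_morph (dot l)); first exact: dotD.
by rewrite /dot /= !mulr0 !addr0.
Qed.

Lemma disc_comb x y z (a b c : R) : pcone x -> pcone y -> pcone z ->
  0 <= a -> 0 <= b -> 0 <= c ->
  a ^+ 2 * disc x + b ^+ 2 * disc y + c ^+ 2 * disc z <=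
  disc (vscale a x + vscale b y + vscale c z).
Proof.
move=> hx hy hz a0 b0 c0.
have -> : disc (vscale a x + vscale b y + vscale c z) =
  a ^+ 2 * disc x + b ^+ 2 * disc y + c ^+ 2 * disc z +
  2 * (a * b * bil x y + b * c * bil y z + a * c * bil x z).
  by rewrite /disc /bil /=; ring.
have p1 := ltW (bil_gt0 hx hy); have p2 := ltW (bil_gt0 hy hz); have p3 := ltW (bil_gt0 hx hz).
by rewrite lerDl; apply: mulr_ge0 => //; rewrite !addr_ge0 // !mulr_ge0.
Qed.

Lemma det3_hom w x y g : \det g = 1 ->
  det3 (fact w g) (fact x g) (fact y g) = det3 w x y.
Proof. by move=> d; rewrite det3_fact d expr1n mul1r. Qed.

Lemma deg_fact w x y z g : \det g = 1 ->
  deg (fact w g) (fact x g) (fact y g) (fact z g) = deg w x y z.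
Proof. by move=> d; rewrite /deg !det3_hom. Qed.

Lemma icr_fact w w' x y g : \det g = 1 ->
  icr (fact w g) (fact w' g) (fact x g) (fact y g) = icr w w' x y.
Proof. by move=> d; rewrite /icr !det3_hom. Qed.

Lemma icr_swap w w' x y : icr w w' y x = - icr w w' x y.
Proof. by rewrite /icr ![det3 _ y x]det3_swap !sgrN; ring. Qed.

Lemma sq_bound (a m : R) : 0 <= a -> a ^+ 2 <= m -> a <= 1 + m.
Proof. by move=> a0 h; have := sqr_ge0 (a - 1); nra. Qed.

Variable G : set M2.
Hypothesis sG : subgroup_SL2 G.
Hypothesis finG : bil_finite G.

Let dG g : G g -> \det g = 1. Proof. by case: sG => _ + _ _; apply. Qed.
Let GM g h : G g -> G h -> G (g *m h). Proof. by case: sG => _ _ + _; apply. Qed.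
Let GV g : G g -> G (invmx g). Proof. by case: sG => _ _ _; apply. Qed.

(** Since [disc] is superadditive on the cone, a point of the hull with given discriminant has
    bounded coefficients, hence a bounded value of [bil x]. *)
Lemma deg_finite w x y z : pcone w -> pcone x -> pcone y -> pcone z ->
  finite_set [set g | G g /\ deg (fact w g) x y z != 0].
Proof.
move=> hw hx hy hz.
pose m (u : V) := 1 + disc w / disc u.
pose K := m x * bil x x + m y * bil x y + m z * bil x z.
apply: sub_finite_set (finG K hx hw) => g /= [Gg dn]; split=> //.
have hwg : pcone (fact w g) by apply: pcone_fact => //; exact: dG.
have n0 : det3 x y z != 0 by apply: contra_neq dn => e; exact: deg_flat.
have [a [b [c [a0 b0 c0 e]]]] := deg_hull hwg hx hy hz n0 dn.
have dw : disc (fact w g) = disc w by rewrite disc_fact dG // expr1n mul1r.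
have := disc_comb hx hy hz a0 b0 c0; rewrite -e dw => le.
have pos (u : V) (s : R) : pcone u -> 0 <= s ^+ 2 * disc u.
  by move=> hu; rewrite mulr_ge0 ?sqr_ge0 // ltW // hu.2.
have := pos x a hx; have := pos y b hy; have := pos z c hz => p1 p2 p3.
have bd (u : V) (s : R) : pcone u -> 0 <= s -> s ^+ 2 * disc u <= disc w -> s <= m u.
  by move=> hu s0 h; apply: sq_bound => //; rewrite ler_pdivlMr // hu.2.
rewrite e !bilD !bilZ /K; apply: lerD; [apply: lerD|]; apply: ler_wpM2r.
- exact: ltW (bil_gt0 _ _).
- by apply: bd => //; lra.
- exact: ltW (bil_gt0 _ _).
- by apply: bd => //; lra.
- exact: ltW (bil_gt0 _ _).
- by apply: bd => //; lra.
Qed.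

(** Divided by c + d, the crossing point has bounded discriminant and so bounded coefficients in [x]
    and [y]. Then [bil x] cannot be large at both ends of the translated segment. *)
Lemma icr_finite w w' x y : pcone w -> pcone w' -> pcone x -> pcone y ->
  finite_set [set g | G g /\ icr (fact w g) (fact w' g) x y != 0].
Proof.
move=> hw hw' hx hy.
pose D := disc w + disc w' + 2 * bil w w'.
pose m (u : V) := 1 + D / disc u.
pose K := m x * bil x x + m y * bil x y.
have fU : finite_set ([set g | G g /\ bil x (fact w g) <= 2 * K] `|`
                      [set g | G g /\ bil x (fact w' g) <= 2 * K]).
  by rewrite finite_setU; split; exact: finG.
apply: sub_finite_set fU => g /= [Gg dn].
have hwg : pcone (fact w g) by apply: pcone_fact => //; exact: dG.
have hwg' : pcone (fact w' g) by apply: pcone_fact => //; exact: dG.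
have [a [b [c [d [a0 b0 c0 d0 [ab cd e]]]]]] := icr_hull hwg hwg' hx hy dn.
pose s := c + d.
have dE : disc (vscale c (fact w g) + vscale d (fact w' g)) =
    c ^+ 2 * disc w + d ^+ 2 * disc w' + 2 * (c * d * bil w w').
  rewrite -!factZ -factD disc_fact dG // expr1n mul1r.
  by rewrite /disc /bil /=; ring.
have Dp : 0 < disc w by exact: hw.2.
have Dp' : 0 < disc w' by exact: hw'.2.
have Bp : 0 < bil w w' by exact: bil_gt0.
have D0 : 0 < D by rewrite /D; lra.
have up : disc (vscale c (fact w g) + vscale d (fact w' g)) <= s ^+ 2 * D.
  rewrite dE /D /s -subr_ge0.
  rewrite (_ : _ - _ = (d ^+ 2 + 2 * (c * d)) * disc w + (c ^+ 2 + 2 * (c * d)) * disc w' +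
      2 * (c ^+ 2 + d ^+ 2 + c * d) * bil w w'); last by ring.
  have n1 := sqr_ge0 c; have n2 := sqr_ge0 d; have n3 := mulr_ge0 c0 d0.
  by apply: addr_ge0; [apply: addr_ge0|]; apply: mulr_ge0; lra.
have lo := disc_comb hx hy hy a0 b0 (lexx (0 : R)).
rewrite (_ : _ + vscale 0 y = vscale a x + vscale b y) in lo; last by apply: vec_eqP => /=; ring.
rewrite e in lo.
have pos (u : V) (r : R) : pcone u -> 0 <= r ^+ 2 * disc u.
  by move=> hu; rewrite mulr_ge0 ?sqr_ge0 // ltW // hu.2.
have := pos x a hx; have := pos y b hy => p1 p2.
have bd (u : V) (r : R) : pcone u -> 0 <= r -> r ^+ 2 * disc u <= s ^+ 2 * D -> r <= s * m u.
  move=> hu r0 h; have s0 : 0 < s by [].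
  rewrite mulrC -ler_pdivrMr //; apply: sq_bound; first by rewrite divr_ge0 // ltW.
  rewrite ler_pdivlMr; last exact: hu.2.
  have -> : (r / s) ^+ 2 * disc u = r ^+ 2 * disc u / s ^+ 2 by field; rewrite gt_eqF.
  by rewrite ler_pdivrMr ?exprn_gt0 // [D * _]mulrC.
have hK : c * bil x (fact w g) + d * bil x (fact w' g) <= s * K.
  have := congr1 (bil x) e; rewrite !bilD !bilZ => <-.
  rewrite (_ : s * K = s * m x * bil x x + s * m y * bil x y); last by rewrite /K; ring.
  apply: lerD; apply: ler_wpM2r.
  - exact: ltW (bil_gt0 _ _).
  - by apply: bd => //; lra.
  - exact: ltW (bil_gt0 _ _).
  - by apply: bd => //; lra.
have q1 : 0 < bil x (fact w g) by exact: bil_gt0.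
have q2 : 0 < bil x (fact w' g) by exact: bil_gt0.
have [h1|h1] := lerP (bil x (fact w g)) (2 * K); first by left.
have [h2|h2] := lerP (bil x (fact w' g)) (2 * K); first by right.
exfalso.
have [c1|c1] := ltrP 0 c.
  have := ltr_pM2l c1 (2 * K) (bil x (fact w g)); rewrite h1 => l1.
  have l2 : d * (2 * K) <= d * bil x (fact w' g) by rewrite ler_wpM2l // ltW.
  have K0 : 0 < s * K by apply: lt_le_trans hK; rewrite ltr_wpDr ?mulr_gt0 // mulr_ge0 // ltW.
  by rewrite /s in hK K0; lra.
have d1 : 0 < d by lra.
have := ltr_pM2l d1 (2 * K) (bil x (fact w' g)); rewrite h2 => l1.
have l2 : c * (2 * K) <= c * bil x (fact w g) by rewrite ler_wpM2l // ltW.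
have K0 : 0 < s * K by apply: lt_le_trans hK; rewrite ltr_wpDl ?mulr_gt0 // mulr_ge0 // ltW.
by rewrite /s in hK K0; lra.
Qed.

Lemma group_countable : countable G.
Proof.
have he := form1_pcone R.
have -> : G = \bigcup_(n in [set: nat]) [set g | G g /\ bil (1, 0, 1) (fact (1, 0, 1) g) <= n%:R].
  apply/seteqP; split=> g; last by move=> [n _ []].
  move=> Gg; exists (Num.truncn (bil (1, 0, 1) (fact (1, 0, 1) g))).+1 => //; split=> //.
  by apply: ltW; exact: truncnS_gt.
apply: bigcup_countable; first exact: countableP.
by move=> n _; apply: finite_set_countable; exact: finG.
Qed.
End Sums.

(** * The degree of a chain in the quotient *)

Section Pairing.
Variable R : realType.
Local Notation V := (R * R * R)%type.
Local Notation M2 := ('M[R]_2).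
Implicit Types (x y z w v : V) (g h k : M2).
Variable G : set M2.
Hypothesis sG : subgroup_SL2 G.
Hypothesis fG : mobius_free G.
Hypothesis finG : bil_finite G.

Let G1 : G 1%:M. Proof. by case: sG. Qed.
Let dG g : G g -> \det g = 1. Proof. by case: sG => _ + _ _; apply. Qed.
Let GM g h : G g -> G h -> G (g *m h). Proof. by case: sG => _ _ + _; apply. Qed.
Let GV g : G g -> G (invmx g). Proof. by case: sG => _ _ _; apply. Qed.
Let pG x g : G g -> pcone x -> pcone (fact x g).
Proof. by move=> Gg; apply: pcone_fact; exact: dG. Qed.

Lemma mulr_bij k : G k -> set_bij G G (fun g => g *m k).
Proof.
move=> Gk; split.
- by move=> g Gg; exact: GM.
- move=> g h _ _ /= e; rewrite -[g]mulmx1 -[h]mulmx1 -(mulgV (dG Gk)) !mulmxA.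
  by rewrite /= in e; rewrite e.
- move=> g Gg; exists (g *m invmx k); first by apply: GM => //; exact: GV.
  by rewrite /= -mulmxA mulVg ?mulmx1 // dG.
Qed.

Lemma mull_bij k : G k -> set_bij G G (fun g => k *m g).
Proof.
move=> Gk; split.
- by move=> g Gg; exact: GM.
- move=> g h _ _ /= e; rewrite -[g]mul1mx -[h]mul1mx -(mulVg (dG Gk)) -!mulmxA.
  by rewrite /= in e; rewrite e.
- move=> g Gg; exists (invmx k *m g); first by apply: GM => //; exact: GV.
  by rewrite /= mulmxA mulgV ?mul1mx // dG.
Qed.

Variable x0 : V.
Hypothesis hx0 : pcone x0.
Variables (I : finType) (lam : I -> V) (gi hi : I -> M2).
Hypothesis Ggi : forall i, G (gi i).
Hypothesis Ghi : forall i, G (hi i).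
Hypothesis Hb : forall b : M2 -> V,
  \sum_i dot (lam i) (fact (b (gi i)) (hi i) + b (hi i) - b (gi i *m hi i)) = 0.

(** Vertices of the homogeneous simplex (gh, h, 1) applied to the base point, for an action from the
    right. *)
Definition tX i := fact x0 (gi i *m hi i).
Definition tY i := fact x0 (hi i).

Let hX i : pcone (tX i). Proof. by apply: pG => //; exact: GM. Qed.
Let hY i : pcone (tY i). Proof. by apply: pG. Qed.

Definition equivariant2 (b : V -> V -> V) := forall x y k, pcone x -> pcone y -> G k ->
  b (fact x k) (fact y k) = fact (b x y) k.

Lemma pair_coboundary b : equivariant2 b ->
  \sum_i dot (lam i) (b (tY i) x0 - b (tX i) x0 + b (tX i) (tY i)) = 0.
Proof.
move=> hb; rewrite -[RHS](Hb (fun g => b (fact x0 g) x0)); apply: eq_bigr => i _.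
congr dot; rewrite -hb //; last exact: pG.
by rewrite -fact_mul -/(tX i) -/(tY i); apply: vec_eqP => /=; ring.
Qed.

(** The degree at [w] of the image of the chain in the quotient. It has values in V*, and [v] is the
    argument of this linear form. *)
Definition Fdeg w v :=
  \sum_i \sum_(g \in G) deg (fact w g) (tX i) (tY i) x0 * dot (lam i) (fact v g).

(** Zero normals, which come from degenerate edges, are filtered out: with one of them no point
    would be generic. *)
Definition edges : seq V :=
  [seq nu <- flatten [seq [:: cross (tX i) (tY i); cross (tY i) x0; cross x0 (tX i)] | i <- enum I]
      | nu != 0].

Definition generic (E : seq V) w := pcone w /\
  forall g nu, G g -> nu \in E -> dot nu (fact w g) != 0.

Lemma generic_fact E w k : G k -> generic E w -> generic E (fact w k).
Proof.
move=> Gk [hw gw]; split; first exact: pG.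
by move=> g nu Gg nE; rewrite -fact_mul; apply: gw => //; exact: GM.
Qed.

Lemma generic_off w g i : G g -> generic edges w ->
  [/\ off (fact w g) (tX i) (tY i), off (fact w g) (tY i) x0 & off (fact w g) x0 (tX i)].
Proof.
move=> Gg [hw gw].
have H x y : cross x y \in [:: cross (tX i) (tY i); cross (tY i) x0; cross x0 (tX i)] ->
    off (fact w g) x y.
  move=> m; rewrite /off; have [p|np] := eqVneq (cross x y) 0; first by left.
  right; rewrite -dot_cross; apply: gw => //; rewrite mem_filter np.
  by apply/flattenP; eexists; [apply: map_f; exact: mem_enum|exact: m].
by split; apply: H; rewrite !inE eqxx ?orbT.
Qed.

Lemma vscale_neq0 (t : R) v : vscale t v != 0 -> t != 0.
Proof. by apply: contra_neq => ->; apply: vec_eqP => /=; rewrite mul0r. Qed.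

(** By [deg_diff] the change from [w] to [w'] is the pairing of the chain with the coboundary of an
    equivariant cochain, namely the sum of all translated crossing numbers weighted by translates of
    [v]; such pairings vanish. *)
Lemma Fdeg_const w w' v : generic edges w -> generic edges w' -> Fdeg w v = Fdeg w' v.
Proof.
move=> gw gw'; have hw := gw.1; have hw' := gw'.1.
pose b x y := \sum_(g \in G) vscale (icr (fact w g) (fact w' g) x y) (fact v g).
have bE x y (s : seq M2) : uniq s -> (forall g, g \in s -> G g) ->
    (forall g, G g -> icr (fact w g) (fact w' g) x y != 0 -> g \in s) ->
    b x y = \sum_(g <- s) vscale (icr (fact w g) (fact w' g) x y) (fact v g).
  move=> us sGs h; rewrite /b; apply: fsumE => // g Gg /vscale_neq0; exact: h.
have eb : equivariant2 b.
  move=> x y k hx hy Gk.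
  have [s us hs] := finite_uniq (icr_finite sG finG hw hw' hx hy).
  rewrite (bE x y s) //; first last.
  - by move=> g Gg n; apply/hs.
  - by move=> g /hs[].
  rewrite fact_sum /b (reindex_fsbig (fun g => g *m k) G G _ (mulr_bij Gk)).
  rewrite (fsumE (s := s)) //; first last.
  - move=> g Gg /vscale_neq0; rewrite !fact_mul icr_fact ?dG // => n; exact/hs.
  - by move=> g /hs[].
  rewrite [LHS]big_seq [RHS]big_seq; apply: eq_bigr => g _.
  by rewrite !fact_mul icr_fact ?dG // factZ.
apply/eqP; rewrite -subr_eq0 -(pair_coboundary eb) /Fdeg -sumrB; apply/eqP.
apply: eq_bigr => i _.
pose A := [set g | G g /\ deg (fact w g) (tX i) (tY i) x0 != 0] `|`
  [set g | G g /\ deg (fact w' g) (tX i) (tY i) x0 != 0] `|`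
  [set g | G g /\ icr (fact w g) (fact w' g) (tX i) (tY i) != 0] `|`
  [set g | G g /\ icr (fact w g) (fact w' g) (tY i) x0 != 0] `|`
  [set g | G g /\ icr (fact w g) (fact w' g) (tX i) x0 != 0].
have fA : finite_set A.
  by rewrite !finite_setU; do !split; try exact: icr_finite; exact: deg_finite.
have [s us hs] := finite_uniq fA.
have sGs g : g \in s -> G g by move/hs => [[[[]|]|]|] [].
rewrite !(bE _ _ s) //; try by move=> g Gg n; apply/hs; rewrite /A /=; tauto.
rewrite !(fsumE (s := s)) //; try by move=> g Gg; rewrite mulf_eq0 negb_or => /andP[n _];
  apply/hs; rewrite /A /=; tauto.
rewrite -!sumrB -big_split /= dot_sum [LHS]big_seq [RHS]big_seq; apply: eq_bigr => g /sGs Gg.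
have [o1 o2 o3] := generic_off i Gg gw; have [o1' o2' o3'] := generic_off i Gg gw'.
rewrite -mulrBl deg_diff //; try exact: pG.
rewrite (icr_swap _ _ (tX i) x0); rewrite /dot /=; ring.
Qed.

Lemma Fdeg_fact w v k : G k -> Fdeg (fact w k) (fact v k) = Fdeg w v.
Proof.
move=> Gk; apply: eq_bigr => i _.
rewrite [RHS](reindex_fsbig (fun g => k *m g) G G _ (mull_bij Gk)).
by apply: eq_fsbigr => g _; rewrite !fact_mul.
Qed.

Lemma Fdeg_support w : pcone w -> exists s : seq M2, [/\ uniq s, forall g, g \in s -> G g,
  forall g i, G g -> deg (fact w g) (tX i) (tY i) x0 != 0 -> g \in s &
  forall v, Fdeg w v =
   \sum_i \sum_(g <- s) deg (fact w g) (tX i) (tY i) x0 * dot (lam i) (fact v g)].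
Proof.
move=> hw.
have fA : finite_set (\bigcup_(i in [set: I]) [set g | G g /\ deg (fact w g) (tX i) (tY i) x0 != 0]).
  by apply: bigcup_finite => // i _; exact: deg_finite.
have [s us hs] := finite_uniq fA.
have h3 g i : G g -> deg (fact w g) (tX i) (tY i) x0 != 0 -> g \in s.
  by move=> Gg n; apply/hs; exists i.
have h2 g : g \in s -> G g by move/hs => [i _ []].
exists s; split=> // v; apply: eq_bigr => i _; apply: fsumE => // g Gg.
by rewrite mulf_eq0 negb_or => /andP[n _]; exact: h3 n.
Qed.

Lemma Fdeg_linear w : pcone w -> exists l, forall v, Fdeg w v = dot l v.
Proof.
move=> hw; have [s [us _ _ hs]] := Fdeg_support hw.
exists (Fdeg w (1, 0, 0), Fdeg w (0, 1, 0), Fdeg w (0, 0, 1)) => v.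
rewrite /dot /= !hs !mulr_suml -!big_split /=; apply: eq_bigr => i _.
rewrite !mulr_suml -!big_split /=; apply: eq_bigr => g _.
by rewrite /dot /=; ring.
Qed.
End Pairing.

Section PairingZero.
Variable R : realType.
Local Notation V := (R * R * R)%type.
Local Notation M2 := ('M[R]_2).
Implicit Types (x y z w v : V) (g h k : M2).
Variable G : set M2.
Hypothesis sG : subgroup_SL2 G.
Hypothesis fG : mobius_free G.
Hypothesis finG : bil_finite G.

Let G1 : G 1%:M. Proof. by case: sG. Qed.
Let dG g : G g -> \det g = 1. Proof. by case: sG => _ + _ _; apply. Qed.
Let GM g h : G g -> G h -> G (g *m h). Proof. by case: sG => _ _ + _; apply. Qed.
Let GV g : G g -> G (invmx g). Proof. by case: sG => _ _ _; apply. Qed.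
Let pG x g : G g -> pcone x -> pcone (fact x g).
Proof. by move=> Gg; apply: pcone_fact; exact: dG. Qed.

Definition pull g (nu : V) : V :=
  (dot nu (fact (1, 0, 0) g), dot nu (fact (0, 1, 0) g), dot nu (fact (0, 0, 1) g)).

Lemma dot_pull g nu w : dot (pull g nu) w = dot nu (fact w g).
Proof. by rewrite /pull /dot /fact /=; ring. Qed.

Lemma dot_nondeg (nu : V) : (forall w, dot nu w = 0) -> nu = 0.
Proof.
move=> h; have := h (1, 0, 0); have := h (0, 1, 0); have := h (0, 0, 1).
by rewrite /dot /= => h1 h2 h3; apply: vec_eqP => /=; lra.
Qed.

Definition genset (E : seq V) : set V := \bigcup_(g in G) [set pull g nu | nu in [set` E]].

Lemma genset_countable E : countable (genset E).
Proof.
apply: bigcup_countable; first exact: group_countable.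
move=> g _; apply: finite_set_countable; apply: finite_image; exact: finite_seq.
Qed.

Lemma genset_neq0 E nu : (forall nu, nu \in E -> nu <> 0) -> genset E nu -> nu <> 0.
Proof.
move=> hE [g Gg [nu' /= nE <-]] e; apply: (hE _ nE); apply: dot_nondeg => w.
by rewrite -[w](factKV _ (dG Gg)) -dot_pull e /dot /= !mul0r !addr0.
Qed.

Lemma genset_generic E w : pcone w -> (forall nu, genset E nu -> dot nu w != 0) ->
  generic G E w.
Proof.
move=> hw h; split=> // g nu Gg nE; rewrite -dot_pull; apply: h.
by exists g => //; exists nu.
Qed.

Variable x0 : V.
Hypothesis hx0 : pcone x0.
Variables (I : finType) (lam : I -> V) (gi hi : I -> M2).
Hypothesis Ggi : forall i, G (gi i).
Hypothesis Ghi : forall i, G (hi i).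
Hypothesis Hb : forall b : M2 -> V,
  \sum_i dot (lam i) (fact (b (gi i)) (hi i) + b (hi i) - b (gi i *m hi i)) = 0.

Local Notation tX := (tX x0 gi hi).
Local Notation tY := (tY x0 hi).
Local Notation edges := (edges x0 gi hi).
Local Notation Fdeg := (Fdeg G x0 lam gi hi).

Let hX i : pcone (tX i). Proof. by apply: pG => //; exact: GM. Qed.
Let hY i : pcone (tY i). Proof. by apply: pG. Qed.

Lemma edges_neq0 nu : nu \in edges -> nu <> 0.
Proof. by rewrite mem_filter => /andP[/eqP]. Qed.

(* An invariant linear form is bounded on the orbit of a compact set of forms of
   discriminant one; but no nonzero linear form is bounded on all of them. *)
Lemma Fdeg_zero w v : generic G edges w -> Fdeg w v = 0.
Proof.
move=> gw; have hw := gw.1.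
have [l hl] := Fdeg_linear sG finG hx0 lam Ggi Ghi hw.
have lE w' v' : generic G edges w' -> Fdeg w' v' = dot l v'.
  by move=> gw'; rewrite (Fdeg_const sG finG hx0 Ggi Ghi Hb v' gw' gw) hl.
have linv v' k : G k -> dot l (fact v' k) = dot l v'.
  move=> Gk; rewrite -(lE _ _ (generic_fact sG Gk gw)).
  by rewrite (Fdeg_fact sG) // hl.
rewrite hl; have [->|l0] := eqVneq l 0; first by rewrite /dot /= !mul0r !addr0.
exfalso.
(* The squares (u - cv)^2, on the boundary of the cone, span V, so [l] does not vanish on all of
   them. *)
pose p (c : R) : V := (1, - 2 * c, c ^+ 2).
have [c hc] : exists c, dot l (p c) != 0.
  apply: contrapT => no.
  have z c : dot l (p c) = 0 by apply/eqP; apply: contrapT => n; apply: no; exists c; exact/negP.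
  move/eqP: l0; apply; have := z 0; have := z 1; have := z (-1).
  by rewrite /dot /p /= => z1 z2 z3; apply: vec_eqP => /=; lra.
(* First and second derivative of [p] at [c]: the germ is the form (u - (c + e) v)^2 + e^2 v^2, of
   discriminant 4 e^2. *)
pose d : V := (0, -2, 2 * c); pose n : V := (0, 0, 2).
have D0 : det3 (p c) d n != 0.
  by rewrite (_ : det3 _ _ _ = -4) ?oppr_eq0 ?pnatr_eq0 // /det3 /p /d /n /=; ring.
(* On a hull of translates of [x0] an invariant [l] satisfies l^2 <= K disc; the 3 comes from (a + b
   + c)^2 <= 3 (a^2 + b^2 + c^2). For small [e] this contradicts the lower bound on [l] at the
   germ. *)
pose m := `|dot l x0|; pose K := 3 * m ^+ 2 / disc x0.
have m0 : 0 <= m by exact: normr_ge0.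
have K0 : 0 <= K by rewrite /K divr_ge0 ?mulr_ge0 ?sqr_ge0 // ltW // hx0.2.
pose B := `|dot l d| + `|dot l n| + 2 * (1 + K).
have B0 : 0 < B by rewrite /B; have := normr_ge0 (dot l d); have := normr_ge0 (dot l n); lra.
pose e0 := Num.min 1 (`|dot l (p c)| / B).
have e00 : 0 < e0 by rewrite /e0 lt_min ltr01 divr_gt0 // normr_gt0.
have [e /andP[ep]] := germ_avoid (genset_countable edges) (fun nu => @genset_neq0 _ nu edges_neq0) D0 e00.
rewrite /e0 lt_min ltr_pdivlMr // => /andP[e1 eB] av.
pose u := germ (p c) d n e 1 1.
have du : disc u = 4 * e ^+ 2 by rewrite /u /germ /disc /p /d /n /=; ring.
have hu : pcone u.
  split; last by rewrite du mulr_gt0 // exprn_gt0.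
  by rewrite /u /germ /p /d /n /= !mulr0 !addr0.
have gu : generic G edges u.
  by apply: genset_generic => // nu gnu; apply: av => //; left.
have big : 2 * (1 + K) * e < `|dot l u|.
  have -> : dot l u = dot l (p c) - (- (e * dot l d + e ^+ 2 * dot l n)).
    by rewrite /u /germ !dotD !dotZ; ring.
  apply: lt_le_trans (lerB_dist _ _); rewrite normrN.
  have h1 : `|e * dot l d + e ^+ 2 * dot l n| <= e * `|dot l d| + e * `|dot l n|.
    apply: le_trans (ler_normD _ _) _; rewrite !normrM !(gtr0_norm ep) lerD // ler_wpM2r //.
    by rewrite ler_piMr // ltW.
  by rewrite /B in eB; lra.
have lu0 : Fdeg u u != 0.
  rewrite lE // -normr_gt0; apply: lt_trans big; rewrite !mulr_gt0 //; lra.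
have [s [us sGs _ hs]] := Fdeg_support sG finG hx0 lam Ggi Ghi hu.
have [i [g [Gg dn]]] : exists i g, G g /\ deg (fact u g) (tX i) (tY i) x0 != 0.
  apply: contrapT => no; move/eqP: lu0; apply; rewrite hs big1 // => i _.
  rewrite big_seq big1 // => g gs.
  have [->|dn] := eqVneq (deg (fact u g) (tX i) (tY i) x0) 0; first by rewrite mul0r.
  by case: no; exists i, g; split=> //; exact: sGs.
have hug := pG Gg hu.
have nd : det3 (tX i) (tY i) x0 != 0 by apply: contra_neq dn => e'; exact: deg_flat.
have [a [b [c' [a0 b0 c0 eu]]]] := deg_hull hug (hX i) (hY i) hx0 nd dn.
have dE y k : G k -> disc (fact y k) = disc y by move=> Gk; rewrite disc_fact dG // expr1n mul1r.
have le := disc_comb (hX i) (hY i) hx0 a0 b0 c0.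
rewrite -eu dE // !dE // in le; last exact: GM.
have lu : dot l u = (a + b + c') * dot l x0.
  rewrite -(linv u g Gg) eu !dotD !dotZ !linv //; [ring|exact: GM].
have D1 : 0 < disc x0 by exact: hx0.2.
have sq : (a + b + c') ^+ 2 <= 3 * (a ^+ 2 + b ^+ 2 + c' ^+ 2).
  have := sqr_ge0 (a - b); have := sqr_ge0 (b - c'); have := sqr_ge0 (a - c'); lra.
have le2 : (a + b + c') ^+ 2 * disc x0 <= 12 * e ^+ 2.
  rewrite du in le.
  have : (a + b + c') ^+ 2 * disc x0 <= 3 * (a ^+ 2 + b ^+ 2 + c' ^+ 2) * disc x0.
    by rewrite ler_pM2r.
  lra.
have up : (dot l u) ^+ 2 <= 4 * K * e ^+ 2.
  have -> : 4 * K * e ^+ 2 = 12 * e ^+ 2 / disc x0 * m ^+ 2 by rewrite /K; field; rewrite gt_eqF.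
  rewrite lu exprMn /m real_normK ?num_real // ler_wpM2r ?sqr_ge0 //.
  by rewrite ler_pdivlMr.
have lo : (2 * (1 + K) * e) ^+ 2 < dot l u ^+ 2.
  rewrite -[ltRHS]real_normK ?num_real // ltrXn2r // ?nnegrE; last first.
  by rewrite !mulr_ge0 // ?addr_ge0 // ltW.
have e2 : 0 < e ^+ 2 by rewrite exprn_gt0.
have : 4 * K * e ^+ 2 <= (2 * (1 + K) * e) ^+ 2.
  rewrite (_ : (2 * (1 + K) * e) ^+ 2 = 4 * (1 + K) ^+ 2 * e ^+ 2); last by ring.
  by rewrite ler_pM2r // ler_pM2l //; have := sqr_ge0 K; nra.
lra.
Qed.

Definition dual x : V := (2 * x.2, - x.1.2, 2 * x.1.1).

Lemma dot_dualB x y w : dot (dual x - dual y) w = bil w x - bil w y.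
Proof. by rewrite /dot /bil /=; ring. Qed.

Lemma closest u : pcone u -> exists2 g, G g &
  forall h, G h -> bil u (fact x0 g) <= bil u (fact x0 h).
Proof.
move=> hu.
have [|g [Gg gle] hmin] := finite_min (fun g => bil u (fact x0 g)) (finG (bil u x0) hu hx0) (x0 := 1%:M).
  by split=> //; rewrite fact1.
exists g => // h Gh; have [le|lt] := lerP (bil u (fact x0 h)) (bil u x0).
  by apply: hmin.
by apply: le_trans gle (ltW _).
Qed.

Lemma bil_comb x y z v (a b c : R) : bil (vscale a x + vscale b y + vscale c z) v =
  a * bil x v + b * bil y v + c * bil z v.
Proof. by rewrite /bil /=; ring. Qed.

Lemma bil_hull x y z u v w : hull x y z u -> bil x v <= bil x w ->
  bil y v <= bil y w -> bil z v <= bil z w -> bil u v <= bil u w.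
Proof.
move=> [a [b [c [a0 b0 c0 ->]]]] h1 h2 h3; rewrite !bil_comb.
have := ler_wpM2l a0 h1; have := ler_wpM2l b0 h2; have := ler_wpM2l c0 h3; lra.
Qed.

(** The Dirichlet cell of the translate of [x0] by [g], with [bil] in place of the distance. *)
Definition in_dirichlet g u := forall h, G h -> bil u (fact x0 g) <= bil u (fact x0 h).

(** A translate that is nearest to some point of the triangle is at least as near as [x0] at one of
    the vertices. Only finitely many translates qualify, and cutting along their mutual bisectors is
    enough. *)
Lemma pieces i : exists P E, dissection [::] (tX i, tY i, x0) P E /\
  forall t, t \in P -> exists2 g, G g &
    [/\ in_dirichlet g t.1.1, in_dirichlet g t.1.2 & in_dirichlet g t.2].
Proof.
have [e|nd] := eqVneq (det3 (tX i) (tY i) x0) 0.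
  exists [::], [::]; split=> //; split=> //.
    by move=> T [_ flat]; rewrite big_nil /tval /= flat.
  by move=> w hw _; rewrite big_nil /tval /= deg_flat.
have tr : tri (tX i, tY i, x0) by split=> //=.
pose A (u : V) := [set g | G g /\ bil u (fact x0 g) <= bil u x0].
have fA : finite_set (A (tX i) `|` A (tY i) `|` A x0).
  by rewrite !finite_setU; do !split; exact: finG.
have [s us hs] := finite_uniq fA.
pose L := [seq dual (fact x0 g) - dual (fact x0 h) | g <- s, h <- s].
have [P [E dis]] := dissectionP L tr.
have [d1 d2 d3 d4 d5] := dis.
exists P, E; split; first by split=> //.
move=> t tP; have [[h1 h2 h3 tn] [k1 k2 k3]] := d1 _ tP.
have sP u g : pcone u -> hull (tX i) (tY i) x0 u -> G g -> in_dirichlet g u -> g \in s.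
  move=> hu hul Gg dg; apply/hs.
  have := dg _ G1; rewrite fact1 => le.
  have [q1|q1] := lerP (bil (tX i) (fact x0 g)) (bil (tX i) x0); first by left; left.
  have [q2|q2] := lerP (bil (tY i) (fact x0 g)) (bil (tY i) x0); first by left; right.
  have [q3|q3] := lerP (bil x0 (fact x0 g)) (bil x0 x0); first by right.
  exfalso.
  have [a [b [c [a0 b0 c0 e]]]] := hul.
  have pos : 0 < a \/ 0 < b \/ 0 < c.
    have [pa|pa] := ltrP 0 a; first by left.
    have [pb|pb] := ltrP 0 b; first by right; left.
    have [pc|pc] := ltrP 0 c; first by right; right.
    have z (r : R) : 0 <= r -> r <= 0 -> r = 0 by move=> r0 r1; apply/eqP; rewrite eq_le r1.
    have := bil_gt0 hu hu; rewrite {1}e bil_comb (z a) // (z b) // (z c) //.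
    by rewrite !mul0r !addr0 ltxx.
  move: le; rewrite e !bil_comb leNgt => /negP; apply.
  have l1 := ler_wpM2l a0 (ltW q1); have l2 := ler_wpM2l b0 (ltW q2).
  have l3 := ler_wpM2l c0 (ltW q3).
  case: pos => [pa|[pb|pc]].
  - have := q1; rewrite -(ltr_pM2l pa) => q; lra.
  - have := q2; rewrite -(ltr_pM2l pb) => q; lra.
  - have := q3; rewrite -(ltr_pM2l pc) => q; lra.
(* The nearest translate is read off at an interior point of the piece. No bisector separates the
   vertices, so it is nearest at each vertex too. *)
pose u := t.1.1 + t.1.2 + t.2.
have hu : pcone u by do 2?apply: pconeD.
have hullu : hull (tX i) (tY i) x0 u.
  apply: (hull_trans k1 k2 k3); exists 1, 1, 1; split=> //; rewrite ?ler01 //.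
  by rewrite /u; apply: vec_eqP => /=; ring.
have [g Gg gmin] := closest hu.
have gs : g \in s by exact: sP hullu Gg gmin.
exists g => //.
have key q : (q = t.1.1 \/ q = t.1.2 \/ q = t.2) -> pcone q -> hull (tX i) (tY i) x0 q -> in_dirichlet g q.
  move=> qv hq hulq h Gh.
  have [h' Gh' h'min] := closest hq.
  apply: le_trans (h'min _ Gh).
  have h's : h' \in s by exact: sP hulq Gh' h'min.
  have lL : dual (fact x0 g) - dual (fact x0 h') \in L by apply/allpairsP; exists (g, h').
  have := d2 _ _ tP lL; rewrite /onesided !dot_dualB.
  have bu v : bil u v = bil t.1.1 v + bil t.1.2 v + bil t.2 v by rewrite /u /bil /=; ring.
  have := gmin _ Gh'; rewrite !bu.
  by case: qv => [->|[->|->]]; move=> g1 [[g2 g3 g4]|[g2 g3 g4]]; lra.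
by split; apply: key => //; [left|right; left|right; right].
Qed.

Definition equivariant3 (T : V -> V -> V -> V) := forall x y z k,
  pcone x -> pcone y -> pcone z -> G k ->
  T (fact x k) (fact y k) (fact z k) = fact (T x y z) k.

Lemma in_dirichlet_hull g x y z u : in_dirichlet g x -> in_dirichlet g y -> in_dirichlet g z ->
  hull x y z u -> in_dirichlet g u.
Proof.
by move=> hx hy hz hu h Gh; apply: (bil_hull hu); [exact: hx|exact: hy|exact: hz].
Qed.

Variable T : V -> V -> V -> V.
Hypothesis Teq : equivariant3 T.
Hypothesis Tcoc : forall x y z w, pcone x -> pcone y -> pcone z -> pcone w ->
  T y z w - T x z w + T x y w - T x y z = 0.
Hypothesis Tflat : forall x y z, pcone x -> pcone y -> pcone z -> det3 x y z = 0 -> T x y z = 0.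

Lemma additive_dot l : additive_cochain (fun x y z => dot l (T x y z)).
Proof.
split=> [x y z w hx hy hz hw|x y z hx hy hz e].
  transitivity (dot l (T y z w - T x z w + T x y w - T x y z)); first by rewrite /dot /=; ring.
  by rewrite Tcoc // /dot /= !mulr0 !addr0.
by rewrite Tflat // /dot /= !mulr0 !addr0.
Qed.

Definition tfact (t : V * V * V) g := (fact t.1.1 g, fact t.1.2 g, fact t.2 g).

Lemma pairing_zero : \sum_i dot (lam i) (T (tX i) (tY i) x0) = 0.
Proof.
have /choice[P /choice[E hPE]] := pieces.
have hg : forall p : I * (V * V * V), exists g, G g /\ (p.2 \in P p.1 ->
    [/\ in_dirichlet g p.2.1.1, in_dirichlet g p.2.1.2 & in_dirichlet g p.2.2]).
  move=> [i t] /=; have [tP|_] := boolP (t \in P i); last by exists 1%:M.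
  by have [_ h] := hPE i; have [g Gg hg] := h _ tP; exists g.
case/choice: hg => gam hgam.
have Ggam p : G (gam p) by case: (hgam p).
pose Q := [seq (i, t) | i <- enum I, t <- P i].
have QP p : p \in Q -> p.2 \in P p.1.
  by move=> /allpairsPdep[i [t [_ tP ->]]].
have sumQ (F : I -> V * V * V -> R) : \sum_(p <- Q) F p.1 p.2 = \sum_i \sum_(t <- P i) F i t.
  by rewrite /Q big_allpairs_dep /= big_enum.
pose J := 'I_(size Q).
pose qj (j : J) := tnth (in_tuple Q) j.
have qP j : (qj j).2 \in P (qj j).1 by apply: QP; exact: mem_tnth.
have sumJ (F : I * (V * V * V) -> R) : \sum_(p <- Q) F p = \sum_j F (qj j).
  by rewrite big_tnth.
pose tj j := tfact (qj j).2 (invmx (gam (qj j))).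
have triQ p : p \in Q -> tri p.2.
  by move=> /QP tP; have [[d1 _ _ _ _] _] := hPE p.1; have [] := d1 _ tP.
(* Coordinates of V turn the chain with values in V* into three real chains, to which [chain_zero]
   applies. *)
pose base := [:: ((1, 0, 0) : V); (0, 1, 0); (0, 0, 1)].
have expand l x g : dot l (fact x g) = \sum_(e <- base) dot l (fact e g) * dot e x.
  by rewrite !big_cons big_nil /dot /fact /=; ring.
transitivity (\sum_(e <- base) \sum_j dot (lam (qj j).1) (fact e (gam (qj j))) *
    dot e (T (tj j).1.1 (tj j).1.2 (tj j).2)).
  rewrite exchange_big /=.
  rewrite -(sumJ (fun p => \sum_(e <- base) dot (lam p.1) (fact e (gam p)) *
     dot e (T (tfact p.2 (invmx (gam p))).1.1 (tfact p.2 (invmx (gam p))).1.2 (tfact p.2 (invmx (gam p))).2))).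
  transitivity (\sum_(p <- Q) dot (lam p.1) (T p.2.1.1 p.2.1.2 p.2.2)).
    rewrite (sumQ (fun i t => dot (lam i) (T t.1.1 t.1.2 t.2))); apply: eq_bigr => i _.
    by have [[_ _ d3 _ _] _] := hPE i; exact: (d3 _ (additive_dot (lam i))).
  rewrite [LHS]big_seq [RHS]big_seq; apply: eq_bigr => p pQ.
  have [h1 h2 h3 _] := triQ _ pQ.
  rewrite -expand -Teq ?factKV ?dG //; by [apply: pG => //; exact: GV|].
rewrite big1_seq // => e _.
(* Bisectors around [x0] are avoided as well: at a generic [w] either [x0] is strictly nearer than
   all its other translates, or it is not a nearest one. *)
pose bis : set V := [set dual x0 - dual (fact x0 g) | g in [set g | G g /\ g <> 1%:M]].
pose EE := edges ++ flatten [seq E i | i <- enum I].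
pose N := genset EE `|` bis.
have EEn nu : nu \in EE -> nu <> 0.
  rewrite mem_cat => /orP[/edges_neq0 //|/flattenP[s /mapP[i _ ->]]].
  by have [[_ _ _ _ d5] _] := hPE i; exact: d5.
apply: (chain_zero (N := N) (T := fun x y z => dot e (T x y z)) (additive_dot e)).
- move=> j; have [h1 h2 h3 n0] := triQ (qj j) (mem_tnth _ _).
  have GV' := GV (Ggam (qj j)).
  split; [exact: pG|exact: pG|exact: pG|].
  by rewrite /= det3_hom // dG.
- rewrite /N -bigcup2E; apply: bigcup_countable => // -[|[|k]] _ /=.
  + exact: genset_countable.
  + apply: (sub_countable (B := G)); last exact: group_countable.
    by apply: card_le_trans (card_image_le _ _) _; apply: subset_card_le => g [].
  + exact: countable0.
- move=> nu [/(genset_neq0 EEn) //|[g [Gg gn] <-]] z; apply: gn.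
  apply: (fG Gg hx0); move: z; rewrite /dual => /vec_split[/= z1 z2 z3].
  by apply: vec_eqP => /=; lra.
move=> w hw hN.
have gEE : generic G EE w by apply: genset_generic => // nu nE; apply: hN; left.
have ged : generic G edges w.
  by split=> // g nu Gg nE; apply: gEE.2; rewrite ?mem_cat ?nE.
have bisne g : G g -> g <> 1%:M -> bil w x0 != bil w (fact x0 g).
  by move=> Gg gn; rewrite -subr_eq0 -dot_dualB; apply: hN; right; exists g.
have degj p : deg w (tfact p.2 (invmx (gam p))).1.1 (tfact p.2 (invmx (gam p))).1.2
     (tfact p.2 (invmx (gam p))).2 = deg (fact w (gam p)) p.2.1.1 p.2.1.2 p.2.2.
  by rewrite /= -(deg_fact _ _ _ _ (dG (Ggam p))) !factKV ?dG.
rewrite -(sumJ (fun p => dot (lam p.1) (fact e (gam p)) * deg w (tfact p.2 (invmx (gam p))).1.1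
   (tfact p.2 (invmx (gam p))).1.2 (tfact p.2 (invmx (gam p))).2)).
have bilV u g h : G g -> bil (fact u g) (fact x0 h) = bil u (fact x0 (h *m invmx g)).
  move=> Gg; rewrite -[LHS]mul1r -[1](expr1n _ 2) -(dG (GV Gg)) -bil_fact factK ?dG //.
  by rewrite -fact_mul.
have inside p g : p \in Q -> G g -> deg (fact w g) p.2.1.1 p.2.1.2 p.2.2 != 0 ->
    forall h, G h -> bil w (fact x0 (gam p *m invmx g)) <= bil w (fact x0 h).
  move=> pQ Gg dn h Gh; have [h1 h2 h3 n0] := triQ _ pQ.
  have hul := deg_hull (pG Gg hw) h1 h2 h3 n0 dn.
  have [_ hd] := hgam p; have [d1 d2 d3] := hd (QP _ pQ).
  have := in_dirichlet_hull d1 d2 d3 hul (GM Gh Gg).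
  by rewrite !bilV // -mulmxA mulgV ?mulmx1 // dG.
(* Outside the cell of [x0] every transported piece has degree 0. Inside it, the only translate of a
   piece [p] that counts is the one by [gam p], so the sum is [Fdeg w e]. *)
have [strict|nstrict] := pselect (forall g, G g -> g <> 1%:M -> bil w x0 < bil w (fact x0 g)); last first.
  rewrite big1_seq // => p /= pQ; rewrite degj.
  have [->|dn] := eqVneq (deg (fact w (gam p)) p.2.1.1 p.2.1.2 p.2.2) 0; first by rewrite mulr0.
  exfalso; apply: nstrict => g Gg gn; rewrite lt_neqAle bisne //=.
  have := inside _ _ pQ (Ggam p) dn _ Gg.
  by rewrite mulgV ?fact1 // dG.
have [s [us sGs hs hF]] := Fdeg_support sG finG hx0 lam Ggi Ghi hw.
pose s' := undup (s ++ [seq gam p | p <- Q]).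
have s'G g : g \in s' -> G g.
  by rewrite mem_undup mem_cat => /orP[/sGs //|/mapP[p _ ->]].
transitivity (\sum_(p <- Q) \sum_(g <- s') deg (fact w g) p.2.1.1 p.2.1.2 p.2.2 *
   dot (lam p.1) (fact e g)).
  rewrite [LHS]big_seq [RHS]big_seq; apply: eq_bigr => p pQ; rewrite degj.
  have gs : gam p \in s' by rewrite mem_undup mem_cat map_f ?orbT.
  rewrite (bigD1_seq _ gs) ?undup_uniq //= [X in _ + X]big1_seq ?addr0; first by rewrite mulrC.
  move=> g /andP[gn /s'G Gg].
  have [->|dn] := eqVneq (deg (fact w g) p.2.1.1 p.2.1.2 p.2.2) 0; first by rewrite mul0r.
  exfalso; have := inside _ _ pQ Gg dn _ G1; rewrite fact1 leNgt => /negP; apply.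
  apply: strict; first by apply: GM => //; exact: GV.
  move=> eg; move/eqP: gn; apply; by rewrite -[g]mul1mx -eg -mulmxA mulVg ?mulmx1 // dG.
pose F i t := \sum_(g <- s') deg (fact w g) t.1.1 t.1.2 t.2 * dot (lam i) (fact e g).
transitivity (\sum_i \sum_(t <- P i) F i t); first exact: (sumQ F).
rewrite -[RHS](Fdeg_zero e ged) hF; apply: eq_bigr => i _.
rewrite /F exchange_big /=.
transitivity (\sum_(g <- s') deg (fact w g) (tX i) (tY i) x0 * dot (lam i) (fact e g)).
  rewrite [LHS]big_seq [RHS]big_seq; apply: eq_bigr => g /s'G Gg; rewrite -mulr_suml; congr (_ * _).
  have [[_ _ _ d4 _] _] := hPE i; apply/esym/(d4 _ (pG Gg hw)) => nu nE.
  apply: gEE.2 => //; rewrite mem_cat; apply/orP; right; apply/flattenP.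
  by exists (E i) => //; apply: map_f; rewrite mem_enum.
rewrite -(fsumE (A := G)) ?undup_uniq //; last first.
  move=> g Gg; rewrite mulf_eq0 negb_or => /andP[dn _].
  by rewrite mem_undup mem_cat (hs _ _ Gg dn).
by apply: fsumE => // g Gg; rewrite mulf_eq0 negb_or => /andP[dn _]; exact: hs dn.
Qed.
End PairingZero.

(** * Extension of linear functionals *)

Section Extension.
Variables (R : realType) (X : Type).
Local Notation M := (X -> R).

Definition linear_graph (D : set (M * R)) :=
  [/\ D (fun=> 0, 0),
      forall m n r s, D (m, r) -> D (n, s) -> D (fun x => m x + n x, r + s),
      forall t m r, D (m, r) -> D (fun x => t * m x, t * r) &
      forall r, D (fun=> 0, r) -> r = 0].

Lemma linear_graph_fun D m r s : linear_graph D -> D (m, r) -> D (m, s) -> r = s.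
Proof.
move=> [_ Dadd Dscale Dfun] Dr Ds; apply/eqP; rewrite -subr_eq0; apply/eqP; apply: Dfun.
have -> : (fun=> 0) = (fun x => m x + -1 * m x) by apply/funext => x; ring.
by rewrite -(mulN1r s); apply: Dadd => //; exact: Dscale.
Qed.

(** A maximal single-valued linear relation is total. Zorn's lemma is applied to sets joined with
    [D], so that the union of the empty chain is admissible. *)
Lemma linear_graph_extend D : linear_graph D -> exists phi : M -> R,
  [/\ forall m n, phi (fun x => m x + n x) = phi m + phi n,
      forall t m, phi (fun x => t * m x) = t * phi m &
      forall m r, D (m, r) -> phi m = r].
Proof.
move=> lD; have [D0 Dadd Dscale Dfun] := lD.
have [|A [lA Amax]] := @Zorn_bigcup _ (fun A => linear_graph (A `|` D)).
  move=> F FP Ftot.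
  pose U := \bigcup_(Y in F) Y.
  have lift p q : (U `|` D) p -> (U `|` D) q -> exists Y, [/\ linear_graph (Y `|` D),
      Y `<=` U, (Y `|` D) p & (Y `|` D) q].
    move=> [[Y FY Yp]|Dp] [[Z FZ Zq]|Dq].
    - have [YZ|ZY] := Ftot _ _ FY FZ.
        exists Z; split; [exact: FP|by move=> z Zz; exists Z| |]; left=> //; exact: YZ.
      exists Y; split; [exact: FP|by move=> z Yz; exists Y| |]; left=> //; exact: ZY.
    - exists Y; split; [exact: FP|by move=> z Yz; exists Y|by left|by right].
    - exists Z; split; [exact: FP|by move=> z Zz; exists Z|by right|by left].
    - by exists set0; split; [rewrite set0U|by []|right|right].
  have sub Y : Y `<=` U -> Y `|` D `<=` U `|` D.
    by move=> YU z [/YU|]; [left|right].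
  split; first by right.
  - move=> m n r s h1 h2; have [Y [[_ Yadd _ _] /sub YU p1 p2]] := lift _ _ h1 h2.
    by apply: YU; exact: Yadd.
  - move=> t m r h1; have [Y [[_ _ Ys _] /sub YU p1 _]] := lift _ _ h1 h1.
    by apply: YU; exact: Ys.
  - by move=> r h1; have [Y [[_ _ _ Yf] _ p1 _]] := lift _ _ h1 h1; exact: Yf.
set E := A `|` D in lA.
have [E0 Eadd Escale Efun] := lA.
have total m : exists r, E (m, r).
  apply: contrapT => no.
  pose E' : set (M * R) := [set p | exists n s t, E (n, s) /\ p = (fun x => n x + t * m x, s)].
  have EE' : E `<=` E'.
    move=> [n s] En; exists n, s, 0; split=> //; congr (_, _).
    by apply/funext => x; rewrite mul0r addr0.
  have lE' : linear_graph E'.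
    split; first exact: EE'.
    - move=> _ _ _ _ [n1 [s1 [t1 [e1 [-> ->]]]]] [n2 [s2 [t2 [e2 [-> ->]]]]].
      exists (fun x => n1 x + n2 x), (s1 + s2), (t1 + t2); split; first exact: Eadd.
      by congr (_, _); apply/funext => x; ring.
    - move=> t _ _ [n1 [s1 [t1 [e1 [-> ->]]]]].
      exists (fun x => t * n1 x), (t * s1), (t * t1); split; first exact: Escale.
      by congr (_, _); apply/funext => x; ring.
    - move=> r [n [s [t [e [en ->]]]]].
      have [t0|tn] := eqVneq t 0.
        apply: Efun; rewrite (_ : (fun=> 0) = n) //; rewrite en; apply/funext => x.
        by rewrite t0 mul0r addr0.
      case: no; exists (- t^-1 * s).
      rewrite (_ : m = (fun x => - t^-1 * n x)); first exact: Escale.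
      apply/funext => x; have := congr1 (fun f => f x) en => /= ex.
      have -> : n x = - (t * m x) by lra.
      by field.
  have pE' : linear_graph (E' `|` D).
    rewrite (_ : E' `|` D = E') //.
    by apply/seteqP; split=> p; [case=> // Dp; apply: EE'; right|left].
  apply: Amax pE'; split; first by move=> p Ap; apply: EE'; left.
  move=> /(_ (m, 0)) h; apply: no; exists 0; left; apply: h.
  exists (fun=> 0), 0, 1; split; first exact: E0.
  by congr (_, _); apply/funext => x; rewrite add0r mul1r.
have /choice[phi hphi] := total.
exists phi; split.
- move=> m n; apply: (linear_graph_fun lA (hphi _)).
  by apply: Eadd; exact: hphi.
- by move=> t m; apply: (linear_graph_fun lA (hphi _)); apply: Escale; exact: hphi.
- by move=> m r Dm; apply: (linear_graph_fun lA (hphi _)); right.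
Qed.
End Extension.

(** * Vanishing of the second cohomology with values in binary forms *)

Section H2.
Variable R : realType.
Local Notation V := (R * R * R)%type.
Local Notation M2 := ('M[R]_2).
Variable G : set M2.
Hypothesis sG : subgroup_SL2 G.
Hypothesis fG : mobius_free G.
Hypothesis finG : bil_finite G.

Let G1 : G 1%:M. Proof. by case: sG. Qed.
Let dG g : G g -> \det g = 1. Proof. by case: sG => _ + _ _; apply. Qed.
Let GM g h : G g -> G h -> G (g *m h). Proof. by case: sG => _ _ + _; apply. Qed.
Let GV g : G g -> G (invmx g). Proof. by case: sG => _ _ _; apply. Qed.

Lemma cocycle_swap (p q r s : V) : p + q = r + s -> s - p + r - q = 0.
Proof. by move=> /vec_split[/= h1 h2 h3]; apply: vec_eqP => /=; lra. Qed.

Lemma cocycle_sub_boundary (p q r s xy xz xw yz yw zw : V) : p - q + r - s = 0 ->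
  p - (zw - yw + yz) - (q - (zw - xw + xz)) + (r - (yw - xw + xy)) - (s - (yz - xz + xy)) = 0.
Proof.
by move=> /vec_split[/= h1 h2 h3]; apply: vec_eqP => /=; lra.
Qed.

Variable c : M2 -> M2 -> V.
Hypothesis cc : forall g h l, G g -> G h -> G l ->
  c (g *m h) l + fact (c g h) l = c g (h *m l) + c h l.

Lemma cocycle_pairing (I : finType) (lam : I -> V) (gi hi : I -> M2) :
  (forall i, G (gi i)) -> (forall i, G (hi i)) ->
  (forall b : M2 -> V,
     \sum_i dot (lam i) (fact (b (gi i)) (hi i) + b (hi i) - b (gi i *m hi i)) = 0) ->
  \sum_i dot (lam i) (c (gi i) (hi i)) = 0.
Proof.
move=> Ggi Ghi Hb.
(* The homogeneous cocycle attached to [c], equivariant for right translations; its value at (gh, h,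
   1) is c(g, h). *)
pose f x y z := fact (c (x *m invmx y) (y *m invmx z)) z.
have cancel x y z : G y -> x *m invmx y *m (y *m z) = x *m z.
  by move=> Gy; rewrite mulmxA -(mulmxA x) mulVg ?mulmx1 // dG.
have fcoc (x y z w : M2) : G x -> G y -> G z -> G w ->
    f y z w - f x z w + f x y w - f x y z = 0.
  move=> Gx Gy Gz Gw; rewrite /f.
  have Gxy := GM Gx (GV Gy); have Gyz := GM Gy (GV Gz); have Gzw := GM Gz (GV Gw).
  have := cc Gxy Gyz Gzw; rewrite !cancel // => e.
  have {}e := congr1 (fun v => fact v w) e; rewrite !factD in e.
  move: e; rewrite -fact_mul -(mulmxA z) mulVg ?dG // mulmx1.
  exact: cocycle_swap.
have feq (x y z k : M2) : G x -> G y -> G z -> G k ->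
    f (x *m k) (y *m k) (z *m k) = fact (f x y z) k.
  move=> Gx Gy Gz Gk; rewrite /f fact_mul.
  have e (u v : M2) : G v -> u *m k *m invmx (v *m k) = u *m invmx v.
    move=> Gv; rewrite -[LHS]mulmx1 -(mulgV (dG Gv)) mulmxA -[_ *m v]mulmx1 -(mulgV (dG Gk)).
    rewrite mulmxA -(mulmxA _ v k) -(mulmxA (u *m k)) mulVg ?mulmx1; last by rewrite dG //; exact: GM.
    by rewrite -(mulmxA u) mulgV ?mulmx1 // dG.
  by rewrite !e.
have [b [beq bline]] := collinear_primitive sG fG finG fcoc feq.
pose T x y z := sphi G f x y z - (b y z - b x z + b x y).
(* A chosen representative has trivial [sec], so that at the triangle of (g, h) the cochain [T]
   equals c(g, h) up to an equivariant coboundary. *)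
pose x0 := rep G (1, 0, 1).
have hx0 : pcone x0.
  by apply: (@orb_pcone R G sG (1, 0, 1)); [exact: rep_orb|exact: form1_pcone].
have sec0 : sec G x0 = 1%:M by exact: (sec_rep sG fG (form1_pcone R)).
have hT := @pairing_zero R G sG fG finG x0 hx0 I lam gi hi Ggi Ghi Hb T.
have pG x g : G g -> pcone x -> pcone (fact x g) by move=> Gg; apply: pcone_fact; exact: dG.
have secG x : pcone x -> G (sec G x) by move=> /(secP sG)[].
rewrite -[RHS]hT.
- have := pair_coboundary sG hx0 Ggi Ghi Hb beq => z0.
  transitivity (\sum_i dot (lam i) (c (gi i) (hi i)) -
     \sum_i dot (lam i) (b (tY x0 hi i) x0 - b (tX x0 gi hi i) x0 + b (tX x0 gi hi i) (tY x0 hi i))).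
    by rewrite z0 subr0.
  rewrite -sumrB; apply: eq_bigr => i _; rewrite /T /sphi /tX /tY.
  rewrite !(sec_fact sG fG) ?sec0 ?mul1mx //; last exact: GM.
  rewrite /f -mulmxA mulgV ?dG // mulmx1 invmx1 mulmx1 fact1.
  by rewrite /dot /=; ring.
- move=> x y z k hx hy hz Gk; rewrite /T /sphi !(sec_fact sG fG) // feq ?beq //; try exact: secG.
  by rewrite !factB factD factB.
- move=> x y z w hx hy hz hw; have := fcoc _ _ _ _ (secG _ hx) (secG _ hy) (secG _ hz) (secG _ hw).
  by rewrite /T /sphi; exact: cocycle_sub_boundary.
- by move=> x y z hx hy hz e; rewrite /T bline // subrr.
Qed.

(** The unknown cochain solves a linear system with one equation for each pair (g, h) and each
    linear form on V. The finite combinations of equations form a graph [D], single-valued by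
    [cocycle_pairing]; a functional [phi] extending it is defined on all functions of [b], and its
    values on coordinate evaluations are the coordinates of a solution. *)
Theorem h2_vanish : exists b : M2 -> V, forall g h, G g -> G h ->
  c g h = fact (b g) h + b h - b (g *m h).
Proof.
pose ch := (V * M2 * M2)%type.
pose okc (s : seq ch) := forall p, p \in s -> G p.1.2 /\ G p.2.
pose del (b : M2 -> V) g h := fact (b g) h + b h - b (g *m h).
pose row (s : seq ch) (b : M2 -> V) := \sum_(p <- s) dot p.1.1 (del b p.1.2 p.2).
pose rhs (s : seq ch) := \sum_(p <- s) dot p.1.1 (c p.1.2 p.2).
pose D : set (((M2 -> V) -> R) * R) := [set p | exists2 s, okc s & p = (row s, rhs s)].
have lD : linear_graph D.
  split.
  - exists [::]; first by [].
    by congr (_, _); [apply/funext => b; rewrite /row big_nil|rewrite /rhs big_nil].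
  - move=> _ _ _ _ [s os [-> ->]] [t ot [-> ->]]; exists (s ++ t).
      by move=> p; rewrite mem_cat => /orP[/os|/ot].
    by congr (_, _); [apply/funext => b; rewrite /row big_cat|rewrite /rhs big_cat].
  - move=> t _ _ [s os [-> ->]]; exists [seq (vscale t p.1.1, p.1.2, p.2) | p <- s].
      by move=> _ /mapP[p /os h ->].
    congr (_, _).
      apply/funext => b; rewrite /row big_map mulr_sumr; apply: eq_bigr => p _.
      by rewrite /dot /=; ring.
    rewrite /rhs big_map mulr_sumr; apply: eq_bigr => p _.
    by rewrite /dot /=; ring.
  - move=> r [s os [es ->]].
    pose tn := tnth (in_tuple s).
    rewrite /rhs big_tnth.
    apply: (cocycle_pairing (lam := fun i => (tn i).1.1) (gi := fun i => (tn i).1.2) (hi := fun i => (tn i).2)).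
    + by move=> i; have [] := os _ (mem_tnth i (in_tuple s)).
    + by move=> i; have [] := os _ (mem_tnth i (in_tuple s)).
    + by move=> b; have := congr1 (fun F => F b) es; rewrite /row big_tnth => <-.
have [phi [phiD phiZ phiE]] := linear_graph_extend lD.
pose ev (e : V) g : (M2 -> V) -> R := fun b => dot e (b g).
pose e1 : V := (1, 0, 0); pose e2 : V := (0, 1, 0); pose e3 : V := (0, 0, 1).
pose B g : V := (phi (ev e1 g), phi (ev e2 g), phi (ev e3 g)).
have evl e g : phi (ev e g) = dot e (B g).
  rewrite (_ : ev e g = (fun b => (e.1.1 * ev e1 g b + e.1.2 * ev e2 g b) + e.2 * ev e3 g b)).
    by rewrite !phiD !phiZ.
  by apply/funext => b; rewrite /ev /dot /e1 /e2 /e3 /=; ring.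
exists B => g h Gg Gh.
have key e : dot e (c g h) = dot e (del B g h).
  have : D (row [:: (e, g, h)], rhs [:: (e, g, h)]).
    by exists [:: (e, g, h)] => // p; rewrite inE => /eqP ->.
  move/phiE; rewrite /rhs big_seq1 /= => <-.
  pose e' := pull h e.
  rewrite (_ : row _ = (fun b => (ev e' g b + ev e h b) + -1 * ev e (g *m h) b)).
    transitivity (phi (ev e' g) + phi (ev e h) + -1 * phi (ev e (g *m h))).
      by rewrite (phiD (fun b => ev e' g b + ev e h b)) (phiD (ev e' g)) (phiZ _ (ev e (g *m h))).
    rewrite !evl /del /e' dot_pull /dot /=; ring.
  apply/funext => b; rewrite /row big_seq1 /ev /e' dot_pull /del /dot /=; ring.
have := key e1; have := key e2; have := key e3.
rewrite /dot /e1 /e2 /e3 /=; rewrite !mul0r !mul1r !add0r !addr0 => k3 k2 k1.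
exact: vec_eqP.
Qed.
End H2.

(** * Rational functions and differential operators *)

Section FieldIdentities.
Variable F : fieldType.

Lemma field_quotient_rule (n n' d d' q q' : F) : d != 0 ->
  (n' * d - n * d') / d ^+ 2 * q + n / d * q' = (n' * q + n * q' - n * q / d * d') / d.
Proof. by move=> d0; field. Qed.

Lemma field_pow_rule (x dx m X : F) : x != 0 ->
  dx * X + x * (m * X / x * dx) = (m + 1) * (x * X) / x * dx.
Proof. by move=> x0; field. Qed.

Lemma field_negpow_rule (x dx m X : F) : x != 0 -> X != 0 ->
  - (X^-1 * (m * X / x * dx)) = - m * X^-1 / x * dx * X.
Proof. by move=> x0 X0; field; rewrite ?x0 ?X0. Qed.

End FieldIdentities.

Section RationalFunctions.
Variable R : realType.
Local Notation C := (R[i]).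
Local Notation K := {fraction {poly C}}.
Local Notation M2 := 'M[R]_2.
Implicit Types (p q s t : {poly C}) (x y f : K) (g h : M2) (k : int).

HB.instance Definition _ := GRing.RMorphism.copy (@tof R) (@tofrac {poly C}).
HB.instance Definition _ := GRing.RMorphism.copy (@cK R) (@tof R \o polyC).

Lemma tof_eq0 p : (tof p == 0) = (p == 0).
Proof. exact: tofrac_eq0. Qed.

Lemma tof_inj : injective (@tof R).
Proof. by move=> p q /eqP; rewrite /tof tofrac_eq => /eqP. Qed.

Lemma repr_fracE x : x * tof \d_(repr x) = tof \n_(repr x).
Proof.
rewrite -{1}[x]reprK /tof; set r := repr x; unlock tofrac.
rewrite -[LHS]FracField.pi_mul; apply/eqmodP; rewrite /= FracField.equivfE /FracField.mulf.
by rewrite !numden_Ratio ?mulf_neq0 ?oner_neq0 ?denom_ratioP ?mulr1 ?(mulrC \d_r).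
Qed.

Lemma fracW x : exists p q, q != 0 /\ x * tof q = tof p.
Proof. by exists \n_(repr x), \d_(repr x); split; [exact: denom_ratioP|exact: repr_fracE]. Qed.

(** Frees [dK] from the representative chosen by [repr]: any fraction may be differentiated.
    [pbK_frac] does the same for the substitution. *)
Lemma dK_frac x p q : q != 0 -> x * tof q = tof p ->
  dK x * tof q + x * tof q^`() = tof p^`().
Proof.
move=> q0 e; rewrite /dK; set n := \n_(repr x); set d := \d_(repr x).
have d0 : tof d != 0 by rewrite tof_eq0; exact: denom_ratioP.
have xe : x = tof n / tof d by rewrite -[tof n]repr_fracE mulfK.
have E : n * q = p * d.
  by apply: tof_inj; rewrite !rmorphM /= -e xe [RHS]mulrAC divfK.
have := congr1 (@deriv _) E; rewrite !derivM => /(congr1 (@tof R)).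
rewrite !rmorphD !rmorphM /= => E'; move/(congr1 (@tof R)): E; rewrite !rmorphM => E.
have -> : tof p^`() = (tof n^`() * tof q + tof n * tof q^`() - tof p * tof d^`()) / tof d.
  by rewrite E' addrK mulfK.
have -> : tof p = tof n * tof q / tof d by rewrite E mulfK.
by rewrite xe; exact: field_quotient_rule.
Qed.

Lemma dKD : {morph (@dK R) : x y / x + y}.
Proof.
move=> x y; have [p [q [q0 e1]]] := fracW x; have [s [t [t0 e2]]] := fracW y.
have h1 := dK_frac q0 e1; have h2 := dK_frac t0 e2.
have qt : q * t != 0 by rewrite mulf_neq0.
have /(dK_frac qt) : (x + y) * tof (q * t) = tof (p * t + s * q).
  by rewrite rmorphD !rmorphM /= -e1 -e2; ring.
rewrite !derivD !derivM !rmorphD !rmorphM /= -h1 -h2 -e1 -e2 => h.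
apply: (mulIf (_ : tof q * tof t != 0)); first by rewrite mulf_neq0 ?tof_eq0.
by apply: (addIr ((x + y) * (tof q^`() * tof t + tof q * tof t^`()))); rewrite h; ring.
Qed.

Lemma dKM x y : dK (x * y) = dK x * y + x * dK y.
Proof.
have [p [q [q0 e1]]] := fracW x; have [s [t [t0 e2]]] := fracW y.
have h1 := dK_frac q0 e1; have h2 := dK_frac t0 e2.
have qt : q * t != 0 by rewrite mulf_neq0.
have /(dK_frac qt) : (x * y) * tof (q * t) = tof (p * s).
  by rewrite !rmorphM /= -e1 -e2; ring.
rewrite !derivM !rmorphD !rmorphM /= -h1 -h2 -e1 -e2 => h.
apply: (mulIf (_ : tof q * tof t != 0)); first by rewrite mulf_neq0 ?tof_eq0.
by apply: (addIr (x * y * (tof q^`() * tof t + tof q * tof t^`()))); rewrite h; ring.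
Qed.

Lemma dK_tof p : dK (tof p) = tof p^`().
Proof.
have := @dK_frac (tof p) p 1 (oner_neq0 _); rewrite rmorph1 mulr1 => /(_ erefl).
by rewrite derivC rmorph0 mulr0 addr0 mulr1.
Qed.

Lemma dK_cK (c : C) : dK (cK c) = 0 :> K.
Proof. by rewrite /cK dK_tof derivC rmorph0. Qed.

Lemma dK1 : @dK R 1 = 0.
Proof. by rewrite -(rmorph1 (@cK R)) dK_cK. Qed.

Lemma dKX x n : x != 0 -> dK (x ^+ n) = n%:R * x ^+ n / x * dK x.
Proof.
move=> x0; elim: n => [|n IH]; first by rewrite expr0 dK1 !mul0r.
by rewrite exprS dKM IH -natr1; exact: field_pow_rule.
Qed.

Lemma dKXz x k : x != 0 -> dK (x ^ k) = k%:~R * x ^ k / x * dK x.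
Proof.
move=> x0; case: k => n; first exact: dKX.
rewrite NegzE -exprnN mulrNz; set m := n.+1.
have xm : x ^+ m != 0 by rewrite expf_neq0.
have := congr1 (@dK R) (mulVf xm); rewrite (dKM (x ^- m)) (dKX m x0) dK1.
move/(canRL (addrK _)); rewrite sub0r -pmulrn => h.
by rewrite -[LHS](mulfK xm) h (field_negpow_rule (dK x) m%:R x0 xm) mulfK.
Qed.

Definition mobev g p : K := (map_poly (@cK R) p).[mobK g].

Lemma mobevD g p q : mobev g (p + q) = mobev g p + mobev g q.
Proof. by rewrite /mobev rmorphD hornerD. Qed.

Lemma mobevM g p q : mobev g (p * q) = mobev g p * mobev g q.
Proof. by rewrite /mobev rmorphM hornerM. Qed.

Lemma mobevC g c : mobev g c%:P = cK c.
Proof. by rewrite /mobev map_polyC hornerC. Qed.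

Lemma mobevX g : mobev g 'X = mobK g.
Proof. by rewrite /mobev map_polyX hornerX. Qed.

Lemma rC_eq0 (r : R) : (rC r == 0) = (r == 0).
Proof. by rewrite /rC eq_complex /= eqxx andbT. Qed.

Lemma lin_neq0 (c d : C) : (c != 0) || (d != 0) -> c *: 'X + d%:P != 0.
Proof.
apply: contraTneq => e; have := congr1 (fun p => p`_1) e; have := congr1 (fun p => p`_0) e.
rewrite !(coefD, coefZ, coefX, coefC) /= mulr0 mulr1 add0r addr0 => -> ->.
by rewrite eqxx.
Qed.

Lemma jK_neq0 g : \det g = 1 -> jK g != 0.
Proof.
move=> dg; rewrite /jK tof_eq0; apply: lin_neq0; rewrite !rC_eq0 -negb_and.
apply/negP => /andP[/eqP c0 /eqP d0]; move: dg; rewrite det2E c0 d0 !mulr0 subrr => /eqP.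
by rewrite eq_sym oner_eq0.
Qed.

Lemma rCM (u v : R) : rC (u * v) = rC u * rC v.
Proof. by rewrite /rC; simpc. Qed.

Lemma rCD (u v : R) : rC (u + v) = rC u + rC v.
Proof. by rewrite /rC; simpc. Qed.

Lemma rCN (u : R) : rC (- u) = - rC u.
Proof. by rewrite /rC; simpc. Qed.

(** As the complex numbers are algebraically closed, linear factors suffice; none of them becomes 0
    because a Moebius transformation with nonzero determinant is not constant. *)
Lemma mobev_neq0 g p : \det g = 1 -> p != 0 -> mobev g p != 0.
Proof.
move=> dg p0; have [rs e] := closed_field_poly_normal p.
rewrite e -mul_polyC mobevM mobevC mulf_neq0 //.
  by rewrite /cK tof_eq0 polyC_eq0 lead_coef_eq0.
elim: rs {e} => [|r rs IH]; first by rewrite big_nil mobevC rmorph1 oner_neq0.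
rewrite big_cons mobevM; apply: mulf_neq0; last exact: IH.
rewrite -polyCN mobevD mobevX mobevC.
have j0 := jK_neq0 dg.
apply/negP => /eqP /(congr1 ( *%R^~ (jK g))).
rewrite mul0r mulrDl /mobK (divfK j0) /jK /cK -!rmorphM -rmorphD => /eqP.
rewrite tof_eq0 mulrDr.
rewrite [X in X == 0](_ : _ = (rC (ga g) - r * rC (gc g)) *: 'X + (rC (gb g) - r * rC (gd g))%:P); last first.
  by rewrite -!mul_polyC !polyCB !polyCM polyCN; ring.
apply/negP; apply: lin_neq0; rewrite -negb_and !subr_eq0; apply/negP => /andP[/eqP ea /eqP eb].
have : rC (\det g) = 0 by rewrite det2E rCD rCN !rCM ea eb; ring.
by move/eqP; rewrite rC_eq0 dg oner_eq0.
Qed.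

Lemma pbK_frac g x p q : \det g = 1 -> q != 0 -> x * tof q = tof p ->
  pbK g x * mobev g q = mobev g p.
Proof.
move=> dg q0 e; rewrite /pbK -!/(mobev _ _); set n := \n_(repr x); set d := \d_(repr x).
have d0 : d != 0 := denom_ratioP _.
have : n * q = p * d.
  by apply: tof_inj; rewrite !rmorphM /= -e -[tof n]repr_fracE -/d; ring.
move/(congr1 (mobev g)); rewrite !mobevM => E.
by rewrite mulrAC E mulfK // mobev_neq0.
Qed.

Lemma pbK_tof g p : \det g = 1 -> pbK g (tof p) = mobev g p.
Proof.
move=> dg; have := @pbK_frac g (tof p) p 1 dg (oner_neq0 _); rewrite rmorph1 mulr1 => /(_ erefl).
by rewrite (mobevC g 1) rmorph1 mulr1.
Qed.

Lemma pbK_morph g : \det g = 1 -> {phi : {rmorphism K -> K} | phi =1 pbK g}.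
Proof.
move=> dg.
have pB : zmod_morphism (pbK g).
  move=> x y; have [p [q [q0 e1]]] := fracW x; have [s [t [t0 e2]]] := fracW y.
  have qt : q * t != 0 by rewrite mulf_neq0.
  have /(pbK_frac dg qt) : (x - y) * tof (q * t) = tof (p * t + (- s) * q).
    by rewrite rmorphD !rmorphM rmorphN /= -e1 -e2; ring.
  rewrite mobevD !mobevM (_ : mobev g (- s) = - mobev g s); last first.
    by rewrite -mulN1r -polyCN mobevM mobevC rmorphN1 mulN1r.
  rewrite -(pbK_frac dg q0 e1) -(pbK_frac dg t0 e2) => h.
  apply: (mulIf (_ : mobev g q * mobev g t != 0)); first by rewrite mulf_neq0 ?mobev_neq0.
  by rewrite h; ring.
have pM : monoid_morphism (pbK g).
  split; first by rewrite -(rmorph1 (@tof R)) pbK_tof // (mobevC g 1) rmorph1.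
  move=> x y; have [p [q [q0 e1]]] := fracW x; have [s [t [t0 e2]]] := fracW y.
  have qt : q * t != 0 by rewrite mulf_neq0.
  have /(pbK_frac dg qt) : (x * y) * tof (q * t) = tof (p * s).
    by rewrite !rmorphM /= -e1 -e2; ring.
  rewrite !mobevM -(pbK_frac dg q0 e1) -(pbK_frac dg t0 e2) => h.
  apply: (mulIf (_ : mobev g q * mobev g t != 0)); first by rewrite mulf_neq0 ?mobev_neq0.
  by rewrite h; ring.
pose phi : {rmorphism K -> K} := HB.pack (pbK g)
  (GRing.isZmodMorphism.Build _ _ (pbK g) pB) (GRing.isMonoidMorphism.Build _ _ (pbK g) pM).
by exists phi.
Qed.

Lemma rmorph_frac_ext (phi psi : {rmorphism K -> K}) :
  (forall c, phi (cK c) = psi (cK c)) -> phi (tof 'X) = psi (tof 'X) -> phi =1 psi.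
Proof.
move=> hc hX.
have hp p : phi (tof p) = psi (tof p).
  elim/poly_ind: p => [|p c IH]; first by rewrite !rmorph0.
  by rewrite !rmorphD !rmorphM /= IH hX hc.
move=> x; have [p [q [q0 e]]] := fracW x.
have q1 : psi (tof q) != 0 by rewrite fmorph_eq0 tof_eq0.
by apply: (mulIf q1); rewrite -{1}hp -!rmorphM e hp.
Qed.

Lemma pbK_cK g c : \det g = 1 -> pbK g (cK c) = cK c.
Proof. by move=> dg; rewrite /cK pbK_tof // mobevC. Qed.

Lemma pbK_X g : \det g = 1 -> pbK g (tof 'X) = mobK g.
Proof. by move=> dg; rewrite pbK_tof // mobevX. Qed.

Lemma tof_lin (c d : C) : tof (c *: 'X + d%:P) = cK c * tof 'X + cK d.
Proof. by rewrite rmorphD -mul_polyC rmorphM. Qed.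

Lemma mobKE g : \det g = 1 ->
  mobK g * (cK (rC (gc g)) * tof 'X + cK (rC (gd g))) = cK (rC (ga g)) * tof 'X + cK (rC (gb g)).
Proof. by move=> dg; rewrite -!tof_lin /mobK divfK // jK_neq0. Qed.

Lemma jKE g : jK g = cK (rC (gc g)) * tof 'X + cK (rC (gd g)).
Proof. exact: tof_lin. Qed.

Lemma det_mul1 g h : \det g = 1 -> \det h = 1 -> \det (g *m h) = 1.
Proof. by move=> dg dh; rewrite det_mulmx dg dh mulr1. Qed.

Lemma jK_mul g h : \det g = 1 -> \det h = 1 -> jK (g *m h) = pbK h (jK g) * jK h.
Proof.
move=> dg dh; have [phi e] := pbK_morph dh; rewrite -e (jKE g) rmorphD rmorphM !e !pbK_cK // pbK_X //.
have e2 := mobKE dh; rewrite -jKE in e2; rewrite mulrDl -(mulrA _ (mobK h)) e2 !jKE.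
have [_ _ -> ->] := mul2E g h; rewrite !rCD !rCM !rmorphD !rmorphM; ring.
Qed.

Lemma mobK_mul g h : \det g = 1 -> \det h = 1 -> mobK (g *m h) = pbK h (mobK g).
Proof.
move=> dg dh; have dgh := det_mul1 dg dh.
apply: (mulIf (jK_neq0 dgh)); rewrite {2}jK_mul // mulrA.
rewrite {1}jKE mobKE //; have [phi e] := pbK_morph dh; rewrite -!e -rmorphM jKE mobKE //.
rewrite rmorphD rmorphM !e !pbK_cK // pbK_X //.
have e2 := mobKE dh; rewrite -jKE in e2; rewrite mulrDl -(mulrA _ (mobK h)) e2 !jKE.
have [-> -> _ _] := mul2E g h; rewrite !rCD !rCM !rmorphD !rmorphM; ring.
Qed.

Lemma pbK_mul g h x : \det g = 1 -> \det h = 1 -> pbK (g *m h) x = pbK h (pbK g x).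
Proof.
move=> dg dh; have dgh := det_mul1 dg dh.
have [phi e1] := pbK_morph dg; have [psi e2] := pbK_morph dh; have [chi e3] := pbK_morph dgh.
rewrite -e1 -e2 -e3.
apply: (@rmorph_frac_ext chi (psi \o phi : {rmorphism K -> K})) => /= [c|].
  by rewrite e1 e2 e3 !pbK_cK.
by rewrite e1 e2 e3 !pbK_X // mobK_mul.
Qed.

Lemma det_1 : \det (1%:M : M2) = 1. Proof. exact: det1. Qed.

Lemma jK1 : jK (1%:M : M2) = 1.
Proof.
by rewrite jKE /gc /gd !mxE /= (rmorph0 (@cK R)) mul0r add0r (rmorph1 (@cK R)).
Qed.

Lemma pbK1 x : pbK (1%:M : M2) x = x.
Proof.
have [phi e] := pbK_morph det_1; rewrite -e.
apply: (@rmorph_frac_ext phi (idfun : {rmorphism K -> K})) => /= [c|]; rewrite e.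
  by rewrite pbK_cK // det_1.
rewrite pbK_X ?det_1 // /mobK jK1 divr1 /ga /gb !mxE /= addr0.
by rewrite (_ : rC 1 = 1) // scale1r.
Qed.

Lemma dK_mobK g : \det g = 1 -> dK (mobK g) = jK g ^- 2.
Proof.
move=> dg; have j0 := jK_neq0 dg; have := mobKE dg; rewrite -jKE => e.
move: (mobK g) e => m e.
have /(congr1 (@dK R)) := e; rewrite dKM {2}jKE !dKD !dKM !dK_cK (dK_tof 'X) derivX rmorph1.
rewrite !mul0r !add0r !addr0 !mulr1 => h.
have h2 : dK (m) * jK g ^+ 2 = 1.
  rewrite expr2 mulrA (_ : dK (m) * jK g = cK (rC (ga g)) - m * cK (rC (gc g))).
    rewrite mulrBl mulrAC e jKE -(rmorph1 (@cK R)) -[1](_ : rC (\det g) = 1); last by rewrite dg.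
    by rewrite det2E rCD rCN !rCM rmorphD rmorphN !rmorphM; ring.
  by rewrite -h addrK.
by apply: (mulIf (expf_neq0 2 j0)); rewrite h2 (mulVf (expf_neq0 2 j0)).
Qed.

Lemma dK_pbK g x : \det g = 1 -> dK (pbK g x) = jK g ^- 2 * pbK g (dK x).
Proof.
move=> dg; rewrite -dK_mobK //.
have hp p : dK (mobev g p) = dK (mobK g) * mobev g p^`().
  elim/poly_ind: p => [|p c IH].
    by rewrite (mobevC g 0) deriv0 (mobevC g 0) rmorph0 mulr0 -(rmorph0 (@cK R)) dK_cK.
  rewrite mobevD mobevM mobevC mobevX dKD dKM dK_cK IH derivMXaddC mobevD mobevM mobevX; ring.
have [p [q [q0 e]]] := fracW x; have [phi ephi] := pbK_morph dg.
have h1 := pbK_frac dg q0 e.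
have := congr1 (@dK R) h1; rewrite dKM !hp => h2.
have h0 := dK_frac q0 e; move: (dK x) h0 => y h0.
have := congr1 phi h0; rewrite rmorphD !rmorphM !ephi !pbK_tof // => h3.
apply: (mulIf (mobev_neq0 dg q0)).
apply: (addIr (pbK g x * (dK (mobK g) * mobev g q^`()))); by rewrite h2 -h3; ring.
Qed.

End RationalFunctions.

(** * The operators of d_k and the slash action *)

Section Operators.
Variables (R : realType) (k : int).
Local Notation C := (R[i]).
Local Notation K := {fraction {poly C}}.
Local Notation M2 := 'M[R]_2.
Local Notation V := (R * R * R)%type.
Implicit Types (p q : {poly C}) (f w : K) (g h : M2) (x y : V).

Lemma tofD p q : tof (p + q) = tof p + tof q. Proof. exact: rmorphD. Qed.
Lemma tofN p : tof (- p) = - tof p. Proof. exact: rmorphN. Qed.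
Lemma tofM p q : tof (p * q) = tof p * tof q. Proof. exact: rmorphM. Qed.
Lemma tof1 : tof 1 = 1 :> K. Proof. exact: rmorph1. Qed.
Lemma tof0 : tof 0 = 0 :> K. Proof. exact: rmorph0. Qed.

(** The weight k action on functions; together with its inverse [untwist] it exhibits the slash
    action on operators as a conjugation. *)
Definition twist g f := jK g ^ (- k) * pbK g f.
Definition untwist g f := pbK (invmx g) (jK g ^ k * f).

Lemma slashOpE (A : Op R) g f : slashOp k A g f = twist g (A (untwist g f)).
Proof. by []. Qed.

Lemma det_invmx1 g : \det g = 1 -> \det (invmx g) = 1.
Proof. by move=> dg; rewrite det_inv dg invr1. Qed.

Lemma pbKD g f w : \det g = 1 -> pbK g (f + w) = pbK g f + pbK g w.
Proof. by move=> dg; have [phi e] := pbK_morph dg; rewrite -!e rmorphD. Qed.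

Lemma pbKM g f w : \det g = 1 -> pbK g (f * w) = pbK g f * pbK g w.
Proof. by move=> dg; have [phi e] := pbK_morph dg; rewrite -!e rmorphM. Qed.

Lemma pbKXz g f (m : int) : \det g = 1 -> pbK g (f ^ m) = pbK g f ^ m.
Proof. by move=> dg; have [phi e] := pbK_morph dg; rewrite -!e fmorphXz. Qed.

Lemma pbKV g f : \det g = 1 -> pbK (invmx g) (pbK g f) = f.
Proof. by move=> dg; rewrite -pbK_mul ?det_invmx1 // mulgV // pbK1. Qed.

Lemma pbVK g f : \det g = 1 -> pbK g (pbK (invmx g) f) = f.
Proof. by move=> dg; rewrite -pbK_mul ?det_invmx1 // mulVg // pbK1. Qed.

Lemma jKz_neq0 g (m : int) : \det g = 1 -> jK g ^ m != 0.
Proof. by move=> dg; apply: expfz_neq0; exact: jK_neq0. Qed.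

Lemma twistD g f w : \det g = 1 -> twist g (f + w) = twist g f + twist g w.
Proof. by move=> dg; rewrite /twist pbKD // mulrDr. Qed.

Lemma untwistD g f w : \det g = 1 -> untwist g (f + w) = untwist g f + untwist g w.
Proof. by move=> dg; rewrite /untwist mulrDr pbKD // det_invmx1. Qed.

Lemma twistK g f : \det g = 1 -> untwist g (twist g f) = f.
Proof.
move=> dg; rewrite /untwist /twist mulrA -invr_expz divff ?jKz_neq0 // mul1r; exact: pbKV.
Qed.

Lemma untwistK g f : \det g = 1 -> twist g (untwist g f) = f.
Proof.
by move=> dg; rewrite /untwist /twist pbVK // mulrA -invr_expz mulVf ?jKz_neq0 // mul1r.
Qed.

Lemma twist_mul g h f : \det g = 1 -> \det h = 1 ->
  twist (g *m h) f = twist h (twist g f).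
Proof.
move=> dg dh; rewrite /twist pbKM // pbKXz // -pbK_mul // jK_mul //.
by rewrite expfzMl -mulrA mulrCA.
Qed.

Lemma untwist_mul g h f : \det g = 1 -> \det h = 1 ->
  untwist (g *m h) f = untwist g (untwist h f).
Proof.
move=> dg dh; have dgh := det_mul1 dg dh.
rewrite -[RHS](twistK _ dgh); congr untwist.
by rewrite twist_mul // !untwistK.
Qed.

Lemma opdDl p q f : opd k (p + q) f = opd k p f + opd k q f.
Proof. by rewrite /opd derivD !tofD; ring. Qed.

Lemma opdNl p f : opd k (- p) f = - opd k p f.
Proof. by rewrite /opd derivN !tofN; ring. Qed.

Lemma opdZl c p f : opd k (c *: p) f = cK c * opd k p f.
Proof.
rewrite /opd derivZ -!mul_polyC !tofM.
rewrite -[tof c%:P]/(cK c); ring.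
Qed.

Lemma opdD p f w : opd k p (f + w) = opd k p f + opd k p w.
Proof. by rewrite /opd dKD; ring. Qed.

Lemma natK_neq0 m : (m.+1%:R : K) != 0.
Proof.
by rewrite -(rmorph_nat (@cK R)) fmorph_eq0 pnatr_eq0.
Qed.

(** The test functions 1 and tau recover the polynomial from the operator, also for k = 0, when the
    term in p' is absent. *)
Lemma opd_inj p q : opd k p = opd k q -> p = q.
Proof.
move=> e; apply/subr0_eq.
have {}e f : opd k (p - q) f = 0 by rewrite opdDl opdNl e subrr.
set r := p - q in e *.
have := e 1; have := e (tof 'X); rewrite /opd dK1 (dK_tof 'X) derivX tof1.
rewrite (mulr1 (2%:R * _)) mulr0 add0r (mulr1 (k%:~R * _)) => h1 h2; move: h1; rewrite h2 mul0r addr0 => /(congr1 ( *%R 2%:R^-1)).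
rewrite mulr0 mulKf ?natK_neq0 // => h; apply: (@tof_inj R); by rewrite h tof0.
Qed.

Lemma dK_natz f (m : int) : dK (m%:~R * f) = m%:~R * dK f.
Proof. by rewrite dKM -(rmorph_int (@cK R)) dK_cK mul0r add0r. Qed.

Lemma dK_opd q f : dK (opd k q f) = 2%:R * (tof q^`() * dK f + tof q * dK (dK f)) +
  k%:~R * (tof q^`()^`() * f + tof q^`() * dK f).
Proof.
rewrite /opd dKD -!mulrA (dK_natz _ 2) dK_natz.
by move: (dK f) (dKM (tof q^`()) f) => w ->; rewrite (dKM (tof q) w) !dK_tof.
Qed.

Lemma opd_bracket p q f :
  opd k p (opd k q f) - opd k q (opd k p f) = opd k ((p * q^`() - p^`() * q) *+ 2) f.
Proof.
rewrite {1 3}/opd !dK_opd /opd mulr2n !derivD derivN !derivM.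
rewrite !tofD !tofN !tofD !tofM.
move: (dK (dK f)) (dK f) (tof p) (tof q) (tof _) (tof _) (tof _) (tof _) => ? ? ? ? ? ? ? ?.
ring.
Qed.

End Operators.

Lemma field_slash_rule (F : fieldType) (two kk P P1 j J c f df : F) : j != 0 -> J != 0 ->
  J^-1 * (two * P * (j ^+ 2 * (kk * J / j * c * f + J * df)) + kk * P1 * (J * f)) =
  two * (j ^+ 2 * P) * df + kk * (two * j * c * P + P1) * f.
Proof. by move=> j0 J0; field; rewrite ?j0 ?J0. Qed.

Section Slash.
Variables (R : realType) (k : int).
Local Notation C := (R[i]).
Local Notation K := {fraction {poly C}}.
Local Notation M2 := 'M[R]_2.
Local Notation V := (R * R * R)%type.
Implicit Types (p q : {poly C}) (f w : K) (g h : M2) (x y : V).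

Lemma dK_slash_poly g p p1 : \det g = 1 -> tof p1 = jK g ^+ 2 * pbK g (tof p) ->
  tof p1^`() = 2%:R * jK g * dK (jK g) * pbK g (tof p) + pbK g (tof p^`()).
Proof.
move=> dg e; have j0 := jK_neq0 dg; have := congr1 (@dK R) e.
rewrite dK_tof (dKM (jK g ^+ 2)) dK_pbK // (dK_tof p) (dKM (jK g) (jK g)) => ->.
rewrite (mulVKf (expf_neq0 2 j0)); congr (_ + _).
by rewrite (mulrC (dK _)) -mulr2n -(mulr_natl (jK g * _)) mulrA.
Qed.

(** Conjugation transforms the polynomial by the weight -2 action p |-> j^2 p(g tau); the term k p'
    absorbs the derivative of the factor j^k. *)
Lemma opd_slash g p p1 f : \det g = 1 -> tof p1 = jK g ^+ 2 * pbK g (tof p) ->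
  slashOp k (opd k p) g f = opd k p1 f.
Proof.
move=> dg e; rewrite slashOpE; have j0 := jK_neq0 dg; have J0 := jKz_neq0 k dg.
have e2 : pbK g (untwist k g f) = jK g ^ k * f by rewrite /untwist pbVK.
move: (untwist k g f) e2 => u e2.
have e3 : pbK g (dK u) = jK g ^+ 2 * (k%:~R * jK g ^ k / jK g * dK (jK g) * f + jK g ^ k * dK f).
  have h := dK_pbK u dg; rewrite e2 (dKM (jK g ^ k)) (dKXz k j0) in h.
  exact: (esym (canLR (mulVKf (expf_neq0 2 j0)) h)).
have := field_slash_rule 2%:R k%:~R (pbK g (tof p)) (pbK g (tof p^`())) (dK (jK g)) f (dK f) j0 J0.
rewrite -(dK_slash_poly dg e) -e -/(opd k p1 f) => <-.
rewrite /twist -invr_expz; congr (_ * _); rewrite -e3 -e2.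
have [phi ephi] := pbK_morph dg; rewrite -!ephi /opd.
by move: (dK u) => v; rewrite rmorphD !rmorphM rmorph_nat rmorph_int.
Qed.

Lemma size_quad (A B D : C) : (size (A *: 'X^2 + B *: 'X + D%:P)%R <= 3)%N.
Proof.
apply/leq_sizeP => i hi; rewrite !(coefD, coefZ, coefX, coefC, coefXn).
by rewrite !gtn_eqF ?mulr0 ?addr0 //; lia.
Qed.

(** Coefficients are split into real and imaginary vectors, on which the real matrices of the group
    act separately. *)
Definition cquad x y : {poly C} := Complex x.1.1 y.1.1 *: 'X^2 +
  Complex x.1.2 y.1.2 *: 'X + (Complex x.2 y.2)%:P.

Lemma cquad_coef x y : [/\ (cquad x y)`_2 = Complex x.1.1 y.1.1,
  (cquad x y)`_1 = Complex x.1.2 y.1.2 & (cquad x y)`_0 = Complex x.2 y.2].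
Proof.
by split; rewrite !(coefD, coefZ, coefX, coefC, coefXn) /= ?mulr1 ?mulr0 ?add0r ?addr0.
Qed.

Lemma size_cquad x y : (size (cquad x y) <= 3)%N.
Proof. exact: size_quad. Qed.

Lemma cquadP p : (size p <= 3)%N -> exists x y, p = cquad x y.
Proof.
move=> sp; exists (complex.Re p`_2, complex.Re p`_1, complex.Re p`_0),
  (complex.Im p`_2, complex.Im p`_1, complex.Im p`_0).
apply/polyP => i; have [e2 e1 e0] := cquad_coef (complex.Re p`_2, complex.Re p`_1, complex.Re p`_0)
  (complex.Im p`_2, complex.Im p`_1, complex.Im p`_0).
case: i => [|[|[|i]]]; rewrite ?e2 ?e1 ?e0 //=; try by case: (p`__).
have hi : (3 <= i.+3)%N by [].
by rewrite (nth_default _ (leq_trans sp hi)) (nth_default _ (leq_trans (size_cquad _ _) hi)).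
Qed.

Lemma cquadD x y x' y' : cquad (x + x') (y + y') = cquad x y + cquad x' y'.
Proof.
apply/polyP => i; rewrite !(coefD, coefZ, coefX, coefC, coefXn).
case: i => [|[|[|i]]] /=; rewrite ?mulr1 ?mulr0 ?add0r ?addr0 //.
Qed.

Lemma cquadN x y : cquad (- x) (- y) = - cquad x y.
Proof.
apply/polyP => i; rewrite !(coefD, coefN, coefZ, coefX, coefC, coefXn).
case: i => [|[|[|i]]] /=; rewrite ?mulr1 ?mulr0 ?add0r ?addr0 ?oppr0 //.
Qed.

Lemma cquad_inj x y x' y' : cquad x y = cquad x' y' -> x = x' /\ y = y'.
Proof.
move=> e; have [a2 a1 a0] := cquad_coef x y; have [b2 b1 b0] := cquad_coef x' y'.
move: a2 a1 a0 b2 b1 b0; rewrite e => -> -> -> [? ?] [? ?] [? ?].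
by split; apply: vec_eqP.
Qed.

Lemma cfact g x y : let rx := fact x g in let ry := fact y g in
  let A := Complex x.1.1 y.1.1 in let B := Complex x.1.2 y.1.2 in let D := Complex x.2 y.2 in
  let a := rC (ga g) in let b := rC (gb g) in let c := rC (gc g) in let d := rC (gd g) in
  [/\ Complex rx.1.1 ry.1.1 = A * (a * a) + B * (a * c) + D * (c * c),
      Complex rx.1.2 ry.1.2 = A * (a * b + a * b) + B * (a * d + b * c) + D * (c * d + c * d) &
      Complex rx.2 ry.2 = A * (b * b) + B * (b * d) + D * (d * d)].
Proof. by rewrite /rC /=; split; simpc; congr Complex; ring. Qed.

Lemma cquad_slash g x y : \det g = 1 ->
  tof (cquad (fact x g) (fact y g)) = jK g ^+ 2 * pbK g (tof (cquad x y)).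
Proof.
move=> dg; have j0 := jK_neq0 dg.
have -> : pbK g (tof (cquad x y)) = cK (Complex x.1.1 y.1.1) * mobK g ^+ 2 +
   cK (Complex x.1.2 y.1.2) * mobK g + cK (Complex x.2 y.2).
  by rewrite pbK_tof // /cquad -!mul_polyC !mobevD !mobevM !mobevC !mobevX.
have aux (A B D m j : K) : j ^+ 2 * (A * m ^+ 2 + B * m + D) =
  A * (m * j) ^+ 2 + B * (m * j) * j + D * j ^+ 2 by ring.
have e := mobKE dg; rewrite -jKE in e; rewrite aux e.
rewrite /cquad -!mul_polyC !tofD !tofM -![tof _%:P]/(cK _) jKE /=.
have [-> -> ->] := cfact g x y.
move: (Complex _ _) (Complex _ _) (Complex _ _) (rC _) (rC _) (rC _) (rC _) => A B D a b c d.
have cKD u v : cK (u + v) = cK u + cK v :> K by exact: rmorphD.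
have cKM u v : cK (u * v) = cK u * cK v :> K by exact: rmorphM.
rewrite !(cKD, cKM).
move: (cK A) (cK B) (cK D) (cK a) (cK b) (cK c) (cK d) (tof 'X) => ? ? ? ? ? ? ? ?.
ring.
Qed.

Lemma quadP p : (size p <= 3)%N -> p = p`_2 *: 'X^2 + p`_1 *: 'X + (p`_0)%:P.
Proof.
move=> sp; apply/polyP => i; rewrite !(coefD, coefZ, coefX, coefC, coefXn).
case: i => [|[|[|i]]] /=; rewrite ?mulr1 ?mulr0 ?add0r ?addr0 //.
by rewrite nth_default // (leq_trans sp).
Qed.

Definition dop x y : Op R := opd k (cquad x y).

Lemma in_dkP (A : Op R) : in_dk k A <-> exists x y, A = dop x y.
Proof.
split=> [[p /cquadP[x [y ->]] ->]|[x [y ->]]]; first by exists x, y.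
by exists (cquad x y) => //; exact: size_cquad.
Qed.

Lemma dopD x y x' y' f : dop (x + x') (y + y') f = dop x y f + dop x' y' f.
Proof. by rewrite /dop cquadD opdDl. Qed.

Lemma dopN x y f : dop (- x) (- y) f = - dop x y f.
Proof. by rewrite /dop cquadN opdNl. Qed.

Lemma dop_inj x y x' y' : dop x y = dop x' y' -> x = x' /\ y = y'.
Proof. by move=> /opd_inj /cquad_inj. Qed.

Lemma dop_slash g x y f : \det g = 1 -> slashOp k (dop x y) g f = dop (fact x g) (fact y g) f.
Proof. by move=> dg; apply: opd_slash => //; exact: cquad_slash. Qed.

Lemma in_dk0 : in_dk k (fun _ : K => 0).
Proof.
exists 0; first by rewrite size_poly0.
by apply/funext => f; rewrite /opd deriv0 tof0 !mulr0 !mul0r addr0.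
Qed.

Lemma in_dkD (A B : Op R) : in_dk k A -> in_dk k B -> in_dk k (fun f => A f + B f).
Proof.
move=> [p sp ->] [q sq ->]; exists (p + q).
  by rewrite (leq_trans (size_polyD _ _)) // geq_max sp.
by apply/funext => f; rewrite opdDl.
Qed.

Lemma in_dkN (A : Op R) : in_dk k A -> in_dk k (fun f => - A f).
Proof.
move=> [p sp ->]; exists (- p); first by rewrite size_polyN.
by apply/funext => f; rewrite opdNl.
Qed.

Lemma in_dkZ c (A : Op R) : in_dk k A -> in_dk k (fun f => cK c * A f).
Proof.
move=> [p sp ->]; exists (c *: p); first by rewrite (leq_trans (size_scale_leq _ _)).
by apply/funext => f; rewrite opdZl.
Qed.

(** The cubic terms of p q' - p' q cancel, so the degree stays at most 2. *)
Lemma in_dk_bracket (A B : Op R) : in_dk k A -> in_dk k B ->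
  in_dk k (fun f => A (B f) - B (A f)).
Proof.
move=> [p sp ->] [q sq ->]; exists ((p * q^`() - p^`() * q) *+ 2); last first.
  by apply/funext => f; rewrite opd_bracket.
have aux (a b c a' b' c' : C) : let u := a *: 'X^2 + b *: 'X + c%:P in
    let v := a' *: 'X^2 + b' *: 'X + c'%:P in
    (u * v^`() - u^`() * v) *+ 2 = (b * a' - a * b') *+ 2 *: 'X^2 +
      (c * a' - a * c') *+ 4 *: 'X + ((c * b' - b * c') *+ 2)%:P.
  rewrite /= !derivD !derivZ derivXn derivX !derivC /= expr1 -!mul_polyC.
  by rewrite !polyCMn !polyCB !polyCM; ring.
by rewrite (quadP sp) (quadP sq) aux size_quad.
Qed.

Lemma in_dk_slash g (A : Op R) : \det g = 1 -> in_dk k A -> in_dk k (slashOp k A g).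
Proof.
move=> dg /in_dkP[x [y ->]]; apply/in_dkP; exists (fact x g), (fact y g).
by apply/funext => f; exact: dop_slash.
Qed.

Lemma in_dk_add (A : Op R) f w : in_dk k A -> A (f + w) = A f + A w.
Proof. by move=> [p _ ->]; exact: opdD. Qed.

End Slash.

(** * Lifting cocycles in a filtered ring *)

Section Filtered.
Variables (A : pzRingType) (I : nat -> A -> Prop).
Implicit Types (x y z : A).
Hypothesis I0 : forall x, I 0 x.
Hypothesis ID : forall n x y, I n x -> I n y -> I n (x + y).
Hypothesis IN : forall n x, I n x -> I n (- x).
Hypothesis IM : forall m n x y, I m x -> I n y -> I (m + n) (x * y).
Hypothesis IS : forall n x, I n.+1 x -> I n x.
Hypothesis Isep : forall x, (forall n, I n x) -> x = 0.

Definition cong n x y := I n (x - y).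

Lemma Ile m n x : (m <= n)%N -> I n x -> I m x.
Proof.
move=> /subnK <-; elim: (n - m)%N => // k IH; rewrite addSn => /IS; exact: IH.
Qed.

Lemma IMl n x z : I n x -> I n (z * x).
Proof. by move=> /(IM (I0 z)). Qed.

Lemma IMr n x z : I n x -> I n (x * z).
Proof. by move=> /IM/(_ (I0 z)); rewrite addn0. Qed.

Lemma cong_sym n x y : cong n x y -> cong n y x.
Proof. by move=> /IN; rewrite opprB. Qed.

Lemma cong_trans n x y z : cong n x y -> cong n y z -> cong n x z.
Proof. by move=> h1 /(ID h1); rewrite addrA subrK. Qed.

Lemma congD n x y x' y' : cong n x y -> cong n x' y' -> cong n (x + x') (y + y').
Proof. by move=> h1 /(ID h1); rewrite addrACA -opprD. Qed.

Lemma congN n x y : cong n x y -> cong n (- x) (- y).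
Proof. by move=> /IN; rewrite opprD. Qed.

Lemma congMl n x y z : cong n x y -> cong n (z * x) (z * y).
Proof. by move=> /(IM (I0 z)); rewrite add0n mulrBr. Qed.

Lemma congMr n x y z : cong n x y -> cong n (x * z) (y * z).
Proof. by move=> /IM/(_ (I0 z)); rewrite addn0 mulrBl. Qed.

Lemma congM n x y x' y' : cong n x y -> cong n x' y' -> cong n (x * x') (y * y').
Proof. by move=> h1 h2; apply: cong_trans (congMr _ h1) (congMl _ h2). Qed.

Lemma cong_le m n x y : (m <= n)%N -> cong n x y -> cong m x y.
Proof. exact: Ile. Qed.

Hypothesis I00 : forall n, I n 0.

Lemma cong_refl n x : cong n x x.
Proof. by rewrite /cong subrr. Qed.

Lemma cong_eq x y : (forall n, cong n x y) -> x = y.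
Proof. by move=> h; apply/eqP; rewrite -subr_eq0; apply/eqP/Isep. Qed.

Lemma Isum n (J : Type) (s : seq J) (F : J -> A) : (forall j, I n (F j)) ->
  I n (\sum_(j <- s) F j).
Proof. by move=> h; apply: big_ind => //; exact: ID. Qed.

Lemma I_exp n m x : I n x -> I (n * m) (x ^+ m).
Proof.
move=> h; elim: m => [|m IH]; first by rewrite muln0; exact: I0.
by rewrite exprS mulnS; exact: IM.
Qed.

(** The inverse of m!, given as a central element of the ring, so that exponentials make sense
    without a field of scalars. *)
Variable q : nat -> A.
Hypothesis qC : forall m x, q m * x = x * q m.
Hypothesis qP : forall m, q m *+ m`! = 1.

Lemma q_bin m i : (i <= m)%N -> q m *+ 'C(m, i) = q (m - i)%N * q i.
Proof.
move=> im.
have e : (q (m - i)%N * q i) *+ ((m - i)`! * i`!) = 1.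
  by rewrite mulrnA -mulrnAl -mulrnAr !qP mulr1.
transitivity ((q m *+ 'C(m, i)) * ((q (m - i)%N * q i) *+ ((m - i)`! * i`!))).
  by rewrite e mulr1.
transitivity ((q m *+ m`!) * (q (m - i)%N * q i)); last by rewrite qP mul1r.
rewrite !mulrnAl mulrnAr -mulrnA; congr (_ *+ _).
by rewrite -(bin_fact im) mulnC [(_ * i`!)%N]mulnC.
Qed.

Lemma triangle (F : nat -> nat -> A) N :
  \sum_(j < N) \sum_(i < (N - j)%N) F j i = \sum_(m < N) \sum_(i < m.+1) F (m - i)%N i.
Proof.
elim: N => [|N IH]; first by rewrite !big_ord0.
rewrite big_ord_recr [RHS]big_ord_recr /= -IH subSnn big_ord_recl big_ord0 addr0.
transitivity (\sum_(j < N) \sum_(i < (N - j)%N) F j i + (\sum_(j < N) F j (N - j)%N + F N 0)).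
  rewrite addrA; congr (_ + _); rewrite -big_split /=; apply: eq_bigr => j _.
  by rewrite subSn ?big_ord_recr //= ltnW.
congr (_ + _).
rewrite (reindex_inj rev_ord_inj) /= [RHS]big_ord_recl subn0 addrC; congr (_ + _).
by apply: eq_bigr => j _; rewrite subKn.
Qed.

Lemma product_trunc (a b : nat -> A) N : (forall i, I i (a i)) -> (forall i, I i (b i)) ->
  cong N ((\sum_(j < N) a j) * (\sum_(i < N) b i)) (\sum_(m < N) \sum_(i < m.+1) a (m - i)%N * b i).
Proof.
move=> ha hb; rewrite -(triangle (fun j i => a j * b i)) mulr_suml /cong -sumrB.
apply: Isum => j; rewrite mulr_sumr.
have jN : (N - j <= N)%N by rewrite leq_subr.
have -> : \sum_(i < N) a j * b i = \sum_(i < (N - j)%N) a j * b i + \sum_(N - j <= i < N) a j * b i.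
  by rewrite -!(big_mkord xpredT (fun i => a j * b i)) (big_cat_nat (leq0n _) jN).
rewrite addrAC subrr add0r big_seq; apply: big_ind => //; first exact: ID.
move=> i; rewrite mem_index_iota => /andP[ij _].
by apply: (@Ile _ (j + i)); [rewrite -leq_subLR|exact: IM].
Qed.

Definition etrunc N x := \sum_(m < N) q m * x ^+ m.

Lemma I_term x m : I 1 x -> I m (q m * x ^+ m).
Proof. by move=> /(I_exp m); rewrite mul1n => h; exact: IMl. Qed.

Lemma q0 : q 0%N = 1.
Proof. exact: (qP 0). Qed.

Lemma q1 : q 1%N = 1.
Proof. exact: (qP 1). Qed.

Lemma etruncN N x : I 1 x -> cong N (etrunc N x * etrunc N (- x)) 1.
Proof.
move=> hx; case: N => [|N]; first exact: I0.
have := product_trunc N.+1 (fun i => I_term i hx) (fun i => I_term i (IN hx)).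
move/cong_trans; apply.
rewrite (_ : \sum_(m < N.+1) _ = 1); first exact: cong_refl.
rewrite big_ord_recl [X in _ + X]big1 ?addr0.
  by rewrite big_ord_recl big_ord0 addr0 /= q0 !expr0 !mulr1.
move=> m _; set k := (bump 0 m).
transitivity (q k * (x - x) ^+ k); last by rewrite subrr expr0n mulr0.
rewrite exprDn_comm; last by rewrite /GRing.comm mulrN mulNr.
rewrite mulr_sumr; apply: eq_bigr => i _.
have ik : (i <= k)%N by rewrite -ltnS.
rewrite mulrnAr -mulrnAl -mulrA (mulrA _ (q i)) -(qC i) !mulrA -q_bin //.
Qed.

(** Iterated commutators from the right: the conjugate exp(-x) y exp(x) is the sum of the
    [adn y x i] divided by i!. *)
Fixpoint adn (y x : A) n := if n is n'.+1 then adn y x n' * x - x * adn y x n' else y.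

Lemma mulX_adn y x m : y * x ^+ m = \sum_(i < m.+1) (x ^+ (m - i)%N * adn y x i) *+ 'C(m, i).
Proof.
elim: m => [|m IH]; first by rewrite big_ord_recl big_ord0 expr0 mulr1 mul1r addr0.
rewrite exprSr mulrA IH mulr_suml.
have step (i : 'I_m.+1) : (x ^+ (m - i)%N * adn y x i) *+ 'C(m, i) * x =
    (x ^+ (m.+1 - i)%N * adn y x i) *+ 'C(m, i) + (x ^+ (m - i)%N * adn y x i.+1) *+ 'C(m, i).
  rewrite mulrnAl -mulrnDl; congr (_ *+ _).
  by rewrite /= mulrBr !mulrA -exprSr -subSn ?leq_ord // addrC subrK.
rewrite (eq_bigr _ (fun i _ => step i)) big_split /=.
have -> : \sum_(i < m.+1) (x ^+ (m.+1 - i)%N * adn y x i) *+ 'C(m, i) =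
    \sum_(i < m.+2) (x ^+ (m.+1 - i)%N * adn y x i) *+ 'C(m, i).
  by rewrite [RHS]big_ord_recr /= bin_small // mulr0n addr0.
rewrite [RHS]big_ord_recl [X in X + _ = _]big_ord_recl /= !bin0 -addrA; congr (_ + _).
by rewrite -big_split /=; apply: eq_bigr => i _; rewrite subSS binS mulrnDr.
Qed.

Lemma I_adn y x i : I 1 x -> I i (adn y x i).
Proof.
move=> hx; elim: i => [|i IH]; first exact: I0.
apply: ID; first by rewrite -addn1; exact: IM.
by apply: IN; rewrite -add1n; exact: IM.
Qed.

Lemma etrunc_ad N y x : I 1 x ->
  cong N (y * etrunc N x) (etrunc N x * \sum_(i < N) q i * adn y x i).
Proof.
move=> hx.
have hz i : I i (q i * adn y x i).
  by apply: IMl; exact: I_adn.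
apply: cong_sym.
apply: cong_trans (product_trunc N (fun i => I_term i hx) hz) _.
rewrite /etrunc mulr_sumr /cong -sumrB; apply: Isum => m.
rewrite mulrA -qC -mulrA mulX_adn mulr_sumr -sumrB.
apply: Isum => i; have im : (i <= m)%N by rewrite -ltnS.
rewrite mulrnAr -mulrnAl q_bin // (_ : _ - _ = 0); first exact: I00.
by rewrite -!mulrA (mulrA _ (q i)) -(qC i) !mulrA subrr.
Qed.

Variables (Ser gg : A -> Prop) (eps : A) (Exp : A -> A).
Hypothesis SerM : forall x y, Ser x -> Ser y -> Ser (x * y).
Hypothesis SerB : forall x y, Ser x -> Ser y -> Ser (x - y).
Hypothesis Ser1 : Ser 1.
Hypothesis Ser_grade : forall n x, Ser x -> I n x -> I n.+1 (eps * x - x * eps - x *+ n).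
Hypothesis gg1 : forall x, gg x -> I 1 x.
Hypothesis ggD : forall x y, gg x -> gg y -> gg (x + y).
Hypothesis ggN : forall x, gg x -> gg (- x).
Hypothesis ggq : forall m x, gg x -> gg (q m * x).
Hypothesis ggR : forall x y, gg x -> gg y -> gg (x * y - y * x).
Hypothesis ggeps : forall x, gg x -> gg (eps * x - x * eps).
Hypothesis ggcl : forall x, (forall n, exists2 y, gg y & cong n x y) -> gg x.
Hypothesis gg0 : gg 0.
Hypothesis ExpS : forall x, gg x -> Ser (Exp x).
Hypothesis ExpP : forall x n, gg x -> cong n (Exp x) (etrunc n x).

Lemma ExpN x : gg x -> Exp x * Exp (- x) = 1.
Proof.
move=> hx; apply: cong_eq => n; apply: cong_trans (etruncN n (gg1 hx)).
by apply: congM; apply: ExpP => //; exact: ggN.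
Qed.

Lemma ExpNl x : gg x -> Exp (- x) * Exp x = 1.
Proof. by move=> hx; have := ExpN (ggN hx); rewrite opprK. Qed.

Lemma conj_cong n y x : gg x ->
  cong n (Exp (- x) * y * Exp x) (\sum_(i < n) q i * adn y x i).
Proof.
move=> hx; rewrite -[\sum_(i < n) _]mul1r -(ExpNl hx) -!mulrA; apply: congMl.
apply: cong_trans (congMl y (ExpP n hx)) _.
apply: cong_trans (etrunc_ad n y (gg1 hx)) _.
by apply: congMr; apply: cong_sym; exact: ExpP.
Qed.

Lemma gg_adn y x i : gg x -> gg y -> gg (adn y x i).
Proof. by move=> hx hy; elim: i => [//|i IH] /=; exact: ggR. Qed.

Lemma gg_sum n (F : 'I_n -> A) : (forall i, gg (F i)) -> gg (\sum_(i < n) F i).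
Proof. by move=> h; apply: big_ind => //; exact: ggD. Qed.

Lemma gg_conj x y : gg x -> gg y -> gg (Exp (- x) * y * Exp x).
Proof.
move=> hx hy; apply: ggcl => n; exists (\sum_(i < n) q i * adn y x i); last exact: conj_cong.
by apply: gg_sum => i; apply: ggq; exact: gg_adn.
Qed.

(** The term of index 0 in the conjugation series is [eps] itself and cancels; all others are
    iterated commutators of [eps, x], which lies in [gg]. *)
Lemma gg_conj_eps x : gg x -> gg (Exp (- x) * eps * Exp x - eps).
Proof.
move=> hx; apply: ggcl => n.
exists (\sum_(i < n) q i.+1 * adn eps x i.+1).
  apply: gg_sum => i; apply: ggq.
  have e : gg (eps * x - x * eps) by exact: ggeps.
  elim: (nat_of_ord i) => [//|j IH]; exact: ggR.
apply: cong_le (leqnSn n) _.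
have := conj_cong n.+1 eps hx.
by rewrite big_ord_recl /= q0 mul1r => h; have := congD h (cong_refl n.+1 (- eps)); rewrite addrAC subrr add0r.
Qed.

(* These two properties, stable under products and valid for exponentials, replace
   the Baker-Campbell-Hausdorff formula: conjugation moves [eps] and [gg] within [gg]. *)
Definition grouplike x x' := [/\ x * x' = 1, x' * x = 1, Ser x, gg (x' * eps * x - eps) &
   forall y, gg y -> gg (x' * y * x)].

Lemma grouplike_Exp x : gg x -> grouplike (Exp x) (Exp (- x)).
Proof.
move=> hx; split; [exact: ExpN|exact: ExpNl|exact: ExpS|exact: gg_conj_eps|].
by move=> y hy; exact: gg_conj.
Qed.

Lemma grouplikeM x x' y y' : grouplike x x' -> grouplike y y' -> grouplike (x * y) (y' * x').
Proof.
move=> [e1 e2 s1 c1 a1] [e3 e4 s2 c2 a2]; split.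
- by rewrite mulrA -(mulrA x) e3 mulr1.
- by rewrite mulrA -(mulrA y') e2 mulr1.
- exact: SerM.
- have -> : y' * x' * eps * (x * y) - eps = y' * (x' * eps * x - eps) * y + (y' * eps * y - eps).
    by rewrite mulrBr mulrBl !mulrA addrA subrK.
  by apply: ggD => //; exact: a2.
- by move=> z hz; rewrite (_ : y' * x' * z * (x * y) = y' * (x' * z * x) * y);
    [apply: a2; exact: a1|rewrite !mulrA].
Qed.

Lemma grouplike_top n x x' : grouplike x x' -> cong n.+1 x 1 ->
  exists2 y, gg y & I n.+1 y /\ cong n.+2 (x - 1) y.
Proof.
move=> [e1 e2 sx cx _] h.
pose f := x - 1; pose th := x' * eps * x - eps.
have If : I n.+1 f by [].
have Sf : Ser f by exact: SerB.
have eth : x * th = eps * f - f * eps.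
  transitivity (eps * x - x * eps); first by rewrite /th mulrBr !mulrA e1 mul1r.
  by rewrite /f mulrBr mulrBl mulr1 mul1r opprB addrA subrK.
have g1 := Ser_grade Sf If.
have If2 : I n.+1 (eps * f - f * eps).
  by apply: ID; [exact: IMl|apply: IN; exact: IMr].
have Ith : I n.+1 th.
  rewrite -[th]mul1r -e2 -mulrA eth; exact: IMl.
have c1 : cong n.+2 (f *+ n.+1) th.
  have c2 : cong n.+2 (x * th) th.
    rewrite /cong -{2}[th]mul1r -mulrBl; apply: (@Ile _ (n.+1 + n.+1)); first by lia.
    exact: IM.
  apply: cong_trans c2; rewrite eth; exact: cong_sym.
have qn : q n.+1 *+ (n.+1)`! = 1 by exact: qP.
(* Division by n + 1, written as n! times the inverse of (n + 1)!. *)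
exists ((q n.+1 * th) *+ n`!).
  elim: (n`!) => [|k IH]; first by rewrite mulr0n; exact: gg0.
  by rewrite mulrS; apply: ggD => //; exact: ggq.
split.
  elim: (n`!) => [|k IH]; first by rewrite mulr0n; exact: I00.
  by rewrite mulrS; apply: ID => //; exact: IMl.
have e : f = (q n.+1 * (f *+ n.+1)) *+ n`!.
  by rewrite mulrnAr -mulrnA -factS -mulrnAl qn mul1r.
rewrite -/f {1}e -!mulrnAl; exact: congMl.
Qed.

(** In powers with exponent at least 2 each occurrence of [b] is accompanied by a factor of order 1,
    which pushes it beyond the top degree. *)
Lemma Exp_add_top n x b : gg x -> gg b -> I n.+1 b -> cong n.+2 (Exp (x + b)) (Exp x + b).
Proof.
move=> hx hb Ib.
apply: cong_trans (ExpP n.+2 (ggD hx hb)) _.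
apply: (@cong_trans _ _ (etrunc n.+2 x + b)); last first.
  by apply: congD; [apply: cong_sym; exact: ExpP|exact: cong_refl].
rewrite /etrunc 2!big_ord_recl [X in cong _ _ (X + b)]big_ord_recl [X in cong _ _ (_ + X + b)]big_ord_recl.
rewrite /= /bump /= !expr0 q1 !expr1 !mul1r -!addrA; apply: congD; first exact: cong_refl.
apply: congD; first exact: cong_refl.
rewrite [X in cong _ _ X]addrC; apply: congD; first exact: cong_refl.
rewrite /cong -sumrB; apply: Isum => i; rewrite -mulrBr; apply: IMl.
rewrite !add1n.
have c0 : cong n.+1 (x + b) x by rewrite /cong addrAC subrr add0r.
have cX k : cong n.+1 ((x + b) ^+ k) (x ^+ k).
  by elim: k => [|k IH]; rewrite ?expr0 ?exprS; [exact: cong_refl|exact: congM].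
rewrite [X in X - _]exprSr [X in _ - X]exprSr mulrDr.
set k := i.+1.
have -> : (x + b) ^+ k * x + (x + b) ^+ k * b - x ^+ k * x =
   ((x + b) ^+ k - x ^+ k) * x + (x + b) ^+ k * b by rewrite mulrBl addrAC.
apply: ID; first by rewrite -[n.+2]addn1; apply: IM; [exact: cX|exact: gg1].
apply: (@Ile _ (k + n.+1)); first by rewrite /k; lia.
by apply: IM => //; have := I_exp k (ID (gg1 hx) (gg1 hb)); rewrite mul1n.
Qed.

Lemma Exp_cong n x y : gg x -> gg y -> cong n x y -> cong n (Exp x) (Exp y).
Proof.
move=> hx hy c; apply: cong_trans (ExpP n hx) _; apply: cong_sym.
apply: cong_trans (ExpP n hy) _; rewrite /cong -sumrB; apply: Isum => i.
rewrite -mulrBr; apply: IMl; elim: (nat_of_ord i) => [|k IH]; first exact: cong_refl.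
by rewrite !exprS; apply: congM => //; exact: cong_sym.
Qed.

Lemma Exp1 x : gg x -> cong 1 (Exp x) 1.
Proof.
move=> hx; apply: cong_trans (ExpP 1 hx) _.
by rewrite /etrunc big_ord_recl big_ord0 addr0 q0 mul1r; exact: cong_refl.
Qed.

Lemma Exp2 x : gg x -> cong 2 (Exp x) (1 + x).
Proof.
move=> hx; apply: cong_trans (ExpP 2 hx) _.
by rewrite /etrunc !big_ord_recl big_ord0 addr0 q0 q1 !mul1r expr0 expr1; exact: cong_refl.
Qed.

Lemma cong_absorbl n e y : cong 1 e 1 -> I n y -> cong n.+1 (e * y) y.
Proof.
move=> he hy; rewrite /cong -{2}[y]mul1r -mulrBl -add1n; exact: IM.
Qed.

Lemma cong_absorbr n e y : cong 1 e 1 -> I n y -> cong n.+1 (y * e) y.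
Proof.
move=> he hy; rewrite /cong -{2}[y]mulr1 -mulrBr -addn1; exact: IM.
Qed.

Variables (T : Type) (mul : T -> T -> T) (G : T -> Prop) (sg : T -> A -> A).
Hypothesis Gmul : forall g h, G g -> G h -> G (mul g h).
Hypothesis mulTA : forall g h l, mul (mul g h) l = mul g (mul h l).
Hypothesis sgD : forall g x y, G g -> sg g (x + y) = sg g x + sg g y.
Hypothesis sgM : forall g x y, G g -> sg g (x * y) = sg g x * sg g y.
Hypothesis sg1 : forall g, G g -> sg g 1 = 1.
Hypothesis sgI : forall g n x, G g -> I n x -> I n (sg g x).
Hypothesis sggg : forall g x, G g -> gg x -> gg (sg g x).
Hypothesis sgA : forall g h x, G g -> G h -> sg (mul g h) x = sg h (sg g x).

Lemma sg0 g : G g -> sg g 0 = 0.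
Proof. by move=> Gg; apply: (addrI (sg g 0)); rewrite -sgD // !addr0. Qed.

Lemma sgN g x : G g -> sg g (- x) = - sg g x.
Proof. by move=> Gg; apply: (addrI (sg g x)); rewrite -sgD // !subrr sg0. Qed.

Lemma sg_cong g n x y : G g -> cong n x y -> cong n (sg g x) (sg g y).
Proof. by move=> Gg c; rewrite /cong -sgN // -sgD //; exact: sgI. Qed.

Lemma sgMn g x n : G g -> sg g (x *+ n) = sg g x *+ n.
Proof. by move=> Gg; elim: n => [|n IH]; rewrite ?mulr0n ?sg0 // !mulrS sgD // IH. Qed.

Lemma sgq g m : G g -> sg g (q m) = q m.
Proof.
move=> Gg; transitivity (sg g (q m) * (q m *+ m`!)); first by rewrite qP mulr1.
by rewrite mulrnAr -mulrnAl -sgMn // qP sg1 // mul1r.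
Qed.

Lemma sgX g x n : G g -> sg g (x ^+ n) = sg g x ^+ n.
Proof. by move=> Gg; elim: n => [|n IH]; rewrite ?expr0 ?sg1 // !exprS sgM // IH. Qed.

Lemma sgExp g x : G g -> gg x -> sg g (Exp x) = Exp (sg g x).
Proof.
move=> Gg hx; apply: cong_eq => n; apply: cong_trans (sg_cong Gg (ExpP n hx)) _.
apply: cong_sym; apply: cong_trans (ExpP n (sggg Gg hx)) _.
rewrite (_ : sg g (etrunc n x) = etrunc n (sg g x)); first exact: cong_refl.
rewrite /etrunc (big_morph (sg g) (fun x y => sgD x y Gg) (sg0 Gg)).
by apply: eq_bigr => i _; rewrite sgM // sgq // sgX.
Qed.

Hypothesis H2 : forall n (y : T -> T -> A),
  (forall g h, G g -> G h -> gg (y g h) /\ I n.+1 (y g h)) ->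
  (forall g h l, G g -> G h -> G l ->
     cong n.+2 (sg l (y g h) + y (mul g h) l) (y g (mul h l) + y h l)) ->
  exists b : T -> A, (forall g, G g -> gg (b g) /\ I n.+1 (b g)) /\
    forall g h, G g -> G h -> cong n.+2 (y g h) (sg h (b g) + b h - b (mul g h)).
Hypothesis complete : forall x : nat -> A, (forall n, gg (x n)) ->
  (forall n, cong n.+1 (x n.+1) (x n)) -> exists2 X, gg X & forall n, cong n.+1 X (x n).

Definition cocyc n (X : T -> A) := (forall g, G g -> gg (X g)) /\
  forall g h, G g -> G h -> cong n (sg h (Exp (X g)) * Exp (X h)) (Exp (X (mul g h))).

Lemma cocyc2 X : (forall g, G g -> gg (X g)) ->
  (forall g h, G g -> G h -> X (mul g h) = sg h (X g) + X h) -> cocyc 2 X.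
Proof.
move=> hX cX; split=> // g h Gg Gh; have Ggh := Gmul Gg Gh.
have h1 := congM (sg_cong Gh (Exp2 (hX _ Gg))) (Exp2 (hX _ Gh)).
apply: cong_trans h1 _; apply: cong_trans (cong_sym (Exp2 (hX _ Ggh))).
rewrite cX // sgD // sg1 // mulrDr mulr1 mulrDl mul1r /cong.
rewrite (_ : _ - _ = sg h (X g) * X h); first by apply: (IM (m := 1) (n := 1)); [apply: sgI => //|]; apply: gg1; exact: hX.
by rewrite !addrA [X in X - _]addrAC [X in X - _]addrAC [LHS]addrAC subrr add0r.
Qed.

Lemma lift_step n X : cocyc n.+1 X ->
  exists X', cocyc n.+2 X' /\ forall g, G g -> cong n.+1 (X' g) (X g).
Proof.
move=> [hX cX].
have hE g : G g -> cong 1 (Exp (X g)) 1 by move=> /hX; exact: Exp1.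
have hsE g h : G g -> G h -> cong 1 (sg h (Exp (X g))) 1.
  by move=> Gg Gh; rewrite -(sg1 Gh); apply: sg_cong => //; exact: hE.
have ex : forall p : T * T, exists y, G p.1 -> G p.2 -> [/\ gg y, I n.+1 y &
    cong n.+2 (sg p.2 (Exp (X p.1)) * Exp (X p.2)) (Exp (X (mul p.1 p.2)) + y)].
  move=> [g h] /=; have [Gg|] := pselect (G g); last by exists 0.
  have [Gh|] := pselect (G h); last by exists 0.
  have Ggh := Gmul Gg Gh.
  have gl := grouplikeM (grouplikeM (grouplike_Exp (sggg Gh (hX _ Gg))) (grouplike_Exp (hX _ Gh)))
     (grouplike_Exp (ggN (hX _ Ggh))).
  have [|y gy [Iy cy]] := grouplike_top gl (n := n).
    rewrite -(ExpN (hX _ Ggh)) -sgExp //; [apply: congMr; exact: cX|exact: hX].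
  exists y => _ _; split=> //.
  have := congMr (Exp (X (mul g h))) cy.
  rewrite mulrBl mul1r -mulrA ExpNl ?mulr1; last exact: hX.
  rewrite -sgExp //; last exact: hX.
  move=> c1; have c2 := cong_trans c1 (cong_absorbr (hE _ Ggh) Iy).
  by have := congD c2 (cong_refl n.+2 (Exp (X (mul g h)))); rewrite subrK addrC.
have /choice[yp hyp] := ex.
pose y g h := yp (g, h).
have hy g h : G g -> G h -> [/\ gg (y g h), I n.+1 (y g h) &
    cong n.+2 (sg h (Exp (X g)) * Exp (X h)) (Exp (X (mul g h)) + y g h)].
  by move=> Gg Gh; exact: (hyp (g, h)).
have [||b [hb cb]] := H2 (n := n) (y := y).
- by move=> g h Gg Gh; have [] := hy _ _ Gg Gh.
- move=> g h l Gg Gh Gl; have Ggh := Gmul Gg Gh; have Ghl := Gmul Gh Gl.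
  have [_ I1 c1] := hy _ _ Gg Gh; have [_ I2 c2] := hy _ _ Ggh Gl.
  have [_ I3 c3] := hy _ _ Gh Gl; have [_ I4 c4] := hy _ _ Gg Ghl.
  (* Both bracketings of the triple product give this element; comparing its two expansions yields
     the 2-cocycle relation for [y]. *)
  pose P := sg l (sg h (Exp (X g)) * Exp (X h)) * Exp (X l).
  pose E := Exp (X (mul (mul g h) l)).
  have p1 : cong n.+2 P (E + (sg l (y g h) + y (mul g h) l)).
    apply: cong_trans (congMr _ (sg_cong Gl c1)) _; rewrite sgD // mulrDl.
    rewrite [X in cong _ _ (E + X)]addrC addrA; apply: congD; first exact: c2.
    by apply: cong_absorbr; [exact: hE|exact: sgI].
  have p2 : cong n.+2 P (E + (y g (mul h l) + y h l)).
    rewrite /P sgM // -sgA // -mulrA.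
    apply: cong_trans (congMl _ c3) _; rewrite mulrDr addrA; apply: congD.
      by rewrite /E mulTA; exact: c4.
    by apply: cong_absorbl; [exact: hsE|].
  have := congD (cong_refl n.+2 (- E)) (cong_trans (cong_sym p1) p2).
  by rewrite !addKr.
exists (fun g => X g - b g); split; last first.
  by move=> g Gg; rewrite /cong addrAC subrr add0r; apply: IN; have [] := hb _ Gg.
split=> [g Gg|g h Gg Gh].
  by apply: ggD; [exact: hX|apply: ggN; have [] := hb _ Gg].
have Ggh := Gmul Gg Gh.
have top g' : G g' -> cong n.+2 (Exp (X g' - b g')) (Exp (X g') - b g').
  by move=> Gg'; have [b1 b2] := hb _ Gg'; apply: Exp_add_top => //; [exact: hX|exact: ggN|exact: IN].
have [_ _ c] := hy _ _ Gg Gh; have [bg1 bg2] := hb _ Gg; have [bh1 bh2] := hb _ Gh.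
apply: cong_trans (congM (sg_cong Gh (top _ Gg)) (top _ Gh)) _.
apply: cong_trans (cong_sym (top _ Ggh)).
rewrite sgD // sgN // mulrBr !mulrBl opprB.
apply: (@cong_trans _ _ (Exp (X (mul g h)) + y g h - sg h (b g) + (0 - b h))).
  apply: congD; first by apply: congD; [exact: c|apply: congN; apply: cong_absorbr; [exact: hE|exact: sgI]].
  apply: congD; last by apply: congN; apply: cong_absorbl; [exact: hsE|].
  rewrite /cong subr0; apply: (@Ile _ (n.+1 + n.+1)); first by lia.
  by apply: IM => //; exact: sgI.
rewrite sub0r -!addrA; apply: congD; first exact: cong_refl.
have := congD (cb _ _ Gg Gh) (cong_refl n.+2 (- sg h (b g) - b h)).
rewrite (_ : sg h (b g) + b h - b (mul g h) + (- sg h (b g) - b h) = - b (mul g h)) //.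
by rewrite addrAC -opprD subrr add0r.
Qed.

Theorem lift_cocycle X1 : cocyc 2 X1 -> exists X,
  [/\ forall g, G g -> gg (X g), forall g, G g -> cong 2 (X g) (X1 g) &
      forall g h, G g -> G h -> sg h (Exp (X g)) * Exp (X h) = Exp (X (mul g h))].
Proof.
move=> h1.
have ex : forall p : nat * (T -> A), exists X', cocyc p.1.+1 p.2 ->
    cocyc p.1.+2 X' /\ forall g, G g -> cong p.1.+1 (X' g) (p.2 g).
  move=> [n X] /=; have [h|] := pselect (cocyc n.+1 X); last by exists X.
  by have [X' hX'] := lift_step h; exists X'.
have /choice[st hst] := ex.
(* [Xs k] is a cocycle modulo order k + 2 and agrees with its successor modulo the same order. *)
pose Xs := fix Xs k := if k is k'.+1 then st (k'.+1, Xs k') else X1.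
have hXs k : cocyc k.+2 (Xs k).
  by elim: k => [//|k IH] /=; have [] := hst (k.+1, Xs k) IH.
have cXs k g : G g -> cong k.+2 (Xs k.+1 g) (Xs k g).
  by move=> Gg /=; have [_] := hst (k.+1, Xs k) (hXs k); exact.
have exX : forall g, exists X, G g -> gg X /\ forall n, cong n.+1 X (Xs n g).
  move=> g; have [Gg|] := pselect (G g); last by exists 0.
  have [||X gX cX] := complete (x := fun n => Xs n g).
  - by move=> n; apply: (hXs n).1.
  - by move=> n; apply: cong_le (cXs n _ Gg).
  by exists X.
have /choice[X hX] := exX.
exists X; split.
- by move=> g /hX[].
- move=> g Gg; have [_ c] := hX _ Gg; apply: cong_trans (c 1%N) _; exact: (cXs 0%N).
move=> g h Gg Gh; have Ggh := Gmul Gg Gh; apply: cong_eq => n; apply: (cong_le (leqnSn n)).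
have cE g' : G g' -> cong n.+1 (Exp (X g')) (Exp (Xs n g')).
  by move=> Gg'; have [g1 c] := hX _ Gg'; apply: Exp_cong => //; exact: (hXs n).1.
apply: cong_trans (congM (sg_cong Gh (cE _ Gg)) (cE _ Gh)) _.
apply: cong_trans (cong_sym (cE _ Ggh)).
by apply: cong_le ((hXs n).2 _ _ Gg Gh).
Qed.
End Filtered.

(** * Power series of operators *)

Section MultiIndexSums.
Variables (n : nat) (V : zmodType).
Implicit Types (a b c d : mi n).

Definition misub a b : mi n := fun i => (a i - b i)%N.

Definition mile a b := [forall i, (a i <= b i)%N].

Definition msum a (h : mi n -> V) : V :=
  \sum_(b : {ffun 'I_n -> 'I_(mdeg a).+1} | [forall i, (b i <= a i)%N])
    h (fun i => nat_of_ord (b i)).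

Lemma inord_le N m : (m <= N)%N -> (inord m : 'I_N.+1) = m :> nat.
Proof. exact: inordK. Qed.

Lemma mileP a b : reflect (forall i, (a i <= b i)%N) (mile a b).
Proof. exact: forallP. Qed.

Lemma leq_mdeg a i : (a i <= mdeg a)%N.
Proof. by rewrite /mdeg (bigD1 i) //= leq_addr. Qed.

Lemma mdeg_sub a b : mile b a -> (mdeg b + mdeg (misub a b))%N = mdeg a.
Proof.
move=> /mileP ba; rewrite /mdeg -big_split /=; apply: eq_bigr => i _.
by rewrite /misub subnKC.
Qed.

Lemma misub_mile a b : mile (misub a b) a.
Proof. by apply/mileP => i; exact: leq_subr. Qed.

Lemma mile_mdeg a b : mile a b -> (mdeg a <= mdeg b)%N.
Proof. by move=> /mdeg_sub <-; exact: leq_addr. Qed.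

Lemma misubK a b : mile b a -> misub a (misub a b) = b.
Proof. by move=> /mileP ba; apply/funext => i; rewrite /misub subKn. Qed.

Lemma mdeg_eq0 a : (mdeg a == 0%N) = [forall i, a i == 0%N].
Proof.
apply/eqP/forallP => [h i|h]; first by have := leq_mdeg a i; rewrite h leqn0.
by rewrite /mdeg big1 // => i _; apply/eqP.
Qed.

Lemma eq_msum a (h h' : mi n -> V) :
  (forall b, mile b a -> h b = h' b) -> msum a h = msum a h'.
Proof. by move=> e; apply: eq_bigr => b /e. Qed.

(** Replaces the bound [mdeg a] in the index type by any larger one, so that nested sums run over a
    common type. *)
Lemma msum_bound N a (h : mi n -> V) : (forall i, (a i <= N)%N) ->
  msum a h = \sum_(b : {ffun 'I_n -> 'I_N.+1} | [forall i, (b i <= a i)%N])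
    h (fun i => nat_of_ord (b i)).
Proof.
move=> aN; rewrite /msum.
rewrite (reindex_onto (fun b : {ffun 'I_n -> 'I_N.+1} => [ffun i => inord (b i)])
  (fun b : {ffun 'I_n -> 'I_(mdeg a).+1} => [ffun i => inord (b i)])) /=; last first.
  move=> b /forallP ba; apply/ffunP => i; rewrite !ffunE; apply: val_inj => /=.
  by rewrite (inord_le (leq_trans (ba i) (aN i))) inord_le // (leq_trans (ba i)) // leq_mdeg.
have key (b : {ffun 'I_n -> 'I_N.+1}) : [forall i, (b i <= a i)%N] -> forall i,
    (inord (b i) : 'I_(mdeg a).+1) = b i :> nat.
  by move=> /forallP ba i; rewrite inordK // ltnS (leq_trans (ba i)) // leq_mdeg.
apply: eq_big => [b|b].
  apply/idP/idP => [/andP[/forallP h1 /eqP h2]|h1].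
    apply/forallP => i; rewrite -h2 !ffunE; have := h1 i; rewrite !ffunE => h3.
    by apply: (leq_trans _ h3); apply: eq_leq; apply: inord_le; exact: leq_trans h3 (aN i).
  apply/andP; split.
    by apply/forallP => i; rewrite ffunE (key b h1); have /forallP := h1.
  by apply/eqP/ffunP => i; apply: val_inj; rewrite !ffunE /= (key b h1) inordK.
move=> /andP[/forallP h1 /eqP h2]; congr h; apply/funext => i.
have := h1 i; rewrite -[in RHS]h2 !ffunE => h3.
by apply: esym; apply: inord_le; exact: leq_trans h3 (aN i).
Qed.

(** The reindexing (b, c) |-> (c, b - c) behind the associativity of the Cauchy product. *)
Lemma exchange_msum a (h : mi n -> mi n -> V) :
  msum a (fun b => msum b (fun c => h c (misub b c))) =
  msum a (fun c => msum (misub a c) (h c)).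
Proof.
pose N := mdeg a; pose T := {ffun 'I_n -> 'I_N.+1}.
have aN i : (a i <= N)%N by exact: leq_mdeg.
pose v (b : T) : mi n := fun i => nat_of_ord (b i).
have vN (b : T) i : (v b i <= N)%N := ltn_ord (b i).
transitivity (\sum_(b : T | mile (v b) a) \sum_(c : T | mile (v c) (v b)) h (v c) (misub (v b) (v c))).
  rewrite (msum_bound _ aN); apply: eq_bigr => b _.
  by rewrite (msum_bound _ (vN b)).
rewrite (exchange_big_dep (fun c : T => mile (v c) a)) /=; last first.
  by move=> b c /mileP h1 /mileP h2; apply/mileP => i; exact: leq_trans (h2 i) (h1 i).
rewrite (msum_bound _ aN); apply: eq_bigr => c /mileP ca.
have acN i : (misub a (v c) i <= N)%N by rewrite (leq_trans (leq_subr _ _)).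
rewrite (msum_bound _ acN).
rewrite (reindex_onto (fun d : T => [ffun i => inord (c i + d i)] : T)
   (fun b : T => [ffun i => inord (b i - c i)] : T)) /=; last first.
  move=> b /andP[/mileP h1 /mileP h2]; apply/ffunP => i; rewrite !ffunE; apply: val_inj => /=.
  have le1 : (b i - c i <= N)%N by rewrite (leq_trans (leq_subr _ _)) // -ltnS.
  by rewrite (inord_le le1) subnKC ?inord_val //; exact: h2.
have key (d : T) : (forall i, (d i <= misub a (v c) i)%N) -> forall i,
    (inord (c i + d i) : 'I_N.+1) = (c i + d i)%N :> nat.
  move=> da i; rewrite inordK // ltnS; apply: leq_trans (aN i).
  by have := da i; rewrite /misub leq_subRL ?ca.
apply: eq_big => [d|d].
  apply/idP/idP => [/andP[/andP[/mileP h1 /mileP h2] /eqP h3]|/forallP da].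
    apply/forallP => i; rewrite -h3 !ffunE inordK; last first.
      by rewrite ltnS (leq_trans (leq_subr _ _)) // -ltnS.
    by have := h1 i; rewrite /v ffunE; exact: leq_sub2r.
  apply/andP; split; [apply/andP; split; apply/mileP => i|].
  - by rewrite /v ffunE key //; have := da i; rewrite /misub leq_subRL ?ca.
  - by rewrite /v ffunE key // leq_addr.
  by apply/eqP/ffunP => i; apply: val_inj; rewrite !ffunE /= key // addKn inordK.
move=> /andP[/andP[/mileP h1 /mileP h2] /eqP h3]; congr h; apply/funext => i.
rewrite -[in RHS]h3 /misub /v !ffunE; apply: esym; apply: inord_le.
by apply: leq_trans (leq_subr _ _) _; rewrite -ltnS; exact: ltn_ord.
Qed.

Lemma msum_rev a (h : mi n -> V) : msum a h = msum a (fun b => h (misub a b)).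
Proof.
pose N := mdeg a; pose T := {ffun 'I_n -> 'I_N.+1}.
rewrite /msum (reindex_onto (fun d : T => [ffun i => inord (a i - d i)] : T)
   (fun b : T => [ffun i => inord (a i - b i)] : T)) /=; last first.
  move=> b /forallP ba; apply/ffunP => i; rewrite !ffunE; apply: val_inj => /=.
  have le1 : (a i - b i <= N)%N by rewrite (leq_trans (leq_subr _ _)) // leq_mdeg.
  by rewrite (inord_le le1) subKn ?inord_val.
have key (d : T) i : (inord (a i - d i) : 'I_N.+1) = (a i - d i)%N :> nat.
  by apply: inord_le; exact: leq_trans (leq_subr _ _) (leq_mdeg a i).
apply: eq_big => [d|d].
  apply/idP/idP => [/andP[/forallP h1 /eqP h3]|/forallP da].
    by apply/forallP => i; rewrite -h3 ffunE key leq_subr.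
  apply/andP; split; first by apply/forallP => i; rewrite ffunE (key d i); exact: leq_subr.
  apply/eqP/ffunP => i; apply: val_inj; rewrite !ffunE /= key subKn ?inord_val //; exact: da.
by move=> _; congr h; apply/funext => i; rewrite ffunE key.
Qed.

Lemma msum_top a (h : mi n -> V) :
  (forall b, mile b a -> mdeg (misub a b) != 0%N -> h b = 0) -> msum a h = h a.
Proof.
move=> h0; have ea i : (inord (a i) : 'I_(mdeg a).+1) = a i :> nat by rewrite inordK // ltnS leq_mdeg.
pose b0 : {ffun 'I_n -> 'I_(mdeg a).+1} := [ffun i => inord (a i)].
have e0 : (fun i => nat_of_ord (b0 i)) = a by apply/funext => i; rewrite ffunE ea.
rewrite /msum (bigD1 b0) /=; last by apply/forallP => i; rewrite ffunE ea.
rewrite e0 big1 ?addr0 // => b /andP[/forallP ba nb]; apply: h0; first exact/mileP.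
apply: contra nb; rewrite mdeg_eq0 => /forallP hb; apply/eqP/ffunP => i; apply: val_inj.
by rewrite /= ffunE ea; apply/eqP; rewrite eqn_leq ba /=; have := hb i; rewrite subn_eq0.
Qed.

Lemma msum0 a : msum a (fun=> 0) = 0.
Proof. exact: big1. Qed.

Lemma msumD a (h h' : mi n -> V) : msum a (fun b => h b + h' b) = msum a h + msum a h'.
Proof. exact: big_split. Qed.

Lemma msumB a (h h' : mi n -> V) : msum a (fun b => h b - h' b) = msum a h - msum a h'.
Proof. exact: sumrB. Qed.

Lemma msumMn a (h : mi n -> V) m : msum a h *+ m = msum a (fun b => h b *+ m).
Proof. by rewrite /msum sumrMnl. Qed.

End MultiIndexSums.

(** * The filtered ring in which series of operators live *)

Section FilteredEndomorphisms.
Variables (X : Type) (deg : X -> nat) (V : zmodType).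
Implicit Types (u v : X -> V).

Definition vanish m u := forall a, (deg a < m)%N -> u a = 0.

(** Coefficients of a series are arbitrary maps, for which the Cauchy product need not be
    distributive. Additive series are therefore realised as additive endomorphisms of families that
    respect the order; these form a ring under composition, which also contains the Euler
    operator. *)
Record fend := Fend {
  fend_fun :> (X -> V) -> X -> V;
  fend_add : forall u v a, fend_fun (fun b => u b + v b) a = fend_fun u a + fend_fun v a;
  fend_vanish : forall m u, vanish m u -> vanish m (fend_fun u) }.
Implicit Types (f g : fend).

Lemma fendP f g : (forall u a, f u a = g u a) -> f = g.
Proof.
case: f g => [f f1 f2] [g g1 g2] /= e.
have {}e : f = g by apply/funext => u; apply/funext => a.
by subst g; congr Fend; exact: Prop_irrelevance.
Qed.

HB.instance Definition _ := gen_eqMixin fend.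
HB.instance Definition _ := gen_choiceMixin fend.

Definition fzero : fend.
Proof. by exists (fun _ _ => 0) => // u v a; rewrite addr0. Defined.

Definition fopp f : fend.
Proof.
exists (fun u a => - f u a) => [u v a|m u h a am]; first by rewrite fend_add opprD.
by rewrite (fend_vanish f h) ?oppr0.
Defined.

Definition fadd f g : fend.
Proof.
exists (fun u a => f u a + g u a) => [u v a|m u h a am]; first by rewrite !fend_add addrACA.
by rewrite !(fend_vanish _ h) ?addr0.
Defined.

Definition fone : fend.
Proof. by exists (fun u => u). Defined.

Definition fmul f g : fend.
Proof.
exists (fun u => f (g u)) => [u v a|m u h]; last by apply: fend_vanish; exact: fend_vanish.
by rewrite -fend_add; congr (f _ a); apply/funext => b; exact: fend_add.
Defined.

Lemma faddA : associative fadd.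
Proof. by move=> f g h; apply: fendP => u a /=; rewrite addrA. Qed.
Lemma faddC : commutative fadd.
Proof. by move=> f g; apply: fendP => u a /=; rewrite addrC. Qed.
Lemma fadd0 : left_id fzero fadd.
Proof. by move=> f; apply: fendP => u a /=; rewrite add0r. Qed.
Lemma faddN : left_inverse fzero fopp fadd.
Proof. by move=> f; apply: fendP => u a /=; rewrite addNr. Qed.

HB.instance Definition _ := GRing.isZmodule.Build fend faddA faddC fadd0 faddN.

Lemma fmulA : associative fmul.
Proof. by move=> f g h; apply: fendP. Qed.
Lemma fmul1 : left_id fone fmul.
Proof. by move=> f; apply: fendP. Qed.
Lemma fmulr1 : right_id fone fmul.
Proof. by move=> f; apply: fendP. Qed.
Lemma fmulDl : left_distributive fmul fadd.
Proof. by move=> f g h; apply: fendP. Qed.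
Lemma fmulDr : right_distributive fmul fadd.
Proof. by move=> f g h; apply: fendP => u a; exact: fend_add. Qed.

HB.instance Definition _ :=
  GRing.Zmodule_isPzRing.Build fend fmulA fmul1 fmulr1 fmulDl fmulDr.

Lemma fendDE f g u a : (f + g) u a = f u a + g u a. Proof. by []. Qed.
Lemma fendNE f u a : (- f) u a = - f u a. Proof. by []. Qed.
Lemma fendME f g u : (f * g) u = f (g u). Proof. by []. Qed.
Lemma fendMnE f m u a : (f *+ m) u a = f u a *+ m.
Proof. by elim: m => [//|m IH]; rewrite !mulrS fendDE IH. Qed.

(** For the endomorphism given by a series this says that the series lies in the m-th power of the
    ideal (rho). *)
Definition fil m f := forall l u, vanish l u -> vanish (l + m) (f u).

Lemma fil0 f : fil 0 f.
Proof. by move=> l u; rewrite addn0; exact: fend_vanish. Qed.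

Lemma fil00 m : fil m 0.
Proof. by []. Qed.

Lemma filD m f g : fil m f -> fil m g -> fil m (f + g).
Proof. by move=> hf hg l u hu a am; rewrite fendDE (hf l) ?(hg l) ?addr0. Qed.

Lemma filN m f : fil m f -> fil m (- f).
Proof. by move=> hf l u hu a am; rewrite fendNE (hf l) ?oppr0. Qed.

Lemma filM m l f g : fil m f -> fil l g -> fil (m + l) (f * g).
Proof.
move=> hf hg j u hu; rewrite fendME (addnC m) addnA.
by apply: hf; apply: hg.
Qed.

Lemma filS m f : fil m.+1 f -> fil m f.
Proof. by move=> hf l u hu a am; apply: (hf l u hu); rewrite addnS ltnW // ltnS. Qed.

Lemma fil_sep f : (forall m, fil m f) -> f = 0.
Proof.
move=> hf; apply: fendP => u a.
by apply: (hf (deg a).+1 0%N u) => //; rewrite add0n.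
Qed.

Definition fgrade : fend.
Proof.
exists (fun u a => u a *+ deg a) => [u v a|m u h a am]; first by rewrite mulrnDl.
by rewrite h // mul0rn.
Defined.

End FilteredEndomorphisms.

Section SeriesAction.
Variables (F : fieldType) (n : nat).
Hypothesis natF : forall m, (m.+1%:R : F) != 0.
Local Notation ser := (mi n -> F -> F).
Local Notation E := (fend (@mdeg n) F).
Implicit Types (S T : ser) (f g : E) (a b : mi n) (x y : F) (u : mi n -> F).

Definition gmul S T : ser := fun a x => msum a (fun b => S b (T (misub a b) x)).
Definition gone : ser := fun a x => if [forall i, a i == 0%N] then x else 0.
Definition gpow S m : ser := iter m (gmul S) gone.
Definition gexp S : ser := fun a x => \sum_(m < (mdeg a).+1) (m`!%:R)^-1 * gpow S m a x.

Definition addop (A : F -> F) := forall x y, A (x + y) = A x + A y.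

Lemma addop0 A : addop A -> A 0 = 0.
Proof. by move=> hA; apply: (addrI (A 0)); rewrite -hA !addr0. Qed.

Lemma addopMn A x m : addop A -> A (x *+ m) = A x *+ m.
Proof. by move=> hA; elim: m => [|m IH]; rewrite ?addop0 // !mulrS hA IH. Qed.

Lemma addop_msum A a h : addop A -> A (msum a h) = msum a (fun b => A (h b)).
Proof. by move=> hA; apply: (big_morph A hA (addop0 hA)). Qed.

Definition acts S f := (forall a, addop (S a)) /\
  forall u a, f u a = msum a (fun b => S b (u (misub a b))).

Lemma acts_ex S : (forall a, addop (S a)) -> exists f, acts S f.
Proof.
move=> hS; pose f u a := msum a (fun b => S b (u (misub a b))).
have f1 u v a : f (fun b => u b + v b) a = f u a + f v a.
  by rewrite /f -msumD; apply: eq_msum => b _; rewrite hS.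
have f2 m u : vanish (@mdeg n) m u -> vanish (@mdeg n) m (f u).
  move=> h a am; rewrite /f -[RHS](msum0 _ a); apply: eq_msum => b ba.
  by rewrite h ?addop0 //; apply: leq_ltn_trans am; apply: mile_mdeg; exact: misub_mile.
by exists (Fend f1 f2); split.
Qed.

Definition delta x : mi n -> F := fun b => if mdeg b == 0%N then x else 0.

(** A series is recovered from its action on families concentrated in degree 0; this makes [acts] a
    faithful dictionary. *)
Lemma acts_coef S f a x : acts S f -> S a x = f (delta x) a.
Proof.
move=> [hS ->]; rewrite msum_top => [|b _ /negPf h].
  by rewrite /delta (_ : mdeg _ == 0%N) // mdeg_eq0; apply/forallP => i; rewrite /misub subnn.
by rewrite /delta h addop0.
Qed.

Lemma acts_inj S T f : acts S f -> acts T f -> S = T.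
Proof.
move=> h1 h2; apply/funext => a; apply/funext => x.
by rewrite (acts_coef _ _ h1) (acts_coef _ _ h2).
Qed.

Lemma acts_eq S f g : acts S f -> acts S g -> f = g.
Proof. by move=> [_ h1] [_ h2]; apply: fendP => u a; rewrite h1 h2. Qed.

Lemma acts_mul S T f g : acts S f -> acts T g -> acts (gmul S T) (f * g).
Proof.
move=> [hS hf] [hT hg]; split=> [a x y|u a].
  by rewrite /gmul -msumD; apply: eq_msum => b _; rewrite hT hS.
rewrite fendME hf.
transitivity (msum a (fun b => msum (misub a b) (fun c => S b (T c (u (misub (misub a b) c)))))).
  by apply: eq_msum => b _; rewrite hg addop_msum.
rewrite -exchange_msum; apply: eq_msum => b /mileP ba; apply: eq_msum => c /mileP cb.
congr (S _ (T _ (u _))); apply/funext => i; rewrite /misub.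
by have := ba i; have := cb i; lia.
Qed.

Lemma acts_one : acts gone 1.
Proof.
split=> [a x y|u a]; first by rewrite /gone; case: ifP => // _; rewrite addr0.
rewrite (msum_rev a) msum_top => [|b ba h].
  rewrite /gone (_ : [forall i, misub a a i == 0%N]); last first.
    by apply/forallP => i; rewrite /misub subnn.
  by congr u; apply/funext => i; rewrite /misub subnn subn0.
by rewrite /gone -mdeg_eq0 (negPf h).
Qed.

Lemma acts_zero : acts (fun _ _ => 0) 0.
Proof. by split=> [a x y|u a]; rewrite ?addr0 // msum0. Qed.

Lemma acts_add S T f g : acts S f -> acts T g -> acts (fun a x => S a x + T a x) (f + g).
Proof.
move=> [hS hf] [hT hg]; split=> [a x y|u a]; first by rewrite hS hT addrACA.
by rewrite fendDE hf hg msumD.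
Qed.

Lemma acts_opp S f : acts S f -> acts (fun a x => - S a x) (- f).
Proof.
move=> [hS hf]; split=> [a x y|u a]; first by rewrite hS opprD.
by rewrite fendNE hf -[LHS]sub0r -[0](msum0 _ a) -msumB; apply: eq_msum => b _; rewrite sub0r.
Qed.

Lemma acts_sub S T f g : acts S f -> acts T g -> acts (fun a x => S a x - T a x) (f - g).
Proof. by move=> h1 h2; exact: acts_add h1 (acts_opp h2). Qed.

Lemma acts_Mn m S f : acts S f -> acts (fun a x => S a x *+ m) (f *+ m).
Proof.
move=> [hS hf]; split=> [a x y|u a]; first by rewrite hS mulrnDl.
by rewrite fendMnE hf msumMn.
Qed.

Lemma acts_sum (I : Type) (r : seq I) (S : I -> ser) (f : I -> E) :
  (forall i, acts (S i) (f i)) -> acts (fun a x => \sum_(i <- r) S i a x) (\sum_(i <- r) f i).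
Proof.
move=> h; elim: r => [|i r IH].
  rewrite big_nil (_ : (fun _ _ => _) = (fun _ _ => 0)); first exact: acts_zero.
  by apply/funext => a; apply/funext => x; rewrite big_nil.
rewrite big_cons (_ : (fun _ _ => _) = (fun a x => S i a x + \sum_(j <- r) S j a x)).
  exact: acts_add.
by apply/funext => a; apply/funext => x; rewrite big_cons.
Qed.

Definition qend (m : nat) : E.
Proof.
exists (fun u a => (m`!%:R)^-1 * u a) => [u v a|l u h a al]; first by rewrite mulrDr.
by rewrite h // mulr0.
Defined.

Lemma fact_neq0 m : (m`!%:R : F) != 0.
Proof. by rewrite -(prednK (fact_gt0 m)) natF. Qed.

Lemma qendP m : qend m *+ m`! = 1.
Proof.
by apply: fendP => u a; rewrite fendMnE /= -mulrnAl -[_ *+ _]mulr_natl mulfV ?fact_neq0 // mul1r.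
Qed.

Lemma qendC m f : qend m * f = f * qend m.
Proof.
have c1 : f * (qend m *+ m`!) = (qend m *+ m`!) * f by rewrite qendP mulr1 mul1r.
transitivity (qend m * (f * (qend m *+ m`!))); first by rewrite qendP mulr1.
by rewrite mulrnAr mulrnAr -mulrnAl qendP mul1r.
Qed.

Lemma acts_q m S f : acts S f -> acts (fun a x => (m`!%:R)^-1 * S a x) (qend m * f).
Proof.
move=> [hS hf]; split=> [a x y|u a]; first by rewrite hS mulrDr.
by rewrite fendME /= hf addop_msum // => x y; rewrite mulrDr.
Qed.

Lemma acts_pow S f m : acts S f -> acts (gpow S m) (f ^+ m).
Proof.
move=> h; elim: m => [|m IH]; first by rewrite expr0; exact: acts_one.
by rewrite exprS; exact: acts_mul.
Qed.

Lemma fil_acts S f m : acts S f ->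
  fil m f <-> forall a x, (mdeg a < m)%N -> S a x = 0.
Proof.
move=> h; split=> [hf a x am|hS l u hu a al].
  by rewrite (acts_coef _ _ h); apply: (hf 0%N) => //.
have [hS' ->] := h; rewrite -[RHS](msum0 _ a); apply: eq_msum => b ba.
have [bm|mb] := ltnP (mdeg b) m; first exact: hS.
by rewrite hu ?addop0 //; have := mdeg_sub ba; lia.
Qed.

Lemma cong_acts S T f g m : acts S f -> acts T g ->
  fil m (f - g) <-> forall a, (mdeg a < m)%N -> S a = T a.
Proof.
move=> h1 h2; rewrite (fil_acts _ (acts_sub h1 h2)); split=> h a => [am|x am].
  by apply/funext => x; apply/eqP; rewrite -subr_eq0; apply/eqP; exact: h.
by rewrite h // subrr.
Qed.

Local Notation eps := (fgrade (@mdeg n) F).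

Lemma acts_grade S f : acts S f -> acts (fun a x => S a x *+ mdeg a) (eps * f - f * eps).
Proof.
move=> [hS hf]; split=> [a x y|u a]; first by rewrite hS mulrnDl.
rewrite fendDE fendNE !fendME /= !hf msumMn -msumB; apply: eq_msum => b ba.
by rewrite addopMn // -(mdeg_sub ba) mulrnDr addrK.
Qed.

Definition Ser f := exists S, acts S f.

Lemma SerM f g : Ser f -> Ser g -> Ser (f * g).
Proof. by move=> [S h1] [T h2]; exists (gmul S T); exact: acts_mul. Qed.

Lemma SerB f g : Ser f -> Ser g -> Ser (f - g).
Proof. by move=> [S h1] [T h2]; eexists; exact: acts_sub h1 h2. Qed.

Lemma Ser1 : Ser 1.
Proof. by exists gone; exact: acts_one. Qed.

Lemma Ser_grade m f : Ser f -> fil m f -> fil m.+1 (eps * f - f * eps - f *+ m).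
Proof.
move=> [S h] hf; have hS := (fil_acts m h).1 hf.
apply: (fil_acts _ (acts_sub (acts_grade h) (acts_Mn m h))).2 => a x am.
have [lt|ge] := ltnP (mdeg a) m; first by rewrite hS // !mul0rn subrr.
by rewrite (_ : mdeg a = m) ?subrr //; apply/eqP; rewrite eqn_leq ge -ltnS am.
Qed.

Section LieAlgebra.
Variable D : (F -> F) -> Prop.
Hypothesis D0 : D (fun=> 0).
Hypothesis DD : forall A B, D A -> D B -> D (fun x => A x + B x).
Hypothesis DN : forall A, D A -> D (fun x => - A x).
Hypothesis DZ : forall m A, D A -> D (fun x => (m`!%:R)^-1 * A x).
Hypothesis Dbr : forall A B, D A -> D B -> D (fun x => A (B x) - B (A x)).
Hypothesis Dadd : forall A, D A -> addop A.

Definition gg f := exists2 S, (forall a, D (S a)) /\ S (mi0 n) = (fun=> 0) & acts S f.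

Lemma mdeg0 : mdeg (mi0 n) = 0%N.
Proof. by rewrite /mdeg big1. Qed.

Lemma mdeg_eq0_mi0 a : mdeg a = 0%N -> a = mi0 n.
Proof.
move=> h; apply/funext => i; have := leq_mdeg a i; rewrite h leqn0 => /eqP; exact.
Qed.

Lemma ggP S f : acts S f -> gg f <-> (forall a, D (S a)) /\ S (mi0 n) = (fun=> 0).
Proof.
by move=> h; split=> [[T hT hf]|hS]; [rewrite (acts_inj h hf)|exists S].
Qed.

Lemma gg_fil f : gg f -> fil 1 f.
Proof.
move=> [S [_ h0] h]; apply: (fil_acts _ h).2 => a x; rewrite ltnS leqn0 => /eqP/mdeg_eq0_mi0 ->.
by rewrite h0.
Qed.

Lemma ggD f g : gg f -> gg g -> gg (f + g).
Proof.
move=> [S [hS S0] hf] [T [hT T0] hg]; eexists; last exact: acts_add hf hg.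
by split=> [a|]; [exact: DD|apply/funext => x; rewrite S0 T0 addr0].
Qed.

Lemma ggN f : gg f -> gg (- f).
Proof.
move=> [S [hS S0] hf]; eexists; last exact: acts_opp hf.
by split=> [a|]; [exact: DN|apply/funext => x; rewrite S0 oppr0].
Qed.

Lemma ggq m f : gg f -> gg (qend m * f).
Proof.
move=> [S [hS S0] hf]; eexists; last exact: acts_q m _ _ hf.
by split=> [a|]; [exact: DZ|apply/funext => x; rewrite S0 mulr0].
Qed.

Lemma gg0 : gg 0.
Proof. by eexists; last exact: acts_zero. Qed.

Lemma D_sum (I : Type) (r : seq I) (P : pred I) (A : I -> F -> F) :
  (forall i, P i -> D (A i)) -> D (fun x => \sum_(i <- r | P i) A i x).
Proof.
move=> h; elim: r => [|i r IH].
  by rewrite (_ : (fun _ => _) = (fun=> 0)) //; apply/funext => x; rewrite big_nil.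
have [Pi|nPi] := boolP (P i).
  rewrite (_ : (fun _ => _) = (fun x => A i x + \sum_(j <- r | P j) A j x)).
    by apply: DD => //; exact: h.
  by apply/funext => x; rewrite big_cons Pi.
rewrite (_ : (fun _ => _) = (fun x => \sum_(j <- r | P j) A j x)) //.
by apply/funext => x; rewrite big_cons (negPf nPi).
Qed.

(** Once the second product is summed in reverse order, each coefficient of the commutator is a sum
    of brackets of elements of [D]. *)
Lemma ggR f g : gg f -> gg g -> gg (f * g - g * f).
Proof.
move=> [S [hS S0] hf] [T [hT T0] hg].
eexists; last exact: acts_sub (acts_mul hf hg) (acts_mul hg hf).
have e a : (fun x => gmul S T a x - gmul T S a x) =
    (fun x => msum a (fun b => S b (T (misub a b) x) - T (misub a b) (S b x))).
  apply/funext => x; rewrite /gmul [X in _ - X]msum_rev -msumB; apply: eq_msum => b ba.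
  by rewrite misubK.
split=> [a|]; rewrite e; first by apply: D_sum => b _; exact: Dbr.
apply/funext => x; rewrite -[RHS](msum0 _ (mi0 n)); apply: eq_msum => b /mileP b0.
have -> : b = mi0 n by apply/funext => i; have := b0 i; rewrite leqn0 => /eqP.
by rewrite S0 (_ : misub _ _ = mi0 n) ?T0 ?subrr //; apply/funext => i.
Qed.

Lemma gg_grade f : gg f -> gg (eps * f - f * eps).
Proof.
move=> [S [hS S0] hf]; eexists; last exact: acts_grade hf.
split=> [a|]; last by apply/funext => x; rewrite S0 mul0rn.
elim: (mdeg a) => [|m IH]; first by rewrite (_ : (fun _ => _) = (fun=> 0)).
rewrite (_ : (fun _ => _) = (fun x => S a x + S a x *+ m)); first exact: DD.
by apply/funext => x; rewrite mulrS.
Qed.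

(* The coefficients of each degree stabilise along the sequence. *)
Lemma gg_limit (f : nat -> E) : (forall m, gg (f m)) ->
  (forall m, fil m.+1 (f m.+1 - f m)) -> exists2 g, gg g & forall m, fil m.+1 (g - f m).
Proof.
move=> hg hc.
have /choice[S hS] : forall m, exists S, acts S (f m) by move=> m; have [S _ h] := hg m; exists S.
have hD m := (ggP (hS m)).1 (hg m).
have st m l a : (mdeg a < m.+1)%N -> (m <= l)%N -> S l a = S m a.
  move=> am; elim: l => [|l IH]; first by rewrite leqn0 => /eqP ->.
  rewrite leq_eqVlt => /predU1P[<- //|ml]; rewrite ltnS in ml.
  rewrite -(IH ml); apply: (cong_acts l.+1 (hS l.+1) (hS l)).1 (hc l) _ _.
  by rewrite (leq_trans am).
pose S' a := S (mdeg a) a.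
have [g hg'] : exists g, acts S' g.
  by apply: acts_ex => a; apply: Dadd; exact: (hD (mdeg a)).1.
exists g.
  apply: (ggP hg').2; split=> [a|]; first exact: (hD (mdeg a)).1.
  exact: (hD (mdeg (mi0 n))).2.
move=> m; apply: (cong_acts m.+1 hg' (hS m)).2 => a am.
by rewrite /S' (st (mdeg a) m a).
Qed.

Lemma gg_closed f : (forall m, exists2 g, gg g & fil m (f - g)) -> gg f.
Proof.
move=> h; have /choice[g hg] : forall m, exists g, gg g /\ fil m.+1 (f - g).
  by move=> m; have [g g1 g2] := h m.+1; exists g.
have [|m|f' gf' hf'] := gg_limit (f := g).
- by move=> m; have [] := hg m.
- rewrite (_ : _ - _ = (f - g m) - (f - g m.+1)).
    by apply: filD; [have [] := hg m|apply: filN; apply: filS; have [] := hg m.+1].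
  by rewrite opprB [RHS]addrC addrA subrK.
suff -> : f = f' by [].
apply/eqP; rewrite -subr_eq0; apply/eqP; apply: fil_sep => m; apply: filS.
rewrite (_ : _ - _ = (f - g m) - (f' - g m)).
  by apply: filD; [have [] := hg m|apply: filN].
by rewrite opprB addrA subrK.
Qed.

(** [Exp] is specified on [gg] only, through the series that acts; elsewhere it takes the default
    value 0. *)
Lemma Exp_ex : exists Exp : E -> E, forall S f, (forall a, D (S a)) -> S (mi0 n) = (fun=> 0) ->
  acts S f -> acts (gexp S) (Exp f).
Proof.
have h f : exists g, forall S, (forall a, D (S a)) -> S (mi0 n) = (fun=> 0) ->
    acts S f -> acts (gexp S) g.
  have [[S [hS S0] hf]|no] := pselect (gg f); last first.
    by exists 0 => S hS S0 hf; case: no; exists S.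
  have [|g hg] := @acts_ex (gexp S).
    move=> a x y; rewrite /gexp -big_split; apply: eq_bigr => m _ /=.
    by have [-> _] := acts_pow m hf; rewrite mulrDr.
  by exists g => T _ _ hT; rewrite (acts_inj hT hf).
have /choice[Exp hExp] := h.
by exists Exp => S f hS S0 hf; exact: hExp.
Qed.

(** The i-th power of an element of order 1 has order i, so in degrees below m it makes no
    difference whether the exponential is cut at m or at the degree of the coefficient. *)
Lemma gexp_trunc S f g m : gg f -> acts S f -> acts (gexp S) g ->
  fil m (g - etrunc qend m f).
Proof.
move=> gf hf hg.
have ht : acts (fun a x => \sum_(i < m) (i`!%:R)^-1 * gpow S i a x) (etrunc qend m f).
  by apply: acts_sum => i; apply: acts_q; exact: acts_pow.
apply: (cong_acts m hg ht).2 => a am; apply/funext => x; rewrite /gexp.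
rewrite (big_ord_widen m (fun i => (i`!%:R)^-1 * gpow S i a x) am) big_mkcond /=.
apply: eq_bigr => i _; case: ifPn => //; rewrite -leqNgt => ai.
have fi : fil i (f ^+ i).
  by have := I_exp (@fil0 _ _ _) (@filM _ _ _) i (gg_fil gf); rewrite mul1n.
by rewrite (fil_acts i (acts_pow i hf)).1 ?mulr0.
Qed.

End LieAlgebra.
End SeriesAction.

(** * Lifting cocycles of series with coefficients in a Lie algebra of operators *)

Section LiftSeries.
Variables (F : fieldType) (n : nat).
Hypothesis natF : forall m, (m.+1%:R : F) != 0.
Local Notation ser := (mi n -> F -> F).
Local Notation E := (fend (@mdeg n) F).
Variable D : (F -> F) -> Prop.
Hypothesis D0 : D (fun=> 0).
Hypothesis DD : forall A B, D A -> D B -> D (fun x => A x + B x).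
Hypothesis DN : forall A, D A -> D (fun x => - A x).
Hypothesis DZ : forall m A, D A -> D (fun x => (m`!%:R)^-1 * A x).
Hypothesis Dbr : forall A B, D A -> D B -> D (fun x => A (B x) - B (A x)).
Hypothesis Dadd : forall A, D A -> addop A.
Variables (T : Type) (mul : T -> T -> T) (G : T -> Prop) (tw un : T -> F -> F).
Hypothesis Gmul : forall g h, G g -> G h -> G (mul g h).
Hypothesis mulTA : forall g h l, mul (mul g h) l = mul g (mul h l).
Hypothesis twD : forall g, G g -> addop (tw g).
Hypothesis unD : forall g, G g -> addop (un g).
Hypothesis twK : forall g x, G g -> un g (tw g x) = x.
Hypothesis unK : forall g x, G g -> tw g (un g x) = x.
Hypothesis tw_mul : forall g h x, G g -> G h -> tw (mul g h) x = tw h (tw g x).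
Hypothesis un_mul : forall g h x, G g -> G h -> un (mul g h) x = un g (un h x).
Hypothesis Dconj : forall g A, G g -> D A -> D (fun x => tw g (A (un g x))).
Hypothesis H2D : forall c : T -> T -> F -> F, (forall g h, G g -> G h -> D (c g h)) ->
  (forall g h l, G g -> G h -> G l -> forall x,
     tw l (c g h (un l x)) + c (mul g h) l x = c g (mul h l) x + c h l x) ->
  exists b, (forall g, G g -> D (b g)) /\ forall g h, G g -> G h -> forall x,
     c g h x = tw h (b g (un h x)) + b h x - b (mul g h) x.

Lemma conj_ex : exists sg : T -> E -> E, forall g, G g -> forall (f : E) u a,
  sg g f u a = tw g (f (fun b => un g (u b)) a).
Proof.
have h (p : T * E) : exists f' : E, G p.1 -> forall u a,
    f' u a = tw p.1 (p.2 (fun b => un p.1 (u b)) a).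
  case: p => g f /=; have [Gg|] := pselect (G g); last by exists 0.
  pose f' u a := tw g (f (fun b => un g (u b)) a).
  have f1 u v a : f' (fun b => u b + v b) a = f' u a + f' v a.
    rewrite /f' -twD // -fend_add; congr (tw g (f _ a)).
    by apply/funext => b; rewrite unD.
  have f2 m u : vanish (@mdeg n) m u -> vanish (@mdeg n) m (f' u).
    move=> hu a am; rewrite /f' (fend_vanish f (m := m)) ?(addop0 (twD Gg)) // => b bm.
    by rewrite hu // (addop0 (unD Gg)).
  by exists (Fend f1 f2).
by have /choice[sg hsg] := h; exists (fun g f => sg (g, f)) => g Gg f u a; rewrite (hsg (g, f)).
Qed.

Variable sg : T -> E -> E.
Hypothesis sgE : forall g, G g -> forall (f : E) u a,
  sg g f u a = tw g (f (fun b => un g (u b)) a).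

Lemma acts_conj g (S : ser) f : G g -> acts S f -> acts (fun b x => tw g (S b (un g x))) (sg g f).
Proof.
move=> Gg [hS hf]; split=> [a x y|u a]; first by rewrite unD // hS twD.
by rewrite sgE // hf (addop_msum _ _ (twD Gg)).
Qed.

Lemma conj_fendD g (f f' : E) : G g -> sg g (f + f') = sg g f + sg g f'.
Proof. by move=> Gg; apply: fendP => u a; rewrite fendDE !sgE // fendDE twD. Qed.

Lemma conj_fendM g (f f' : E) : G g -> sg g (f * f') = sg g f * sg g f'.
Proof.
move=> Gg; apply: fendP => u a; rewrite fendME !sgE // fendME; congr (tw g (f _ a)).
by apply/funext => b; rewrite sgE // twK.
Qed.

Lemma conj_fend1 g : G g -> sg g 1 = 1.
Proof. by move=> Gg; apply: fendP => u a; rewrite sgE // [LHS]unK. Qed.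

Lemma conj_fil g m (f : E) : G g -> fil m f -> fil m (sg g f).
Proof.
move=> Gg hf l u hu a am; rewrite sgE // (hf l) ?(addop0 (twD Gg)) // => b bl.
by rewrite hu // (addop0 (unD Gg)).
Qed.

Lemma conj_gg g (f : E) : G g -> gg D f -> gg D (sg g f).
Proof.
move=> Gg [S [hS S0] hf]; exists (fun b x => tw g (S b (un g x))); last exact: acts_conj.
by split=> [a|]; [exact: Dconj|apply/funext => x; rewrite S0 (addop0 (twD Gg))].
Qed.

Lemma conj_mul g h (f : E) : G g -> G h -> sg (mul g h) f = sg h (sg g f).
Proof.
move=> Gg Gh; have Ggh := Gmul Gg Gh; apply: fendP => u a; rewrite !sgE // tw_mul //.
by congr (tw h (tw g (f _ a))); apply/funext => b; rewrite un_mul.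
Qed.

(** The group acts on each coefficient separately, so the congruence amounts to one 2-cocycle
    relation in [D] for every multi-index of degree m + 1. The primitive is put together from these
    and set to 0 in all other degrees. *)
Lemma gg_coboundary m (y : T -> T -> E) :
  (forall g h, G g -> G h -> gg D (y g h) /\ fil m.+1 (y g h)) ->
  (forall g h l, G g -> G h -> G l ->
     fil m.+2 (sg l (y g h) + y (mul g h) l - (y g (mul h l) + y h l))) ->
  exists b : T -> E, (forall g, G g -> gg D (b g) /\ fil m.+1 (b g)) /\
    forall g h, G g -> G h -> fil m.+2 (y g h - (sg h (b g) + b h - b (mul g h))).
Proof.
move=> hy cy.
have exS (p : T * T) : exists S : ser, G p.1 -> G p.2 -> acts S (y p.1 p.2).
  case: p => g h /=; have [Gg|] := pselect (G g); last by exists (fun _ _ => 0).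
  have [Gh|] := pselect (G h); last by exists (fun _ _ => 0).
  by have [[S _ hS] _] := hy _ _ Gg Gh; exists S.
have /choice[S' hS'] := exS; pose S g h := S' (g, h).
have hS g h : G g -> G h -> acts (S g h) (y g h) by exact: (hS' (g, h)).
have DS g h : G g -> G h -> forall a, D (S g h a).
  by move=> Gg Gh; have [/(ggP D (hS _ _ Gg Gh))[]] := hy _ _ Gg Gh.
have exb (a : mi n) : exists b : T -> F -> F, mdeg a = m.+1 -> (forall g, G g -> D (b g)) /\
    forall g h, G g -> G h -> forall x, S g h a x = tw h (b g (un h x)) + b h x - b (mul g h) x.
  have [am|] := pselect (mdeg a = m.+1); last by exists (fun _ _ => 0).
  have [||b hb] := H2D (c := fun g h => S g h a); last by exists b.
    by move=> g h Gg Gh; exact: DS.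
  move=> g h l Gg Gh Gl x; have Ggh := Gmul Gg Gh; have Ghl := Gmul Gh Gl.
  have A1 := acts_add (acts_conj Gl (hS _ _ Gg Gh)) (hS _ _ Ggh Gl).
  have A2 := acts_add (hS _ _ Gg Ghl) (hS _ _ Gh Gl).
  have := (cong_acts m.+2 A1 A2).1 (cy _ _ _ Gg Gh Gl) a.
  by rewrite am ltnSn => /(_ isT) /(congr1 (@^~ x)).
have /choice[b hb] := exb.
pose B g a := if mdeg a == m.+1 then b a g else fun=> 0.
have DB g a : G g -> D (B g a).
  by move=> Gg; rewrite /B; case: eqP => [e|_]; [exact: (hb a e).1|exact: D0].
have /choice[be hbe] : forall g, exists f, G g -> acts (B g) f.
  move=> g; have [Gg|] := pselect (G g); last by exists 0.
  by have [f hf] := acts_ex (fun a => Dadd (DB g a Gg)); exists f.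
exists be; split=> [g Gg|g h Gg Gh].
  split; first apply: (ggP D (hbe g Gg)).2.
    by split=> [a|]; [exact: DB|rewrite /B mdeg0].
  by apply: (fil_acts _ (hbe g Gg)).2 => a x am; rewrite /B (ltn_eqF am).
have Ggh := Gmul Gg Gh.
have A1 := acts_sub (acts_add (acts_conj Gh (hbe g Gg)) (hbe h Gh)) (hbe _ Ggh).
apply: (cong_acts m.+2 (hS _ _ Gg Gh) A1).2 => a.
rewrite ltnS leq_eqVlt => /predU1P[am|am]; apply/funext => x; rewrite /B.
  by rewrite am eqxx; exact: (hb a am).2.
have [_ fy] := hy _ _ Gg Gh; rewrite ((fil_acts _ (hS _ _ Gg Gh)).1 fy _ _ am) (ltn_eqF am).
by rewrite (addop0 (twD Gh)) addr0 subr0.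
Qed.

Lemma lift_series_conj (a : 'I_n -> T -> F -> F) :
  (forall i g, G g -> D (a i g)) ->
  (forall i g h, G g -> G h -> forall x, a i (mul g h) x = tw h (a i g (un h x)) + a i h x) ->
  exists S : T -> ser,
    (forall g, G g -> [/\ forall b, D (S g b), S g (mi0 n) = (fun=> 0),
       gexp (S g) (mi0 n) = id & forall i, gexp (S g) (mi_unit i) = a i g]) /\
    forall g h, G g -> G h ->
      gexp (S (mul g h)) = gmul (fun b x => tw h (gexp (S g) b (un h x))) (gexp (S h)).
Proof.
move=> Da ca; have [Exp hExp] := Exp_ex n D.
(* The series with linear part sum of a_i rho_i and no other terms: a multi-index of degree 1 has
   exactly one entry equal to 1, so the inner sum has a single term. *)
pose S1 g : ser := fun b x => if mdeg b == 1%N then \sum_(i | b i == 1%N) a i g x else 0.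
have DS1 g b : G g -> D (S1 g b).
  move=> Gg; rewrite /S1; case: eqP => _ //; apply: D_sum => // i _; exact: Da.
have /choice[X1 hX1] : forall g, exists f, G g -> acts (S1 g) f.
  move=> g; have [Gg|] := pselect (G g); last by exists 0.
  by have [f hf] := acts_ex (fun b => Dadd (DS1 g b Gg)); exists f.
have gX1 g : G g -> gg D (X1 g).
  move=> Gg; apply: (ggP D (hX1 g Gg)).2; split=> [b|]; first exact: DS1.
  by rewrite /S1 mdeg0.
have cX1 g h : G g -> G h -> X1 (mul g h) = sg h (X1 g) + X1 h.
  move=> Gg Gh; have Ggh := Gmul Gg Gh.
  apply: (acts_eq (hX1 _ Ggh)); rewrite (_ : S1 _ = (fun b x => tw h (S1 g b (un h x)) + S1 h b x)).
    exact: acts_add (acts_conj Gh (hX1 g Gg)) (hX1 h Gh).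
  apply/funext => b; apply/funext => x; rewrite /S1; case: eqP => _; last first.
    by rewrite (addop0 (twD Gh)) addr0.
  rewrite (big_morph _ (twD Gh) (addop0 (twD Gh))) -big_split /=.
  by apply: eq_bigr => i _; exact: ca.
have exE f : gg D f -> exists2 S, (forall b, D (S b)) /\ S (mi0 n) = (fun=> 0) &
    acts S f /\ acts (gexp S) (Exp f).
  by move=> [S [hS S0] hf]; exists S => //; split=> //; exact: hExp.
have ExpS f : gg D f -> Ser (Exp f) by move=> /exE[S _ [_ h]]; exists (gexp S).
have ExpP f m : gg D f -> cong (@fil _ _ _) m (Exp f) (etrunc (qend F n) m f).
  by move=> hf; have [S _ [h1 h2]] := exE f hf; exact: (gexp_trunc hf h1 h2).
have g0 : gg D (0 : E) := gg0 n D0.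
have [X [gX cX EX]] := @lift_cocycle E (@fil _ _ _) (@fil0 _ _ _) (@filD _ _ _) (@filN _ _ _)
  (@filM _ _ _) (@filS _ _ _) (@fil_sep _ _ _) (@fil00 _ _ _) (qend F n) (@qendC F n natF) (@qendP F n natF)
  (@Ser F n) (gg D) (fgrade (@mdeg n) F) Exp (@SerM F n) (@SerB F n) (@Ser1 F n) (@Ser_grade F n)
  (@gg_fil F n D) (ggD DD) (ggN DN) (ggq DZ) (ggR D0 DD Dbr) (gg_grade D0 DD) (gg_closed Dadd)
  g0 ExpS ExpP T mul G sg Gmul mulTA conj_fendD conj_fendM conj_fend1 conj_fil conj_gg conj_mul
  gg_coboundary (gg_limit Dadd) X1
  (cocyc2 (@fil0 _ _ _) (@filD _ _ _) (@filN _ _ _) (@filM _ _ _) (@fil00 _ _ _) (@qendP F n natF) (@gg_fil F n D)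
     ExpP Gmul conj_fendD conj_fend1 conj_fil gX1 cX1).
have /choice[S hS] : forall g, exists S, G g ->
    [/\ forall b, D (S b), S (mi0 n) = (fun=> 0) & acts (gexp S) (Exp (X g))].
  move=> g; have [Gg|] := pselect (G g); last by exists (fun _ _ => 0).
  by have [S [hS S0] [_ h]] := exE _ (gX _ Gg); exists S.
exists S; split=> [g Gg|g h Gg Gh]; last first.
  have Ggh := Gmul Gg Gh; have [_ _ h1] := hS _ Gg; have [_ _ h2] := hS _ Gh.
  have [_ _ h3] := hS _ Ggh; apply: (acts_inj h3); rewrite -EX //.
  exact: acts_mul (acts_conj Gh h1) h2.
have [hD h0 hE] := hS g Gg.
have c2 : cong (@fil _ _ F) 2 (Exp (X g)) (1 + X1 g).
  apply: (cong_trans (@filD _ _ _) (Exp2 (@filD _ _ _) (@fil00 _ _ _) (@qendP F n natF) ExpP (gX g Gg))).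
  exact: (congD (@filD _ _ _) (cong_refl (@fil00 _ _ _) 2 1) (cX g Gg)).
have h1 b : (mdeg b < 2)%N -> gexp (S g) b = (fun x => gone b x + S1 g b x).
  exact: (cong_acts 2 hE (acts_add (acts_one F n) (hX1 g Gg))).1 c2 b.
have hu (i : 'I_n) : mdeg (mi_unit i) = 1%N.
  by rewrite /mdeg (bigD1 i) //= /mi_unit eqxx big1 // => j /negPf ->.
split=> // [|i]; rewrite h1 ?mdeg0 ?hu //; apply/funext => x; rewrite /gone /S1 -mdeg_eq0.
  by rewrite mdeg0 addr0.
rewrite hu /= add0r (big_pred1 i) // => j; by rewrite /mi_unit /= eqb1.
Qed.

End LiftSeries.

(** * The main theorem *)

Section OperatorCohomology.
Variables (R : realType) (k : int) (G : set 'M[R]_2).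
Hypothesis sG : subgroup_SL2 G.
Hypothesis fG : mobius_free G.
Hypothesis finG : bil_finite G.
Local Notation K := {fraction {poly R[i]}}.
Local Notation M2 := 'M[R]_2.

Lemma in_dk_invn m (A : Op R) : in_dk k A -> in_dk k (fun x => (m`!%:R)^-1 * A x).
Proof.
by move=> hA; have := in_dkZ (m`!%:R)^-1 hA; rewrite fmorphV rmorph_nat.
Qed.

(** By [dop_inj] the operator identity splits into cocycle identities for the real and the imaginary
    coefficient vectors, and [h2_vanish] solves each of them. *)
Lemma h2_dk_vanish (c : M2 -> M2 -> Op R) :
  (forall g h, G g -> G h -> in_dk k (c g h)) ->
  (forall g h l, G g -> G h -> G l -> forall x,
     twist k l (c g h (untwist k l x)) + c (g *m h) l x = c g (h *m l) x + c h l x) ->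
  exists b : M2 -> Op R, (forall g, G g -> in_dk k (b g)) /\ forall g h, G g -> G h ->
    forall x, c g h x = twist k h (b g (untwist k h x)) + b h x - b (g *m h) x.
Proof.
move=> hc cc; have [_ dG GM _] := sG.
have /choice[v hv] : forall p : M2 * M2, exists v : (R * R * R) * (R * R * R),
    G p.1 -> G p.2 -> c p.1 p.2 = dop k v.1 v.2.
  move=> [g h] /=; have [Gg|] := pselect (G g); last by exists (0, 0).
  have [Gh|] := pselect (G h); last by exists (0, 0).
  by have /in_dkP[x [y e]] := hc g h Gg Gh; exists (x, y).
pose x g h := (v (g, h)).1; pose y g h := (v (g, h)).2.
have cE g h : G g -> G h -> c g h = dop k (x g h) (y g h) by exact: (hv (g, h)).
have cxy g h l : G g -> G h -> G l ->
    x (g *m h) l + fact (x g h) l = x g (h *m l) + x h l /\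
    y (g *m h) l + fact (y g h) l = y g (h *m l) + y h l.
  move=> Gg Gh Gl; apply: (@dop_inj _ k); apply/funext => f; rewrite !dopD -!cE //; try exact: GM.
  by rewrite -(cc g h l) // addrC -dop_slash ?dG // -cE.
have [br hbr] := h2_vanish sG fG finG (fun g h l Gg Gh Gl => (cxy g h l Gg Gh Gl).1).
have [bi hbi] := h2_vanish sG fG finG (fun g h l Gg Gh Gl => (cxy g h l Gg Gh Gl).2).
exists (fun g => dop k (br g) (bi g)); split=> [g Gg|g h Gg Gh f].
  by apply/in_dkP; exists (br g), (bi g).
rewrite cE // hbr // hbi // !dopD dopN; congr (_ + _ - _).
by rewrite -dop_slash ?dG.
Qed.

End OperatorCohomology.

Theorem theorem3p12 (R : realType) (G : set 'M[R]_2) (k : int) (n : nat)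
    (a : 'I_n -> 'M[R]_2 -> Op R) :
  fuchsian G -> acts_freely G -> acts_properly_discontinuously G ->
  (forall i, Z1_dk G k (a i)) ->
  exists2 A : 'M[R]_2 -> series R n, Z1_Dk G k A &
    forall g, G g ->
      A g (mi0 n) = (fun f => f) /\
      (forall i, A g (mi_unit i) = a i g).
Proof.
move=> [sG _] freeG pdG Za; have [_ dG GM _] := sG.
have fG := freeP sG freeG; have finG := finiteP sG pdG.
have [sg sgE] := @conj_ex {fraction {poly R[i]}} n _ G (twist k) (untwist k)
  (fun g Gg x y => twistD k x y (dG g Gg)) (fun g Gg x y => untwistD k x y (dG g Gg)).
have [S [hS cS]] := @lift_series_conj _ n (@natK_neq0 R) (in_dk k) (in_dk0 R k) (@in_dkD R k)
  (@in_dkN R k) (in_dk_invn (k := k)) (@in_dk_bracket R k) (fun A hA x y => in_dk_add x y hA)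
  _ (@mulmx R 2 2 2) G (twist k) (untwist k) GM (fun g h l => esym (mulmxA g h l))
  (fun g Gg x y => twistD k x y (dG g Gg)) (fun g Gg x y => untwistD k x y (dG g Gg))
  (fun g x Gg => twistK k x (dG g Gg)) (fun g x Gg => untwistK k x (dG g Gg))
  (fun g h x Gg Gh => twist_mul k x (dG g Gg) (dG h Gh))
  (fun g h x Gg Gh => untwist_mul k x (dG g Gg) (dG h Gh))
  (fun g A Gg => in_dk_slash (dG g Gg)) (h2_dk_vanish (k := k) sG fG finG) sg sgE a
  (fun i => (Za i).1) (fun i g h Gg Gh x => congr1 (@^~ x) ((Za i).2 g h Gg Gh)).
exists (fun g => sexp (S g)); last by move=> g /hS[_ _ h0 h1].
split=> [g /hS[h1 h2 _ _]|g h Gg Gh]; last exact: cS.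
by exists (S g) => //; split.
Qed.
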